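(* The map $\hat\chi\colon\mathbb C^\times\to\widehat{\mathcal P}(\mathbb C)$ defined by $$\hat\chi(z)=\begin{cases}0&\text{if }z=1,\\ \hat\kappa&\text{if }z=-1,\\ \{z^2+0i;0\}&\text{if }\mathrm{Arg}\,z\in(-\tfrac\pi2,\tfrac\pi2]\text{ and }z\neq1,\\ \{z^2+0i;2\}&\text{if }\mathrm{Arg}\,z\notin(-\tfrac\pi2,\tfrac\pi2]\text{ and }z\neq-1\end{cases}$$ is a group homomorphism, and the sequence $$0\longrightarrow\mathbb C^\times\xrightarrow{\ \hat\chi\ }\widehat{\mathcal P}(\mathbb C)\longrightarrow\mathcal P(\mathbb C)\longrightarrow0$$ is exact and split, where the right arrow is induced by $\hat\pi\colon(z;2p,2q)\mapsto z$.
   Context: Let $\mathbb C_{\mathrm{cut}}=\mathbb C\setminus((-\infty,0]\cup[1,\infty))$ and let $\overline{\mathbb C}_{\mathrm{cut}}$ be $\mathbb C_{\mathrm{cut}}$ together with, for each $x\in(-\infty,0)\cup(1,\infty)$, two boundary points $x\pm0i=\lim_{t\searrow0}(x\pm ti)$; for a complex number $w$, $w+0i$ denotes the upper boundary point if $w\in(-\infty,0)\cup(1,\infty)$ and $w$ itself otherwise. The principal branches of $\mathrm{Log}$, $\mathrm{Li}_2$ and $\mathrm{Arg}$ (with $\mathrm{Arg}\in(-\pi,\pi]$ on $\mathbb C^\times$) are extended to $\overline{\mathbb C}_{\mathrm{cut}}$ by continuity from the respective side. Let $\widehat{\mathbb C}$ be the quotient of $\overline{\mathbb C}_{\mathrm{cut}}\times(2\mathbb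 Z)^2$ by $(x+0i,2p,2q)\sim(x-0i,2p+2,2q)$ for $x\in(-\infty,0)$ and $(x+0i,2p,2q)\sim(x-0i,2p,2q+2)$ for $x\in(1,\infty)$ ($p,q\in\mathbb Z$); classes are written $(z;2p,2q)$, and $\hat\pi(z;2p,2q)=z\in\mathbb C\setminus\{0,1\}$. Let $\mathrm{FT}=\{(x,y,\tfrac yx,\tfrac{1-1/x}{1-1/y},\tfrac{1-x}{1-y}) : x\neq y\in\mathbb C\setminus\{0,1\}\}$, $\mathrm{FT}^+$ the subset where all five entries have positive imaginary part, and $\widehat{\mathrm{FT}}$ the connected component of $\hat\pi^{-1}(\mathrm{FT})\subset\widehat{\mathbb C}^5$ containing all $((z_0;0,0),\dots,(z_4;0,0))$ with $(z_0,\dots,z_4)\in\mathrm{FT}^+$. The extended pre-Bloch group $\widehat{\mathcal P}(\mathbb C)$ is the quotient of the free abelian group $\mathbb Z[\widehat{\mathbb C}]$ by the subgroup generated by all $\sum_{k=0}^4(-1)^k[\hat z_k]$ with $(\hat z_0,\dots,\hat z_4)\in\widehat{\mathrm{FT}}$; the image of $(z;2p,2q)$ is denoted $[z;2p,2q]$. The pre-Bloch group $\mathcal P(\mathbb C)$ is the quotient of $\mathbb Z[\mathbb C\setminus\{0,1\}]$ by the subgroup generated by $[z_0]-[z_1]+[z_2]-[z_3]+[z_4]$ for $(z_0,\dots,z_4)\in\mathrm{FT}$. For $z\in\overline{\mathbb C}_{\mathrm{cut}}$ and $p\in\mathbb Z$ put $\{z;2p\}=[z;2p,2]-[z;2p,0]$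 (in $\widehat{\mathcal P}(\mathbb C)$ this equals $[z;2p,2q]-[z;2p,2q-2]$ for every $q$), and let $\hat\kappa=\{z;2p\}-\{z;2p-2\}$, an element of $\widehat{\mathcal P}(\mathbb C)$ independent of $z\in\mathbb C\setminus\{0,1\}$ and $p\in\mathbb Z$. *)

(* Defs.v *)
From HB Require Import structures.
From mathcomp Require Import all_boot all_order all_algebra.
From mathcomp Require Import all_classical all_reals.
From mathcomp Require Import topology normedtype trigo.
From mathcomp.real_closed Require Import complex.
From mathcomp.multinomials Require Export freeg.
Import numFieldNormedType.Exports.

Set Implicit Arguments.
Unset Strict Implicit.
Unset Printing Implicit Defensive.

Import Order.TTheory GRing.Theory Num.Theory.
Local Open Scope ring_scope.
Local Open Scope classical_set_scope.
Local Open Scope complex_scope.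

Section ExtendedPreBloch.
Context {R : realType}.
Local Notation C := R[i].

Definition Arg (z : C) : R :=
  let: a +i* b := z in
  if 0 < a then atan (b / a)
  else if a < 0 then (if 0 <= b then atan (b / a) + pi else atan (b / a) - pi)
  else if 0 < b then pi / 2 else if b < 0 then - (pi / 2) else 0.

Definition Cx01 : Type := {z : C | (z != 0) && (z != 1)}.

(* The space \hat C.  As a set it is (C\{0,1}) x Z x Z: the element
   with value (w, p, q) represents the class (w + 0i ; 2p, 2q) (upper
   boundary point when w lies on a cut).  Its topology is the quotient
   topology described below.                                           *)
Definition Chat_carrier : Type :=
  {x : C * int * int | (x.1.1 != 0) && (x.1.1 != 1)}.
Definition Chat : Type := Chat_carrier.
HB.instance Definition _ := Choice.on Chat.

Definition chz (x : Chat) : C := (val x).1.1.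

(* \bar C_cut is the union of the closed upper half plane (side true)
   and of the closed lower half plane (side false) minus {0,1}, glued
   along (0,1); a boundary point x+0i (resp. x-0i) is the point x of
   the closed upper (resp. lower) half plane.  Points are given by
   their coordinates (Re, Im) in R * R.                                *)
Definition Hside (s : bool) (w : R * R) : Prop :=
  (if s then 0 <= w.2 else w.2 <= 0) /\ w <> (0, 0) /\ w <> (1, 0).

(* The projection  \bar C_cut x (2Z)^2 -> \hat C:
   (w + 0i; 2p, 2q) |-> (w, p, q),
   (x - 0i; 2p, 2q) |-> (x, p - 1, q) for x < 0   [(x+0i,2p-2,2q) ~ (x-0i,2p,2q)],
   (x - 0i; 2p, 2q) |-> (x, p, q - 1) for x > 1   [(x+0i,2p,2q-2) ~ (x-0i,2p,2q)],
   and (w; 2p, 2q) |-> (w, p, q) for w in C_cut.                      *)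
Definition glue (s : bool) (p q : int) (w : R * R) : C * int * int :=
  let z := w.1 +i* w.2 in
  if s then (z, p, q)
  else if (w.2 == 0) && (w.1 < 0) then (z, p - 1, q)
  else if (w.2 == 0) && (1 < w.1) then (z, p, q - 1)
  else (z, p, q).

(* Quotient topology: U is open iff each of its preimages in the pieces
   (closed half plane of side s minus {0,1}) x {(2p,2q)} is relatively
   open.                                                               *)
Definition Chat_open (U : set Chat) : Prop :=
  forall (s : bool) (p q : int) (w : R * R), Hside s w ->
    (exists2 x : Chat, U x & val x = glue s p q w) ->
    \forall w' \near w, Hside s w' ->
       forall x' : Chat, val x' = glue s p q w' -> U x'.

Lemma Chat_openT : Chat_open setT.
Proof. by move=> s p q w _ _; apply: filterE => w' _ x' _. Qed.

Lemma Chat_openI : setI_closed Chat_open.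
Proof.
move=> A B oA oB s p q w Hw [x [Ax Bx] ex].
have NA := oA s p q w Hw (ex_intro2 _ _ x Ax ex).
have NB := oB s p q w Hw (ex_intro2 _ _ x Bx ex).
apply: filterS (filterI NA NB) => w' [HA HB] Hw' x' ex'.
by split; [exact: HA | exact: HB].
Qed.

Lemma Chat_open_bigU (I : Type) (f : I -> set Chat) :
  (forall i, Chat_open (f i)) -> Chat_open (\bigcup_i f i).
Proof.
move=> oF s p q w Hw [x [i _ fxi] ex].
have N := oF i s p q w Hw (ex_intro2 _ _ x fxi ex).
by apply: filterS N => w' H Hw' x' ex'; exists i => //; exact: H.
Qed.

HB.instance Definition _ :=
  isOpenTopological.Build Chat Chat_openT Chat_openI Chat_open_bigU.

Definition pihat (x : Chat) : Cx01 := exist _ (val x).1.1 (valP x).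

Definition tuple5 (T : Type) : Type := (T * T * T * T * T)%type.
Definition map5 (T U : Type) (f : T -> U) (t : tuple5 T) : tuple5 U :=
  let: (a, b, c, d, e) := t in (f a, f b, f c, f d, f e).

Definition FT (t : tuple5 C) : Prop :=
  exists x y : C, [/\ x != y, (x != 0) && (x != 1), (y != 0) && (y != 1) &
    t = (x, y, y / x, (1 - x^-1) / (1 - y^-1), (1 - x) / (1 - y))].

Definition FTplus (t : tuple5 C) : Prop :=
  FT t /\ let: (a, b, c, d, e) := t in
  [/\ 0 < Im a, 0 < Im b, 0 < Im c, 0 < Im d & 0 < Im e].

Definition Chat5 : Type := (Chat * Chat * Chat * Chat * Chat)%type.

Definition pihat5 (u : Chat5) : tuple5 C := map5 chz u.

Definition FTplus_lift (u : Chat5) : Prop :=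
  FTplus (pihat5 u) /\
  let: (a, b, c, d, e) := u in
  [/\ (val a).1.2 = 0 /\ (val a).2 = 0, (val b).1.2 = 0 /\ (val b).2 = 0,
      (val c).1.2 = 0 /\ (val c).2 = 0, (val d).1.2 = 0 /\ (val d).2 = 0 &
      (val e).1.2 = 0 /\ (val e).2 = 0].

(* \hat{FT}: the connected component of pihat^{-1}(FT) containing the
   lifts of FT^+ (taken as the union of the components of those lifts). *)
Definition FThat : set Chat5 :=
  \bigcup_(v in FTplus_lift)
     connected_component (pihat5 @^-1` FT : set Chat5) v.

Definition five_term (K : choiceType) (t : tuple5 K) : {freeg K / int} :=
  let: (a, b, c, d, e) := t in
  << a >> - << b >> + << c >> - << d >> + << e >>.

(* the subgroup of Z[\hat C] defining \hat P(C) *)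
Definition Rhat : set {freeg Chat / int} :=
  [set x | exists s : seq (int * Chat5),
     all (fun a => `[< FThat a.2 >]) s /\
     x = \sum_(a <- s) a.1 *: five_term a.2].

(* the subgroup of Z[C \ {0,1}] defining P(C) *)
Definition Rpre : set {freeg Cx01 / int} :=
  [set y | exists s : seq (int * tuple5 Cx01),
     all (fun a => `[< FT (map5 val a.2) >]) s /\
     y = \sum_(a <- s) a.1 *: five_term a.2].

Definition pistar (x : {freeg Chat / int}) : {freeg Cx01 / int} :=
  fglift (fun k => (<< pihat k >> : {freeg Cx01 / int})) x.

Lemma half_valid : ((2^-1 : C) != 0) && ((2^-1 : C) != 1).
Proof.
apply/andP; split => /=.
  by rewrite invr_eq0 pnatr_eq0.
apply/eqP => h.
have : (2 : C) = 1 by rewrite -[LHS]invrK h invr1.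
by move/eqP; rewrite -subr_eq0 -addrA subrr addr0 oner_eq0.
Qed.

Definition Chat_default : Chat :=
  exist (fun x : C * int * int => (x.1.1 != 0) && (x.1.1 != 1))
    (2^-1, 0, 0) half_valid.

(* mkChat w p q = (w + 0i ; 2p, 2q)  (meaningful for w \notin {0,1}) *)
Definition mkChat (w : C) (p q : int) : Chat := insubd Chat_default (w, p, q).

(* {w + 0i ; 2p} = [w + 0i; 2p, 2] - [w + 0i; 2p, 0] *)
Definition brace (w : C) (p : int) : {freeg Chat / int} :=
  << mkChat w p 1 >> - << mkChat w p 0 >>.

(* \hat kappa = {z;2p} - {z;2p-2}, computed at z = 1/2, p = 0 *)
Definition kappa_hat : {freeg Chat / int} := brace 2^-1 0 - brace 2^-1 (-1).

Definition chi_hat (z : C) : {freeg Chat / int} :=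
  if z == 1 then 0
  else if z == -1 then kappa_hat
  else if (- (pi / 2) < Arg z) && (Arg z <= pi / 2) then brace (z ^+ 2) 0
  else brace (z ^+ 2) 1.

End ExtendedPreBloch.

(* Main.v *)
(* A point of \hat C amounts to a pair (u, v) of logarithms of z and 1 - z, that
   is, a solution of exp u + exp v = 1.  In these coordinates \hat FT consists of
   the lifts of the five-term relation given by linear forms in logarithms of x,
   1 - x, y, 1 - y and x - y: the space of such logarithms is connected, because
   loops of x and y realise every shift by 2 pi i.
   If f(u, v) satisfies the five-term relations, comparing two relations that
   differ by one shift shows that f(u, v - 2 pi i) - f(u, v) = g(u) and
   f(u + 2 pi i, v) - f(u, v) = g(v), with g additive; evaluating
   f(u + 2 pi i, v - 2 pi i) in two ways shows that g has period 4 pi i.  For the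
   universal f this g is \hat chi, by \hat chi(z) = g(2 Log z), and it generates
   the kernel of \hat P(C) -> P(C).
   The lifted dilogarithm ell(u, v) has a five-term sum that is constant modulo
   2 pi i, because its derivative along a path vanishes, and exp ell is multiplied
   by exp(u / 2) when v decreases by 2 pi i.  So it yields a retraction of
   \hat chi, which gives both injectivity and the splitting. *)
Require Import Defs.
From HB Require Import structures.
From mathcomp Require Import all_boot all_order all_algebra.
From mathcomp Require Import all_classical all_reals.
From mathcomp Require Import topology normedtype trigo.
From mathcomp.real_closed Require Import complex.
From mathcomp.multinomials Require Import freeg.
From mathcomp Require Import derive sequences exp realfun measure lebesgue_measure lebesgue_integral ftc.
From mathcomp Require Import ring lra zify.
Import Order.TTheory GRing.Theory Num.Theory.
Import numFieldNormedType.Exports.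
Import ComplexField.Normc.
Local Open Scope ring_scope.
Local Open Scope classical_set_scope.
Local Open Scope complex_scope.
Set Implicit Arguments.
Unset Strict Implicit.
Unset Printing Implicit Defensive.
Local Notation Re := complex.Re.
Local Notation Im := complex.Im.

(** The factor 2 in g(2 Log z) turns the period 4 pi i of g into the period 2 pi i of Log, and the
    factor exp(u / 2) in the monodromy of exp ell then gives back z. The obstacle is that \hat FT is
    given topologically, as a component, while both halves of the argument need it as a solution
    set: the formal half must produce relations with prescribed entries, and the analytic half must
    carry one value of the five-term sum to all of them. The linear equations hold modulo 2 pi i on
    the whole preimage of FT, hence exactly on the component, because the integers involved cannot
    jump; conversely, connectedness of the space of logarithms puts every solution into the
    component. *)

HB.instance Definition _ (R : realType) :=
  NormedModule.copy R[i] (R[i] : numFieldType)^o.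

(** * Limits and continuity of complex-valued functions *)

Section ComplexLimits.
Context {R : realType}.
Local Notation C := R[i].

Lemma normcE (z : C) : `|z| = (normc z)%:C.
Proof. by case: z => a b; rewrite normc_def. Qed.

Lemma normc_Re (z : C) : `|Re z| <= normc z.
Proof. by rewrite -lecR -normcE normc_ge_Re. Qed.

Lemma normc_Im (z : C) : `|Im z| <= normc z.
Proof.
case: z => a b; rewrite /normc /= -sqrtr_sqr ler_wsqrtr//.
by rewrite lerDr sqr_ge0.
Qed.

Lemma normc_le_ReIm (z : C) : normc z <= `|Re z| + `|Im z|.
Proof.
have e : z = (Re z)%:C + 'i%C * (Im z)%:C by rewrite -complexE.
rewrite {1}e (le_trans (le_normcD _ _))// normcM /= expr0n /= addr0 sqrtr_sqr.
by rewrite expr1n add0r addr0 sqrtr1 mul1r sqrtr_sqr.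
Qed.

Lemma normc_ge0 (z : C) : 0 <= normc z.
Proof. by case: z => a b; rewrite sqrtr_ge0. Qed.

Lemma normc_gt0 (z : C) : (0 < normc z) = (z != 0).
Proof. by rewrite -ltcR -normcE normr_gt0. Qed.

Lemma normcR (x : R) : normc x%:C = `|x|.
Proof. by rewrite /normc /= expr0n /= addr0 sqrtr_sqr. Qed.

Section Filter.
Context {T : Type} {F : set_system T} {FF : Filter F}.
Implicit Types (f g : T -> C) (a b : C).

Lemma cvgC_dist f a :
  (f @ F --> a) <-> (forall e : R, 0 < e -> \forall x \near F, normc (a - f x) < e).
Proof.
split=> [h e e0|h].
  have e0' : 0 < e%:C by rewrite ltcR.
  move/(@cvgrPdist_lt R[i] R[i]^o) : h => /(_ _ e0').
  by apply: filterS => x; rewrite normcE ltcR.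
apply/(@cvgrPdist_lt R[i] R[i]^o) => e e0.
have ee : e = (Re e)%:C by rewrite RRe_real// gtr0_real.
rewrite ee; have := h (Re e); rewrite -ltcR -ee => /(_ e0).
by apply: filterS => x; rewrite normcE ee ltcR.
Qed.

Lemma cvgCD f g a b : f @ F --> a -> g @ F --> b -> (fun x => f x + g x) @ F --> a + b.
Proof. exact: (@cvgD R[i] R[i]^o). Qed.

Lemma cvgCN f a : f @ F --> a -> (fun x => - f x) @ F --> - a.
Proof. exact: (@cvgN R[i] R[i]^o). Qed.

Lemma cvgCB f g a b : f @ F --> a -> g @ F --> b -> (fun x => f x - g x) @ F --> a - b.
Proof. by move=> fa gb; exact: (cvgCD fa (cvgCN gb)). Qed.

Lemma cvgCM f g a b : f @ F --> a -> g @ F --> b -> (fun x => f x * g x) @ F --> a * b.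
Proof. exact: (@cvgM R[i]). Qed.

Lemma cvgCV f a : a != 0 -> f @ F --> a -> (fun x => (f x)^-1) @ F --> a^-1.
Proof. exact: (@cvgV R[i]). Qed.

Lemma cvgC_ReIm f a : (fun x => Re (f x)) @ F --> Re a ->
  (fun x => Im (f x)) @ F --> Im a -> f @ F --> a.
Proof.
move=> fr fi; apply/cvgC_dist => e e0.
have e2 : 0 < e / 2 by rewrite divr_gt0.
move/cvgrPdist_lt : fr => /(_ _ e2) fr.
move/cvgrPdist_lt : fi => /(_ _ e2) fi.
apply: filterS2 fr fi => x hr hi.
rewrite (le_lt_trans (normc_le_ReIm _))// [e]splitr ltrD//.
  by move: hr; case: (a) (f x) => [? ?] [? ?].
by move: hi; case: (a) (f x) => [? ?] [? ?].
Qed.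

Lemma cvgC_Re f a : f @ F --> a -> (fun x => Re (f x)) @ F --> Re a.
Proof.
move=> /cvgC_dist h; apply/cvgrPdist_lt => e /h; apply: filterS => x.
by apply: le_lt_trans; rewrite (le_trans _ (normc_Re _))//; case: (a) (f x) => [? ?] [? ?].
Qed.

Lemma cvgC_Im f a : f @ F --> a -> (fun x => Im (f x)) @ F --> Im a.
Proof.
move=> /cvgC_dist h; apply/cvgrPdist_lt => e /h; apply: filterS => x.
by apply: le_lt_trans; rewrite (le_trans _ (normc_Im _))//; case: (a) (f x) => [? ?] [? ?].
Qed.

Lemma cvgC_normc f a : f @ F --> a -> (fun x => normc (f x)) @ F --> normc a.
Proof.
move=> /cvgC_dist h; apply/cvgrPdist_lt => e /h; apply: filterS => x.
apply: le_lt_trans; rewrite ler_norml.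
have := le_normcD (a - f x) (f x); have := le_normcD (f x - a) a.
rewrite !subrK -[f x - a]opprB normcN; lra.
Qed.

End Filter.

Lemma nearC (z : C) (P : set C) :
  (\forall s \near z, P s) <-> exists2 d : R, 0 < d & forall s, normc (s - z) < d -> P s.
Proof.
split=> [|[d d0 h]].
  move=> /(@nbhs_ballP R[i] R[i]^o) [d /= d0 h].
  have ed : d = (Re d)%:C by rewrite RRe_real// gtr0_real.
  exists (Re d); first by rewrite -ltcR -ed.
  move=> s hs; apply: h; rewrite /ball /= ed normcE ltcR.
  by rewrite -normcN opprB.
have d0' : 0 < d%:C by rewrite ltcR.
apply/(@nbhs_ballP R[i] R[i]^o); exists d%:C => //= s.
by rewrite /ball /= normcE ltcR => hs; apply: h; rewrite -normcN opprB.
Qed.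

Variant ccont {T : topologicalType} (f : T -> C) (t : T) : Prop :=
  CCont of f @ t --> f t.

Section Ccont.
Context {T : topologicalType}.
Implicit Types (f g : T -> C) (t : T).

Lemma ccontP f t : ccont f t <->
  forall e : R, 0 < e -> \forall s \near t, normc (f t - f s) < e.
Proof. by split=> [[/cvgC_dist]//|h]; split; apply/cvgC_dist. Qed.

Lemma ccont_cst (a : C) t : ccont (fun=> a) t.
Proof. by split; exact: cvg_cst. Qed.

Lemma ccontD f g t : ccont f t -> ccont g t -> ccont (fun s => f s + g s) t.
Proof. by move=> [a] [b]; split; exact: (cvgCD a b). Qed.

Lemma ccontN f t : ccont f t -> ccont (fun s => - f s) t.
Proof. by move=> [?]; split; exact: cvgCN. Qed.

Lemma ccontB f g t : ccont f t -> ccont g t -> ccont (fun s => f s - g s) t.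
Proof. by move=> [a] [b]; split; exact: (cvgCB a b). Qed.

Lemma ccontM f g t : ccont f t -> ccont g t -> ccont (fun s => f s * g s) t.
Proof. by move=> [a] [b]; split; exact: (cvgCM a b). Qed.

Lemma ccontV f t : f t != 0 -> ccont f t -> ccont (fun s => (f s)^-1) t.
Proof. by move=> ? [?]; split; exact: cvgCV. Qed.

Lemma ccont_ReIm f t : {for t, continuous (fun s => Re (f s))} ->
  {for t, continuous (fun s => Im (f s))} -> ccont f t.
Proof. by move=> ? ?; split; exact: cvgC_ReIm. Qed.

Lemma ccont_Re f t : ccont f t -> {for t, continuous (fun s => Re (f s))}.
Proof. by move=> [?]; exact: cvgC_Re. Qed.

Lemma ccont_Im f t : ccont f t -> {for t, continuous (fun s => Im (f s))}.
Proof. by move=> [?]; exact: cvgC_Im. Qed.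

Lemma ccont_normc f t : ccont f t -> {for t, continuous (fun s => normc (f s))}.
Proof. by move=> [?]; exact: cvgC_normc. Qed.

Lemma ccont_near f g t : (\forall s \near t, f s = g s) -> ccont f t -> ccont g t.
Proof.
move=> fg /ccontP h; apply/ccontP => e /h.
have gt := nbhs_singleton fg.
by apply: filterS2 fg => s ->; rewrite gt.
Qed.

Lemma ccont_comp (g : T -> C) (f : C -> C) t :
  ccont g t -> ccont f (g t) -> ccont (fun s => f (g s)) t.
Proof.
by move=> [hg] [hf]; split=> A /hf hA; exact: hg hA.
Qed.

Lemma ccont_open f t (P : set C) :
  ccont f t -> (\forall s \near f t, P s) -> \forall s \near t, P (f s).
Proof. by move=> [h]; exact: h. Qed.

End Ccont.

Lemma real_complex_ccont (t : R) : ccont (fun s : R => s%:C) t.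
Proof. by apply: ccont_ReIm; [exact: cvg_id | exact: cvg_cst]. Qed.

Lemma ccont_id (z : C) : ccont id z.
Proof. by split; exact: cvg_id. Qed.

End ComplexLimits.

(** * Complex derivatives and a mean value bound *)

Section ComplexDerivative.
Context {R : realType}.
Local Notation C := R[i].
Implicit Types (f g : C -> C) (z d : C).

(* Caratheodory's form makes the product and chain rules purely algebraic. *)
Definition cder f z d := exists2 phi : C -> C,
  (forall s, f s - f z = phi s * (s - z)) /\ phi z = d & ccont phi z.

Lemma cderP f z d : (forall e : R, 0 < e ->
    \forall s \near z, normc (f s - f z - d * (s - z)) <= e * normc (s - z)) ->
  cder f z d.
Proof.
move=> h; exists (fun s : C => if (s : R[i]) == z then d else (f s - f z) / (s - z)).
  split=> [s|]; last by rewrite eqxx.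
  case: eqP => [->|/eqP sz]; first by rewrite !subrr mulr0.
  by rewrite divfK// subr_eq0.
apply/ccontP => e e0.
have e2 : 0 < e / 2 by rewrite divr_gt0.
rewrite eqxx; apply: filterS (h _ e2) => s.
case: eqP => [->|/eqP sz]; first by rewrite !subrr normc0.
have sz0 : 0 < normc (s - z) by rewrite normc_gt0 subr_eq0.
have -> : d - (f s - f z) / (s - z) = - ((f s - f z - d * (s - z)) / (s - z)).
  by rewrite [in RHS]mulrBl mulfK ?opprB// subr_eq0.
rewrite normcN normcM normcV => hs.
rewrite ltr_pdivrMr// (le_lt_trans hs)// ltr_pM2r//; lra.
Qed.

Lemma cder_dist f z d : cder f z d -> forall e : R, 0 < e ->
  \forall s \near z, normc (f s - f z - d * (s - z)) <= e * normc (s - z).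
Proof.
case=> phi [h1 <-] + e e0; move=> /ccontP /(_ _ e0).
apply: filterS => s hs; rewrite h1 -mulrBl normcM ler_wpM2r ?normc_ge0//.
by rewrite -normcN opprB ltW.
Qed.

Lemma cder_cont f z d : cder f z d -> ccont f z.
Proof.
case=> phi [h1 h2] cphi.
have -> : f = (fun s => f z + phi s * (s - z)).
  by apply/funext => s; rewrite -h1 addrC subrK.
apply: ccontD; first exact: ccont_cst.
by apply: ccontM => //; apply: ccontB; [exact: ccont_id | exact: ccont_cst].
Qed.

Lemma cder_near f g z d : (\forall s \near z, f s = g s) -> cder f z d -> cder g z d.
Proof.
move=> fg /cder_dist h; apply: cderP => e /h.
have gz := nbhs_singleton fg.
by apply: filterS2 fg => s -> ; rewrite gz.
Qed.

Lemma cder_ext f g z d : f =1 g -> cder f z d -> cder g z d.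
Proof. by move=> /funext ->. Qed.

Lemma cder_eq f z d d' : cder f z d -> d = d' -> cder f z d'.
Proof. by move=> ? <-. Qed.

Lemma cder_cst (a z : C) : cder (fun=> a) z 0.
Proof.
by exists (fun=> 0); [split=> // s; rewrite subrr mul0r | exact: ccont_cst].
Qed.

Lemma cder_id z : cder id z 1.
Proof.
by exists (fun=> 1); [split=> // s; rewrite mul1r | exact: ccont_cst].
Qed.

Lemma cderD f g z d d' : cder f z d -> cder g z d' -> cder (fun s => f s + g s) z (d + d').
Proof.
move=> [p [p1 <-] cp] [q [q1 <-] cq]; exists (fun s => p s + q s).
  by split=> // s; rewrite mulrDl -p1 -q1; ring.
exact: ccontD.
Qed.

Lemma cderN f z d : cder f z d -> cder (fun s => - f s) z (- d).
Proof.
move=> [p [p1 <-] cp]; exists (fun s => - p s).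
  by split=> // s; rewrite mulNr -p1 opprB opprK addrC.
exact: ccontN.
Qed.

Lemma cderB f g z d d' : cder f z d -> cder g z d' -> cder (fun s => f s - g s) z (d - d').
Proof. by move=> hf hg; exact: (cderD hf (cderN hg)). Qed.

Lemma cderM f g z d d' : cder f z d -> cder g z d' ->
  cder (fun s => f s * g s) z (d * g z + f z * d').
Proof.
move=> hf hg; have cg := cder_cont hg.
move: hf hg => [p [p1 <-] cp] [q [q1 <-] cq].
exists (fun s => p s * g s + f z * q s).
  by split=> // s; rewrite mulrDl -[f z * _ * _]mulrA -q1 mulrAC -p1; ring.
exact: (ccontD (ccontM cp cg) (ccontM (ccont_cst _ _) cq)).
Qed.

Lemma cderZ f z d (a : C) : cder f z d -> cder (fun s => a * f s) z (a * d).
Proof.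
move=> hf; apply: cder_eq (cderM (cder_cst a z) hf) _.
by rewrite mul0r add0r.
Qed.

Lemma cderV f z d : f z != 0 -> cder f z d -> cder (fun s => (f s)^-1) z (- (d / f z ^+ 2)).
Proof.
move=> fz hf; have cf := cder_cont hf; move: hf => [p [p1 <-] cp].
pose q s := - (p s * ((f s)^-1 * (f z)^-1)).
(* Caratheodory's factorisation has to hold at every point, and with the factor [q] it fails for the
   inverse where f vanishes. The function is therefore altered at those points, which stay away from
   z, so the derivative is the same. *)
have h : cder (fun s => if f s == 0 then (f z)^-1 + q s * (s - z) else (f s)^-1) z
  (- (p z / f z ^+ 2)).
  exists q.
    split=> [s|]; last by rewrite /q expr2 invfM.
    rewrite (negbTE fz); case: eqP => [_|/eqP fs]; first by rewrite addrC addKr.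
    by rewrite /q mulNr mulrAC -p1; field; rewrite fz fs.
  exact: (ccontN (ccontM cp (ccontM (ccontV fz cf) (ccont_cst _ _)))).
apply: cder_near h.
move/ccontP : cf => /(_ (normc (f z))); rewrite normc_gt0 => /(_ fz).
by apply: filterS => s; case: (f s =P 0) => // ->; rewrite subr0 ltxx.
Qed.

Lemma cder_comp f g z d d' : cder g z d' -> cder f (g z) d ->
  cder (fun s => f (g s)) z (d * d').
Proof.
move=> hg; have cg := cder_cont hg; move: hg => [q [q1 <-] cq] [p [p1 <-] cp].
exists (fun s => p (g s) * q s); first by split=> // s; rewrite p1 q1 mulrA.
exact: (ccontM (ccont_comp cg cp) cq).
Qed.

Lemma cder_Re f (t : R) d : cder f t%:C d -> is_derive t 1 (fun s : R => Re (f s%:C)) (Re d).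
Proof.
move=> [p [p1 <-] cp]; apply/is_derive1_caratheodory.
exists (fun s : R => Re (p s%:C)); split=> //.
  move=> s; have := p1 s%:C; case: (f s%:C) (f t%:C) (p s%:C) => [a b] [a' b'] [x y] /= [].
  by rewrite oppr0 addr0 mulr0 subr0.
apply: ccont_Re; exact: (ccont_comp (real_complex_ccont t) cp).
Qed.

Lemma cder_Im f (t : R) d : cder f t%:C d -> is_derive t 1 (fun s : R => Im (f s%:C)) (Im d).
Proof.
move=> [p [p1 <-] cp]; apply/is_derive1_caratheodory.
exists (fun s : R => Im (p s%:C)); split=> //.
  move=> s; have := p1 s%:C; case: (f s%:C) (f t%:C) (p s%:C) => [a b] [a' b'] [x y] /= [_].
  by rewrite oppr0 addr0 mulr0 add0r.
apply: ccont_Im; exact: (ccont_comp (real_complex_ccont t) cp).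
Qed.

(** The mean value theorem fails for complex values, so it is applied to the real and imaginary
    parts, each contributing M. The lost factor 2 is harmless: the bound is used for M = 0 and for
    an error term. *)
Lemma cder_MVT f (d : R -> C) (M : R) :
  (forall t : R, 0 <= t <= 1 -> cder f t%:C (d t) /\ normc (d t) <= M) ->
  normc (f 1 - f 0) <= M + M.
Proof.
move=> h; rewrite (le_trans (normc_le_ReIm _))// lerD//.
  have [||c] := @MVT_segment R (fun s => Re (f s%:C)) (fun s => Re (d s)) 0 1 ler01.
  - move=> x; rewrite in_itv /= => /andP[x0 x1].
    by apply: cder_Re; apply: (h _ _).1; rewrite !ltW.
  - apply: continuous_in_subspaceT => x; rewrite inE /= in_itv /= => hx.
    have := cder_Re (h _ hx).1; case=> + _; move/derivable1_diffP.
    exact: differentiable_continuous.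
  rewrite in_itv /= => hc; rewrite subr0 mulr1 => e.
  have -> : Re (f 1 - f 0) = Re (d c) by rewrite -e; case: (f 1) (f 0) => [? ?] [? ?].
  by rewrite (le_trans (normc_Re _))//; exact: (h c hc).2.
have [||c] := @MVT_segment R (fun s => Im (f s%:C)) (fun s => Im (d s)) 0 1 ler01.
- move=> x; rewrite in_itv /= => /andP[x0 x1].
  by apply: cder_Im; apply: (h _ _).1; rewrite !ltW.
- apply: continuous_in_subspaceT => x; rewrite inE /= in_itv /= => hx.
  have := cder_Im (h _ hx).1; case=> + _; move/derivable1_diffP.
  exact: differentiable_continuous.
rewrite in_itv /= => hc; rewrite subr0 mulr1 => e.
have -> : Im (f 1 - f 0) = Im (d c) by rewrite -e; case: (f 1) (f 0) => [? ?] [? ?].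
by rewrite (le_trans (normc_Im _))//; exact: (h c hc).2.
Qed.

Lemma cder0_cst f : (forall t : R, 0 <= t <= 1 -> cder f t%:C 0) -> f 1 = f 0.
Proof.
move=> h; apply/eqP; rewrite -subr_eq0; apply/eqP/eq0_normc/le_anti.
rewrite normc_ge0 andbT -[leRHS](addr0 0); apply: (@cder_MVT f (fun=> 0) 0) => t ht.
by rewrite normc0; split=> //; exact: h.
Qed.

End ComplexDerivative.

(** * The complex exponential, its periods and its derivative *)

Section ComplexExponential.
Context {R : realType}.
Local Notation C := R[i].
Implicit Types z w : C.

Definition cexp z : C := (expR (Re z))%:C * (cos (Im z) +i* sin (Im z)).

Definition tau : C := 0 +i* (pi *+ 2).

Lemma complex_eq z w : Re z = Re w -> Im z = Im w -> z = w.
Proof. by case: z w => [? ?] [? ?] /= -> ->. Qed.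

Lemma ReD z w : Re (z + w) = Re z + Re w. Proof. by case: z w => [? ?] []. Qed.
Lemma ImD z w : Im (z + w) = Im z + Im w. Proof. by case: z w => [? ?] []. Qed.
Lemma ReN z : Re (- z) = - Re z. Proof. by case: z. Qed.
Lemma ImN z : Im (- z) = - Im z. Proof. by case: z. Qed.
Lemma ReM z w : Re (z * w) = Re z * Re w - Im z * Im w.
Proof. by case: z w => [? ?] []. Qed.
Lemma ImM z w : Im (z * w) = Re z * Im w + Im z * Re w.
Proof. by case: z w => [? ?] [? ?]. Qed.

Lemma Re_cexp z : Re (cexp z) = expR (Re z) * cos (Im z).
Proof. by rewrite /cexp ReM /= mul0r subr0. Qed.
Lemma Im_cexp z : Im (cexp z) = expR (Re z) * sin (Im z).
Proof. by rewrite /cexp ImM /= mul0r addr0. Qed.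

Lemma cexpD z w : cexp (z + w) = cexp z * cexp w.
Proof.
by apply: complex_eq; rewrite !(ReM, ImM, Re_cexp, Im_cexp, ReD, ImD, expRD, cosD, sinD); ring.
Qed.

Lemma cexp0 : cexp 0 = 1.
Proof. by apply: complex_eq; rewrite ?Re_cexp ?Im_cexp /= expR0 ?cos0 ?sin0 ?mulr1 ?mulr0. Qed.

Lemma cexpNM z : cexp (- z) * cexp z = 1.
Proof. by rewrite -cexpD addNr cexp0. Qed.

Lemma cexp_neq0 z : cexp z != 0.
Proof. by apply/eqP => h; have := cexpNM z; rewrite h mulr0 => /esym/eqP; rewrite oner_eq0. Qed.

Lemma cexpN z : cexp (- z) = (cexp z)^-1.
Proof. by apply: (mulIf (cexp_neq0 z)); rewrite cexpNM mulVf ?cexp_neq0. Qed.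

Lemma cexpB z w : cexp (z - w) = cexp z / cexp w.
Proof. by rewrite cexpD cexpN. Qed.

Lemma normc_cis (b : R) : normc (cos b +i* sin b) = 1.
Proof. by rewrite /normc cos2Dsin2 sqrtr1. Qed.

Lemma normc_cexp z : normc (cexp z) = expR (Re z).
Proof. by rewrite normcM normc_cis mulr1 normcR ger0_norm ?expR_ge0. Qed.

Lemma cexp_tau : cexp tau = 1.
Proof. by apply: complex_eq; rewrite ?Re_cexp ?Im_cexp /= expR0 ?cos2pi ?sin2pi mul1r. Qed.

Lemma cexp_tauz (n : int) : cexp (tau *~ n) = 1.
Proof.
have h (m : nat) : cexp (tau *+ m) = 1.
  elim: m => [|m ih]; first by rewrite mulr0n cexp0.
  by rewrite mulrS cexpD cexp_tau ih mulr1.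
case: n => m; first by rewrite -pmulrn.
by rewrite NegzE mulrNz -pmulrn cexpN h invr1.
Qed.

Lemma cexp_tau2 : cexp (tau / 2) = -1.
Proof.
have -> : tau / 2 = 0 +i* pi.
  apply: (@mulIf _ 2); first by rewrite pnatr_eq0.
  rewrite divfK ?pnatr_eq0// mulr_natr mulr2n; apply: complex_eq => /=; by rewrite ?addr0 ?mulr2n.
apply: complex_eq; rewrite ?Re_cexp ?Im_cexp /= expR0 ?cospi ?sinpi mul1r//.
by rewrite oppr0.
Qed.

Lemma tau_neq0 : tau != 0.
Proof. by rewrite eq_complex /= eqxx /= mulrn_eq0 /= gt_eqF// pi_gt0. Qed.

Lemma cis_eq1 (b : R) : -pi < b <= pi -> cos b = 1 -> b = 0.
Proof.
move=> /andP[b1 b2] cb; apply/normr0_eq0/(@cos_inj R).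
- by rewrite in_itv /= normr_ge0 /= ler_norml b2 ltW.
- by rewrite in_itv /= lexx pi_ge0.
- by rewrite cos_norm cos0.
Qed.

Lemma cexp_eq1 z : cexp z = 1 -> exists n : int, z = tau *~ n.
Proof.
move=> h; have rz : Re z = 0.
  have : normc (cexp z) = 1 by rewrite h normc1.
  by rewrite normc_cexp => /esym e; apply: expR_inj; rewrite expR0 -e.
(* This n brings the imaginary part into (-pi, pi], where a cosine equal to 1 forces the angle 0. *)
pose n := Num.ceil ((Im z - pi) / (pi *+ 2)).
have p2 : 0 < pi *+ 2 :> R by rewrite pmulrn_lgt0// pi_gt0.
have tn : tau *~ n = 0 +i* (n%:~R * (pi *+ 2)).
  apply: complex_eq; first by rewrite [LHS](raddfMz (@complex.Re R : Rcomplex R -> R)) /= mul0rz.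
  by rewrite [LHS](raddfMz (@complex.Im R : Rcomplex R -> R)) /= mulrzl.
exists n; apply/eqP; rewrite -subr_eq0; apply/eqP.
have h' : cexp (z - tau *~ n) = 1 by rewrite cexpB h cexp_tauz divr1.
apply: complex_eq; first by rewrite ReD ReN rz tn /= oppr0 addr0.
apply: cis_eq1; last first.
  have : Re (cexp (z - tau *~ n)) = 1 by rewrite h'.
  by rewrite Re_cexp ReD ReN rz tn /= oppr0 addr0 expR0 mul1r.
rewrite ImD ImN tn /=.
have := Num.Theory.ceil_itv ((Im z - pi) / (pi *+ 2)).
rewrite -/n ltr_pdivlMr// ler_pdivrMr// intrB mulrBl mul1r; move: p2 => /=; set x := _ * _; lra.
Qed.

Lemma cexp_eq z w : cexp z = cexp w -> exists n : int, z = w + tau *~ n.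
Proof.
move=> h; have [] := @cexp_eq1 (z - w).
  by rewrite cexpB h divff ?cexp_neq0.
by move=> n e; exists n; rewrite -e addrC subrK.
Qed.

Lemma is_derive_small (f : R -> R) (d : R) : is_derive (0 : R) (1 : R) f d -> forall e : R, 0 < e ->
  exists2 r : R, 0 < r & forall a, `|a| < r -> `|f a - f 0 - d * a| <= e * `|a|.
Proof.
move=> /is_derive1_caratheodory [g [g1 + <-]] e e0.
move=> /cvgrPdist_lt /(_ _ e0) /nbhs_ballP [r /= r0 h]; exists r => // a ar.
rewrite g1 subr0 -mulrBl normrM ler_wpM2r// distrC ltW//.
by apply: h; rewrite /ball /= sub0r normrN.
Qed.

Lemma cder_cexp0 : cder cexp 0 1.
Proof.
apply: cderP => e e0; apply/nearC.
(* With N the norm of s, the errors of the real and of the imaginary part are each at most 3 k N,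
   whence the divisor 6. The bounds N < 1/4 and N < k / 3 below control expR by 2 and absorb the
   quadratic term 2 N^2 into k N. *)
pose k := Num.min e 1 / 6.
have [k0 k1 ke] : [/\ 0 < k, k <= 1 / 6 & 6 * k <= e].
  by rewrite /k; case: (leP e 1) => ?; split; lra.
have [r1 r10 h1] := is_derive_small (is_derive_expR 0) k0.
have [r2 r20 h2] := is_derive_small (@is_derive_cos R 0) k0.
have [r3 r30 h3] := is_derive_small (@is_derive_sin R 0) k0.
exists (Num.min (Num.min r1 (Num.min r2 r3)) (Num.min (1/4) (k / 3))).
  by rewrite !lt_min r10 r20 r30 /=; apply/andP; split; lra.
move=> s; rewrite subr0 !lt_min => /andP[/andP[s1 /andP[s2 s3]] /andP[s4 s5]].
rewrite mul1r cexp0.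
have na := normc_Re s; have nb := normc_Im s.
have := h1 _ (le_lt_trans na s1); have := h2 _ (le_lt_trans nb s2).
have := h3 _ (le_lt_trans nb s3).
rewrite sin0 cos0 expR0 oppr0 mul0r !subr0 !addr0 !mul1r => h3' h2' h1'.
rewrite (le_trans (normc_le_ReIm _))// !ReD !ImD !ReN !ImN Re_cexp Im_cexp /= subr0.
move: (Re s) (Im s) (normc s) (normc_ge0 s) na nb s4 s5 h1' h2' h3' => a b N N0 na nb s4 s5.
move: (expR a) (sin b) (cos b) => E S K h1' h2' h3'.
have {}h1' : `|E - 1 - a| <= k * N by rewrite (le_trans h1')// ler_wpM2l// ltW.
have {}h2' : `|K - 1| <= k * N by rewrite (le_trans h2')// ler_wpM2l// ltW.
have {}h3' : `|S - b| <= k * N by rewrite (le_trans h3')// ler_wpM2l// ltW.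
have kN : 0 <= k * N by rewrite mulr_ge0// ltW.
have kN1 : k * N <= N by nra.
have E1 : `|E - 1| <= 2 * N.
  by move: h1' na; rewrite !ler_norml => /andP[? ?] /andP[? ?]; apply/andP; split; lra.
have E2 : `|E| <= 2.
  by move: E1; rewrite !ler_norml => /andP[? ?]; apply/andP; split; lra.
have -> : E * K - 1 - a = (E - 1 - a) + E * (K - 1) by ring.
have -> : E * S - b = E * (S - b) + (E - 1) * b by ring.
have e1 : `|E * (K - 1)| <= 2 * (k * N) by rewrite normrM ler_pM.
have e2 : `|E * (S - b)| <= 2 * (k * N) by rewrite normrM ler_pM.
have e3 : `|(E - 1) * b| <= k * N.
  rewrite normrM (@le_trans _ _ ((2 * N) * N)) //; first by rewrite ler_pM.
  by rewrite ler_wpM2r//; lra.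
have := ler_normD (E - 1 - a) (E * (K - 1)).
have := ler_normD (E * (S - b)) ((E - 1) * b).
have : 6 * k * N <= e * N by rewrite ler_wpM2r.
lra.
Qed.

Lemma cder_cexp z : cder cexp z (cexp z).
Proof.
have h : cder (fun s => cexp z * cexp (s - z)) z (cexp z * (1 * (1 - 0))).
  apply: cderZ; apply: cder_comp; first by apply: cderB; [exact: cder_id | exact: cder_cst].
  by rewrite subrr; exact: cder_cexp0.
apply: cder_eq (cder_ext _ h) _; last by rewrite subr0 !mulr1.
by move=> s; rewrite -cexpD addrC subrK.
Qed.

End ComplexExponential.

(** * The principal logarithm on the slit plane *)

Section ComplexLogarithm.
Context {R : realType}.
Local Notation C := R[i].
Implicit Types z w : C.

Definition Log z : C := ln (normc z) +i* Arg z.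

Definition slit z := (0 < Re z) || (Im z != 0).

Lemma Arg_bound z : -pi < Arg z <= pi.
Proof.
case: z => a b; rewrite /Arg.
have p0 := @pi_gt0 R; have := @atan_gtNpi2 R (b / a); have := @atan_ltpi2 R (b / a).
have l0 : 0 <= a -> 0 <= b -> True by [].
have [ha|ha|ha] := ltgtP 0 a.
- by move=> *; apply/andP; split; lra.
- case: (leP 0 b) => hb h1 h2; apply/andP; split; try lra.
    have : atan (b / a) <= 0.
      by rewrite -(@atan0 R) le_atan// mulr_ge0_le0// invr_le0 ltW.
    lra.
  have : 0 < atan (b / a).
    by rewrite -(@atan0 R) lt_atan// nmulr_rgt0// invr_lt0.
  lra.
- by case: (ltP 0 b) => hb; [|case: (ltP b 0)] => *; apply/andP; split; lra.
Qed.

Lemma cos_sin_atan (a b : R) : a != 0 ->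
  cos (atan (b / a)) = `|a| / normc (a +i* b) /\ sin (atan (b / a)) = Num.sg a * b / normc (a +i* b).
Proof.
move=> a0; have e : Num.sqrt (1 + (b / a) ^+ 2) = normc (a +i* b) / `|a|.
  rewrite /normc -sqrtr_sqr -sqrtrV ?sqr_ge0// -sqrtrM ?addr_ge0 ?sqr_ge0//.
  by congr Num.sqrt; field.
have hc : cos (atan (b / a)) = `|a| / normc (a +i* b).
  by rewrite cos_atan e invf_div.
split=> //; have t := @atanK R (b / a); move: t; rewrite /tan => t.
have c0 : cos (atan (b / a)) != 0.
  rewrite hc mulf_neq0 ?normr_eq0// invr_eq0 gt_eqF// normc_gt0.
  by rewrite eq_complex /= (negbTE a0).
rewrite -[LHS](divfK c0) t hc mulrA; congr (_ / _).
by rewrite normrEsg; field.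
Qed.

Lemma cos_sin_Arg z : z != 0 -> cos (Arg z) = Re z / normc z /\ sin (Arg z) = Im z / normc z.
Proof.
case: z => a b z0; rewrite /Arg /Re /Im.
have [a0|a0|a0] := ltgtP 0 a.
- have [-> ->] := cos_sin_atan b (lt0r_neq0 a0).
  by rewrite gtr0_norm// gtr0_sg// mul1r.
- have [hc hs] := cos_sin_atan b (ltr0_neq0 a0).
  move: hc hs; rewrite ltr0_norm// ltr0_sg// mulN1r => hc hs.
  case: ifP => _.
    by rewrite cosDpi sinDpi hc hs !mulNr !opprK.
  by rewrite cosB sinB cospi sinpi !mulr0 hs hc; split; field;
    apply: contra_neq z0 => /eq0_normc.
- subst a; move: z0; rewrite eq_complex /= eqxx /= => b0.
  rewrite expr0n /= add0r sqrtr_sqr mul0r.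
  case: ltgtP b0 => //= hb _.
  + by rewrite cos_pihalf sin_pihalf gtr0_norm// divff// gt_eqF.
  + by rewrite cosN cos_pihalf sinN sin_pihalf ltr0_norm// invrN mulrN divff// lt_eqF.
Qed.

Lemma cexp_Log z : z != 0 -> cexp (Log z) = z.
Proof.
move=> z0; have n0 : 0 < normc z by rewrite normc_gt0.
have [hc hs] := cos_sin_Arg z0.
by apply: complex_eq; rewrite ?Re_cexp ?Im_cexp /= lnK ?posrE// ?hc ?hs mulrC divfK// gt_eqF.
Qed.

Lemma Im_Log z : Im (Log z) = Arg z. Proof. by []. Qed.

(** Most identities between branches of the logarithm below come down to this test on the imaginary
    part. *)
Lemma Log_unique w z : cexp w = z -> -pi < Im w <= pi -> Log z = w.
Proof.
move=> wz /andP[w1 w2].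
have z0 : z != 0 by rewrite -wz cexp_neq0.
have [n e] : exists n : int, Log z = w + tau *~ n by apply: cexp_eq; rewrite cexp_Log.
have /andP[a1 a2] := Arg_bound z.
have p2 := @pi_gt0 R.
suff n0 : n = 0 by rewrite e n0 mulr0z addr0.
have : Im (Log z) = Im w + n%:~R * (pi *+ 2).
  by rewrite e ImD [Im (_ *~ _)](raddfMz (@complex.Im R : Rcomplex R -> R)) /= mulrzl.
rewrite Im_Log => ea.
have n1 : (n%:~R : R) < 1 by rewrite -(ltr_pM2r p2); lra.
have n2 : (- 1 : R) < n%:~R by rewrite -(ltr_pM2r p2); lra.
move: n1 n2; rewrite -[1]/(1%:~R) -[- 1]/((- 1)%:~R) !ltr_int; lia.
Qed.

Lemma slit_neq0 z : slit z -> z != 0.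
Proof. by apply: contraTneq => ->; rewrite /slit /= ltxx eqxx. Qed.

Lemma Arg_lt_pi z : slit z -> Arg z < pi.
Proof.
move=> sz; have /andP[_] := Arg_bound z.
rewrite le_eqVlt => /orP[/eqP e|//].
have [hc hs] := cos_sin_Arg (slit_neq0 sz); move: hc hs; rewrite e cospi sinpi.
have n0 : 0 < normc z by rewrite normc_gt0 slit_neq0.
move=> hc hs; exfalso; move: sz; rewrite /slit => /orP[r0|].
  by have := divr_gt0 r0 n0; rewrite -hc; lra.
by move=> i0; have := congr1 ( *%R^~ (normc z)) hs; rewrite /= mul0r divfK ?gt_eqF// => /esym/eqP; exact/negP.
Qed.

Lemma nbhs_slit z : slit z -> \forall w \near z, slit w.
Proof.
move=> sz; apply/nearC; rewrite /slit; case: (ltP 0 (Re z)) => [r0|].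
  exists (Re z) => // w hw; apply/orP; left.
  have := le_lt_trans (normc_Re _) hw; rewrite ReD ReN ltr_norml; lra.
move=> r0; move: sz; rewrite /slit ltNge r0 /= => i0; exists `|Im z|.
  by rewrite normr_gt0.
move=> w hw; apply/orP; right; apply: contraTneq (le_lt_trans (normc_Im _) hw) => w0.
by rewrite ImD ImN w0 add0r normrN ltxx.
Qed.

Lemma Log1 : Log 1 = 0.
Proof. by apply: Log_unique; [exact: cexp0 | rewrite /= oppr_lt0 pi_gt0 pi_ge0]. Qed.

Lemma ccont_Log1 : ccont Log (1 : C).
Proof.
have near1 : \forall w \near (1 : C), 0 < Re w.
  apply/nearC; exists 1 => // w hw.
  have := le_lt_trans (normc_Re _) hw; rewrite ReD ReN /= ltr_norml; lra.
have cn : ccont id (1 : C) by exact: ccont_id.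
apply: (@ccont_near _ _ (fun w : C => ln (normc w) +i* atan (Im w / Re w))).
  by apply: filterS near1 => -[a b] /= a0; rewrite /Log /Arg a0.
apply: ccont_ReIm.
  suff h : {for (1 : C), continuous ((@ln R) \o (fun w : C => normc w))} by exact: h.
  apply: continuous_comp; first exact: ccont_normc cn.
  by apply: continuous_ln; rewrite normc1.
suff h : {for (1 : C), continuous ((@atan R) \o (fun w : C => Im w / Re w))} by exact: h.
apply: continuous_comp; last exact: continuous_atan.
have c1 : {for (1 : C), continuous (fun w : C => Im w)} by exact: ccont_Im cn.
have c2 : {for (1 : C), continuous (fun w : C => Re w)} by exact: ccont_Re cn.
exact: (cvgM c1 (cvgV (oner_neq0 R) c2)).
Qed.

(** This transports continuity from 1 to the whole slit plane. The number [d] is the distance of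
    [Arg z] from the ends of (-pi, pi), so a correction smaller than [d] does not cross the cut. *)
Lemma Log_near z : slit z -> \forall w \near z, Log w = Log z + Log (w / z).
Proof.
move=> sz; have z0 := slit_neq0 sz.
have /andP[a1 _] := Arg_bound z; have a2 := Arg_lt_pi sz.
have cq : ccont (fun w : C => Log (w / z)) z.
  apply: ccont_comp; last by rewrite divff//; exact: ccont_Log1.
  by apply: ccontM; [exact: ccont_id | exact: ccont_cst].
pose d := Num.min (pi - Arg z) (Arg z + pi).
have d0 : 0 < d by rewrite lt_min; apply/andP; split; lra.
move/ccontP : cq => /(_ _ d0); rewrite divff// Log1.
have : \forall w \near z, w != 0.
  by apply: filterS (nbhs_slit sz) => w; exact: slit_neq0.
apply: filterS2 => w w0; rewrite sub0r normcN => hw.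
have := le_lt_trans (normc_Im _) hw; rewrite lt_min !ltr_norml => /andP[/andP[? ?] /andP[? ?]].
apply: Log_unique; first by rewrite cexpD !cexp_Log ?mulf_neq0 ?invr_eq0// mulrC divfK.
by rewrite ImD Im_Log; apply/andP; split; lra.
Qed.

Lemma ccont_Log z : slit z -> ccont Log z.
Proof.
move=> sz; have z0 := slit_neq0 sz.
apply: (@ccont_near _ _ (fun w => Log z + Log (w / z))).
  by apply: filterS (Log_near sz) => w ->.
apply: ccontD; first exact: ccont_cst.
apply: ccont_comp; last by rewrite divff//; exact: ccont_Log1.
by apply: ccontM; [exact: ccont_id | exact: ccont_cst].
Qed.

(** Inverse function rule: the Caratheodory factor of Log is the reciprocal of the factor [p] of
    exp, evaluated at Log w. It is defined because a zero of [p] at Log w would give w = z. As in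
    [cderV], the value at 0 has to be altered first. *)
Lemma cder_Log z : slit z -> cder Log z z^-1.
Proof.
move=> sz; have z0 := slit_neq0 sz.
have [p [p1 p2] cp] := cder_cexp (Log z); rewrite cexp_Log// in p1 p2.
have cl := ccont_Log sz.
have pl (w : C) : w != 0 -> w != z -> p (Log w) != 0.
  move=> w0 wz; apply: contraNneq wz => e.
  by have := p1 (Log w); rewrite cexp_Log// e mul0r => /eqP; rewrite subr_eq0.
have h : cder (fun w : C => if w == 0 then Log z + (p (Log w))^-1 * (w - z) else Log w) z z^-1.
  exists (fun w : C => (p (Log w))^-1); last first.
    by apply: ccontV; [rewrite p2 | exact: ccont_comp cl cp].
  split=> [w|]; last by rewrite p2.
  rewrite (negbTE z0); case: eqP => [_|/eqP w0]; first by rewrite addrC addKr.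
  case: (w =P z) => [->|/eqP wz]; first by rewrite !subrr mulr0.
  by have := p1 (Log w); rewrite cexp_Log// => ->; rewrite mulKf// pl.
apply: cder_near h; apply: filterS (nbhs_slit sz) => w /slit_neq0.
by case: eqP.
Qed.

End ComplexLogarithm.

(** * Integrals of complex-valued functions over [0, 1] *)

Section ComplexIntegral.
Context {R : realType}.
Local Notation C := R[i].
Local Notation mu := (@lebesgue_measure R).

Definition cint (f : R -> C) : C :=
  (\int[mu]_(t in `[0, 1]) Re (f t)) +i* (\int[mu]_(t in `[0, 1]) Im (f t)).

Lemma integrable01 (f : R -> R) : (forall t : R, 0 <= t <= 1 -> {for t, continuous f}) ->
  mu.-integrable `[0, 1] (EFin \o f).
Proof.
move=> cf; apply: continuous_compact_integrable; first exact: segment_compact.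
by apply: continuous_in_subspaceT => t; rewrite inE /= in_itv /= => /cf.
Qed.

Lemma Rintegral01_bound (f : R -> R) (M : R) : (forall t : R, 0 <= t <= 1 -> {for t, continuous f}) ->
  (forall t : R, 0 <= t <= 1 -> `|f t| <= M) ->
  `|\int[mu]_(t in `[0, 1]) f t| <= M.
Proof.
move=> cf bf; have intf := integrable01 cf.
rewrite (le_trans (le_normr_Rintegral _ intf))//.
have -> : M = \int[mu]_(t in `[0, 1]) (cst M t).
  by rewrite Rintegral_cst//= lebesgue_measure_itv /= lte_fin ltr01 /= oppr0 addr0 mulr1.
apply: le_Rintegral => //.
- by apply: integrable01 => t /cf h; exact: cvg_norm.
- by apply: integrable01 => t _; exact: cvg_cst.
Qed.

Lemma Rintegral01_FTC (f F : R -> R) :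
  (forall t : R, 0 <= t <= 1 -> {for t, continuous f}) ->
  (forall t : R, 0 <= t <= 1 -> is_derive t 1 F (f t)) ->
  \int[mu]_(t in `[0, 1]) f t = F 1 - F 0.
Proof.
move=> cf dF; rewrite /Rintegral (@continuous_FTC2 _ f F)//.
- by apply: continuous_in_subspaceT => t; rewrite inE /= in_itv /= => /cf.
- have cF t : 0 <= t <= 1 -> {for t, continuous F}.
    by move=> /dF[/derivable1_diffP ? _]; exact: differentiable_continuous.
  split.
  + by move=> t; rewrite in_itv /= => /andP[? ?]; case: (dF t) => //; rewrite !ltW.
  + by apply: cvg_at_right_filter; apply: cF; rewrite lexx ler01.
  + by apply: cvg_at_left_filter; apply: cF; rewrite lexx ler01.
- move=> t; rewrite in_itv /= => /andP[? ?]; rewrite derive1E.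
  by case: (dF t) => //; rewrite !ltW.
Qed.

Lemma cint_bound (f : R -> C) (M : R) : (forall t : R, 0 <= t <= 1 -> ccont f t) ->
  (forall t : R, 0 <= t <= 1 -> normc (f t) <= M) -> normc (cint f) <= M + M.
Proof.
move=> cf bf; rewrite (le_trans (normc_le_ReIm _))//= lerD//; apply: Rintegral01_bound.
- by move=> t /cf /ccont_Re.
- by move=> t /bf; apply: le_trans; exact: normc_Re.
- by move=> t /cf /ccont_Im.
- by move=> t /bf; apply: le_trans; exact: normc_Im.
Qed.

Lemma cintB (f g : R -> C) : (forall t : R, 0 <= t <= 1 -> ccont f t) ->
  (forall t : R, 0 <= t <= 1 -> ccont g t) -> cint (fun t => f t - g t) = cint f - cint g.
Proof.
move=> cf cg; apply: complex_eq; rewrite ?ReD ?ImD ?ReN ?ImN /=.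
- rewrite -RintegralB//.
  + by apply: eq_Rintegral => t _; rewrite ReD ReN.
  + by apply: integrable01 => t /cf /ccont_Re.
  + by apply: integrable01 => t /cg /ccont_Re.
- rewrite -RintegralB//.
  + by apply: eq_Rintegral => t _; rewrite ImD ImN.
  + by apply: integrable01 => t /cf /ccont_Im.
  + by apply: integrable01 => t /cg /ccont_Im.
Qed.

Lemma cint_FTC (f : R -> C) (F : C -> C) : (forall t : R, 0 <= t <= 1 -> ccont f t) ->
  (forall t : R, 0 <= t <= 1 -> cder F t%:C (f t)) -> cint f = F 1 - F 0.
Proof.
move=> cf dF; apply: complex_eq; rewrite ?ReD ?ImD ?ReN ?ImN /=.
- apply: (@Rintegral01_FTC _ (fun t => Re (F t%:C))) => t ht.
  + exact: ccont_Re (cf t ht).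
  + exact: cder_Re (dF t ht).
- apply: (@Rintegral01_FTC _ (fun t => Im (F t%:C))) => t ht.
  + exact: ccont_Im (cf t ht).
  + exact: cder_Im (dF t ht).
Qed.

End ComplexIntegral.

(** * The dilogarithm on the plane cut along [1, oo) and its reflection formula *)

Section Dilogarithm.
Context {R : realType}.
Local Notation C := R[i].
Implicit Types z w : C.

(** The slit plane is star-shaped about 1; hence 1 - t z avoids the cut in the integral that defines
    [Li2]. *)
Lemma slit_segment z (t : R) : slit z -> 0 <= t <= 1 -> slit (1 - t%:C + t%:C * z).
Proof.
case: z => a b; rewrite /slit /= !mul0r subr0 addr0 oppr0 add0r => h /andP[t0 t1].
have [->|tn] := eqVneq t 0; first by rewrite mul0r subr0 addr0 ltr01.
have {tn}t0 : 0 < t by rewrite lt_neqAle eq_sym tn.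
case/orP: h => [a0|b0]; last by rewrite add0r (mulf_neq0 (lt0r_neq0 t0) b0) orbT.
apply/orP; left; rewrite ltr_wpDl ?subr_ge0//; exact: mulr_gt0.
Qed.

Lemma slit_1BtM z (t : R) : slit (1 - z) -> 0 <= t <= 1 -> slit (1 - t%:C * z).
Proof.
move=> sz /(slit_segment sz); congr slit; ring.
Qed.

(** The integrand of Li2(z) = - int_0^1 Log(1 - t z) dt / t. The value z at t = 0 is the limit
    there, which makes it continuous on [0, 1]. *)
Definition dilog_kernel z (t : R) : C :=
  if t == 0 then z else - Log (1 - t%:C * z) / t%:C.

Definition Li2 z : C := cint (dilog_kernel z).

Lemma cder_Log1B z w : slit (1 - w * z) -> cder (fun s => - Log (1 - s * z)) w (z / (1 - w * z)).
Proof.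
move=> sw; have h : cder (fun s : C => 1 - s * z) w (0 - (1 * z + w * 0)).
  by apply: cderB; [exact: cder_cst | apply: cderM; [exact: cder_id | exact: cder_cst]].
apply: cder_eq (cderN (cder_comp h (cder_Log sw))) _; ring.
Qed.

Lemma ccont_dilog_kernel z (t : R) : slit (1 - z) -> 0 <= t <= 1 -> ccont (dilog_kernel z) t.
Proof.
move=> sz ht; have [->|t0] := eqVneq t 0.
  have s0 : slit (1 - 0 * z) by rewrite mul0r subr0 /slit /= ltr01.
  (* The Caratheodory factor at 0 of s |-> - Log(1 - s z) is the kernel itself: the difference
     quotient for s != 0, and the derivative z at 0. *)
  have [p [p1 p2] cp] := cder_Log1B s0.
  apply: (@ccont_near _ _ (fun s : R => p s%:C)); last first.
    by apply: ccont_comp cp; exact: real_complex_ccont.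
  apply: filterE => s; rewrite /dilog_kernel.
  have [->|s0'] := eqVneq s 0; first by rewrite p2 mul0r subr0 divr1.
  have := p1 s%:C; rewrite mul0r !subr0 Log1 oppr0 subr0 => ->.
  by rewrite mulfK// eq_complex /= (negbTE s0').
have c1 : ccont (fun s : R => - Log (1 - s%:C * z)) t.
  apply: (ccont_comp (f := fun s => - Log (1 - s * z)) (real_complex_ccont t)).
  exact: cder_cont (cder_Log1B (slit_1BtM sz ht)).
have tC : t%:C != 0 :> C by rewrite eq_complex /= (negbTE t0).
apply: ccont_near (ccontM c1 (ccontV tC (real_complex_ccont t))).
have : \forall s \near t, s != 0 by exact: open_neq.
by apply: filterS => s s0; rewrite /dilog_kernel (negbTE s0).
Qed.

Lemma normc_1BtM_min z : slit (1 - z) ->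
  exists2 m : R, 0 < m & forall t : R, 0 <= t <= 1 -> m <= normc (1 - t%:C * z).
Proof.
move=> sz; have cf (t : R) : {for t, continuous (fun s : R => normc (1 - s%:C * z))}.
  apply: ccont_normc; apply: ccontB; first exact: ccont_cst.
  by apply: ccontM; [exact: real_complex_ccont | exact: ccont_cst].
have [|c] := @EVT_min R (fun s : R => normc (1 - s%:C * z)) 0 1 ler01.
  by apply: continuous_in_subspaceT => t _; exact: cf.
rewrite in_itv /= => c01 hc; exists (normc (1 - c%:C * z)).
  by rewrite normc_gt0 slit_neq0// slit_1BtM.
by move=> t t01; apply: hc; rewrite in_itv.
Qed.

Lemma cder_affine (a b w : C) : cder (fun s => a + s * b) w b.
Proof.
apply: cder_eq (cderD (cder_cst a w) (cderM (cder_id w) (cder_cst b w))) _.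
by rewrite mul1r mulr0 addr0 add0r.
Qed.

(** An error quadratic in h and uniform in t, which permits differentiation under the integral sign.
    The division by t does no harm, since t cancels in the derivative of [g]. Along the segment the
    denominator has norm at least m / 2, which gives the factor 2 / m^2; the other 2 comes from
    [cder_MVT]. *)
Lemma dilog_kernel_diff_bound z h (m : R) (t : R) : 0 < m ->
  (forall s : R, 0 <= s <= 1 -> slit (1 - (z + s%:C * h))) ->
  (forall s : R, 0 <= s <= 1 -> m <= normc (1 - s%:C * z)) ->
  normc h <= m / 2 -> 0 <= t <= 1 ->
  normc (dilog_kernel (z + h) t - dilog_kernel z t - h / (1 - t%:C * z))
    <= 2 * (2 / m ^+ 2 * normc h ^+ 2).
Proof.
move=> m0 sl hm hh t01; have /andP[t0 t1] := t01.
have mm := hm _ t01; have n0 := normc_ge0 h.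
have mpos : 0 < m ^+ 2 by rewrite exprn_gt0.
have Z0 : 1 - t%:C * z != 0 by rewrite -normc_gt0 (lt_le_trans m0).
have B0 : 0 <= 2 / m ^+ 2 * normc h ^+ 2.
  by rewrite mulr_ge0// ?exprn_ge0// divr_ge0// ltW.
have [->|tn0] := eqVneq t 0.
  have -> : dilog_kernel (z + h) 0 - dilog_kernel z 0 - h / (1 - 0%:C * z) = 0.
    by rewrite /dilog_kernel eqxx mul0r subr0 divr1 [z + h]addrC addrK subrr.
  rewrite normc0.
  by rewrite mulr_ge0.
have tC : t%:C != 0 :> C by rewrite eq_complex /= (negbTE tn0).
have sh (s : R) : 0 <= s <= 1 -> slit (1 - t%:C * (z + s%:C * h)).
  by move=> hs; apply: slit_1BtM => //; exact: sl.
have lower (s : R) : 0 <= s <= 1 -> m / 2 <= normc (1 - t%:C * (z + s%:C * h)).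
  move=> /andP[s0 s1].
  have := le_normcD (1 - t%:C * (z + s%:C * h)) (t%:C * (s%:C * h)).
  have -> : 1 - t%:C * (z + s%:C * h) + t%:C * (s%:C * h) = 1 - t%:C * z by ring.
  have : normc (t%:C * (s%:C * h)) <= m / 2.
    rewrite !normcM !normcR !ger0_norm//; apply: le_trans hh.
    rewrite mulrA ler_piMl// mulr_ile1//.
  lra.
pose g (s : C) := - Log (1 - t%:C * (z + s * h)) / t%:C - s * (h / (1 - t%:C * z)).
have -> : dilog_kernel (z + h) t - dilog_kernel z t - h / (1 - t%:C * z) = g 1 - g 0.
  by rewrite /g /dilog_kernel (negbTE tn0) !mul1r !mul0r addr0 subr0; ring.
rewrite mulr_natl mulr2n.
apply: (@cder_MVT _ g (fun s : R => h / (1 - t%:C * (z + s%:C * h)) - h / (1 - t%:C * z))) => s s01.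
have N0 : 1 - t%:C * (z + s%:C * h) != 0 by rewrite slit_neq0// sh.
split.
  have d1 : cder (fun s : C => 1 - t%:C * (z + s * h)) s%:C (0 - t%:C * h).
    by apply: cderB; [exact: cder_cst | apply: cderZ; exact: cder_affine].
  have d2 := cderM (cderN (cder_comp d1 (cder_Log (sh _ s01)))) (cder_cst (t%:C)^-1 s%:C).
  apply: cder_eq (cderB d2 (cderM (cder_id s%:C) (cder_cst (h / (1 - t%:C * z)) _))) _.
  by field; rewrite tC N0 Z0.
have -> : h / (1 - t%:C * (z + s%:C * h)) - h / (1 - t%:C * z) =
   (t%:C * s%:C) * h ^+ 2 * ((1 - t%:C * (z + s%:C * h))^-1 * (1 - t%:C * z)^-1).
  by field; rewrite N0 Z0.
rewrite [h ^+ 2]expr2 !normcM !normcV !normcR -[normc h * normc h]expr2.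
have /andP[s0 s1] := s01; rewrite !ger0_norm//.
have i1 : (normc (1 - t%:C * (z + s%:C * h)))^-1 <= (m / 2)^-1.
  by rewrite lef_pV2 ?posrE ?normc_gt0 ?divr_gt0// lower.
have i2 : (normc (1 - t%:C * z))^-1 <= m^-1.
  by rewrite lef_pV2 ?posrE ?normc_gt0.
rewrite [leRHS]mulrC; apply: ler_pM; rewrite ?mulr_ge0 ?exprn_ge0 ?invr_ge0 ?normc_ge0//.
  by rewrite ler_piMl ?exprn_ge0 ?mulr_ile1.
apply: (le_trans (ler_pM _ _ i1 i2)); rewrite ?invr_ge0 ?normc_ge0//.
by rewrite le_eqVlt; apply/orP; left; apply/eqP; field; rewrite gt_eqF.
Qed.

Lemma cder_Li2 z : z != 0 -> slit (1 - z) -> cder Li2 z (- Log (1 - z) / z).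
Proof.
move=> z0 sz; have [m m0 hm] := normc_1BtM_min sz.
have : \forall w \near z, slit (1 - w).
  have c1 : ccont (fun w : C => 1 - w) z by apply: ccontB; [exact: ccont_cst | exact: ccont_id].
  exact: (ccont_open c1 (nbhs_slit sz)).
move=> /nearC [r r0 hr]; apply: cderP => e e0; apply/nearC.
(* The total error is at most 8 / m^2 times the square of the norm of h: 2 / m^2 from the kernel,
   doubled by [cder_MVT] and once more by [cint_bound]. *)
exists (Num.min r (Num.min (m / 2) (e * m ^+ 2 / 8))).
  by rewrite !lt_min r0 !divr_gt0// mulr_gt0// exprn_gt0.
move=> w; rewrite !lt_min => /andP[wr /andP[wm we]].
have mpos : 0 < m ^+ 2 by rewrite exprn_gt0.
pose h := w - z; rewrite -/h in wr wm we *.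
have wE : w = z + h by rewrite /h addrC subrK.
have sl (s : R) : 0 <= s <= 1 -> slit (1 - (z + s%:C * h)).
  move=> /andP[s0 s1]; apply: hr; rewrite addrC addrA addNr add0r normcM normcR ger0_norm//.
  by apply: le_lt_trans wr; rewrite ler_piMl// normc_ge0.
have sw : slit (1 - w) by have := sl 1; rewrite mul1r -wE; apply; rewrite ler01 lexx.
have ck1 (t : R) : 0 <= t <= 1 -> ccont (dilog_kernel w) t by exact: ccont_dilog_kernel.
have ck2 (t : R) : 0 <= t <= 1 -> ccont (dilog_kernel z) t by exact: ccont_dilog_kernel.
have ck3 (t : R) : 0 <= t <= 1 -> ccont (fun t : R => h / (1 - t%:C * z)) t.
  move=> t01; apply: ccontM; first exact: ccont_cst.
  apply: ccontV; first by rewrite slit_neq0// slit_1BtM.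
  apply: ccontB; first exact: ccont_cst.
  by apply: ccontM; [exact: real_complex_ccont | exact: ccont_cst].
have i3 : cint (fun t : R => h / (1 - t%:C * z)) = - Log (1 - z) / z * h.
  rewrite (@cint_FTC _ _ (fun s => (h / z) * - Log (1 - s * z)))//.
    by rewrite mul1r mul0r subr0 Log1; field.
  move=> t t01; have s0 := slit_1BtM sz t01.
  by apply: cder_eq (cderZ _ (cder_Log1B s0)) _; field; rewrite z0 slit_neq0.
rewrite -i3 /Li2 -cintB// -cintB//; last by move=> t t01; apply: ccontB; [exact: ck1|exact: ck2].
have bnd (t : R) : 0 <= t <= 1 -> normc (dilog_kernel w t - dilog_kernel z t - h / (1 - t%:C * z))
    <= 2 * (2 / m ^+ 2 * normc h ^+ 2).
  by move=> t01; rewrite {1}wE; apply: dilog_kernel_diff_bound => //; exact: ltW.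
apply: le_trans (cint_bound _ bnd) _.
  by move=> t t01; apply: ccontB; [apply: ccontB; [exact: ck1|exact: ck2]|exact: ck3].
have -> : 2 * (2 / m ^+ 2 * normc h ^+ 2) + 2 * (2 / m ^+ 2 * normc h ^+ 2)
  = (8 / m ^+ 2 * normc h) * normc h by ring.
rewrite ler_wpM2r ?normc_ge0//.
move: we; rewrite ltr_pdivlMr// => /ltW we.
by rewrite mulrAC ler_pdivrMr// mulrC.
Qed.

(** The centre 1/2 is the fixed point of z |-> 1 - z, so z and 1 - z can be joined to it inside the
    slit plane by the same parameter. *)
Lemma slit_segment_half z (t : R) : slit z -> 0 <= t <= 1 ->
  slit (2^-1 + t%:C * (z - 2^-1)).
Proof.
have -> : 2^-1 = (2^-1 : R)%:C :> C by rewrite fmorphV rmorph_nat.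
case: z => a b; rewrite /slit /= !(mul0r, oppr0, subr0, addr0, add0r) => h /andP[t0 t1].
have [->|tn] := eqVneq t 0; first by rewrite mul0r addr0 invr_gt0 ltr0n.
have {tn}t0 : 0 < t by rewrite lt_neqAle eq_sym tn.
case/orP: h => [a0|b0]; last by rewrite (mulf_neq0 (lt0r_neq0 t0) b0) orbT.
by apply/orP; left; have := mulr_gt0 t0 a0; rewrite mulrBr; lra.
Qed.

(** Classically pi^2 / 6, written as the value at the fixed point of z |-> 1 - z. *)
Definition reflection_const : C :=
  Li2 2^-1 + Li2 (1 - 2^-1) + Log 2^-1 * Log (1 - 2^-1).

Lemma Li2_reflection z : slit z -> slit (1 - z) ->
  Li2 z + Li2 (1 - z) + Log z * Log (1 - z) = reflection_const.
Proof.
pose L z := Li2 z + Li2 (1 - z) + Log z * Log (1 - z).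
move=> sz s1z; rewrite /reflection_const -/(L 2^-1) -/(L z).
pose p (s : C) := 2^-1 + s * (z - 2^-1).
have -> : L z = L (p 1) by rewrite /p mul1r addrC subrK.
have -> : L 2^-1 = L (p 0) by rewrite /p mul0r addr0.
apply: (@cder0_cst _ (fun s => L (p s))) => t t01.
have sp : slit (p t%:C) by exact: slit_segment_half.
have s1p : slit (1 - p t%:C).
  have -> : 1 - p t%:C = 2^-1 + t%:C * (1 - z - 2^-1) by rewrite /p; field.
  exact: slit_segment_half.
have dp : cder p t%:C (z - 2^-1) by exact: cder_affine.
have dq := cderB (cder_cst 1 t%:C) dp.
have [p0 q0] := (slit_neq0 sp, slit_neq0 s1p).
have d1 := cder_comp dp (cder_Li2 p0 s1p).
have s11p : slit (1 - (1 - p t%:C)) by rewrite subKr.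
have d2 := cder_comp dq (cder_Li2 q0 s11p).
have d3 := cderM (cder_comp dp (cder_Log sp)) (cder_comp dq (cder_Log s1p)).
apply: cder_eq (cderD (cderD d1 d2) d3) _.
by rewrite subKr; field; rewrite p0 q0.
Qed.

End Dilogarithm.

(** * The lifted dilogarithm, its monodromy and its differential *)

Section LiftedDilogarithm.
Context {R : realType}.
Local Notation C := R[i].
Local Notation tau := (@tau R).
Implicit Types a b z : C.

Lemma cder_unique (f : C -> C) z (d d' : C) : cder f z d -> cder f z d' -> d = d'.
Proof.
move=> h h'; apply/eqP; rewrite -subr_eq0; apply/eqP/eq0_normc/le_anti.
rewrite normc_ge0 andbT; apply/ler_addgt0Pr => e e0; rewrite add0r.
have /cder_dist/(_ _ e0)/nearC[r r0 hr] := cderB h h'.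
have r2 : 0 < r / 2 by rewrite divr_gt0.
have := hr (z + (r / 2)%:C); rewrite [z + _ - z]addrC addrA addNr add0r.
rewrite normcR gtr0_norm// !subrr sub0r normcN normcM normcR gtr0_norm//.
by rewrite ler_pM2r//; apply; lra.
Qed.

(** At b = Log(1 - cexp a) this is the Rogers dilogarithm Li2(z) + log z log(1 - z) / 2. For every
    lift b its differential is (a db - b da) / 2, in which no choice of branch is left. *)
Definition dilogA a b : C := Li2 (cexp a) - a * b / 2 + a * Log (1 - cexp a).

Definition dilogB a b : C :=
  reflection_const - (Li2 (cexp b) - a * b / 2 + b * Log (cexp a)).

(* The Rogers dilogarithm divided by 2 pi i; dilogB is its analytic continuation
   around cexp a = 1 by the reflection formula, and on the common domain the two
   differ by a multiple of tau ^ 2. *)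
Definition ell a b : C := (if slit (1 - cexp a) then dilogA a b else dilogB a b) / tau.

Lemma ell_dilogA a b : slit (1 - cexp a) -> ell a b = dilogA a b / tau.
Proof. by rewrite /ell => ->. Qed.

Lemma cexp_ell_dilogB a b : cexp a + cexp b = 1 -> slit (cexp a) ->
  cexp (ell a b) = cexp (dilogB a b / tau).
Proof.
move=> ab sa; rewrite /ell; case: ifP => // s1a.
have eb : 1 - cexp a = cexp b by rewrite -ab addrC addKr.
have [m am] : exists m : int, a = Log (cexp a) + tau *~ m.
  by apply: cexp_eq; rewrite cexp_Log ?cexp_neq0.
have [n bn] : exists n : int, b = Log (cexp b) + tau *~ n.
  by apply: cexp_eq; rewrite cexp_Log ?cexp_neq0.
(* After the reflection formula, the difference of the two expressions is minus the product of a -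
   Log(cexp a) and b - Log(cexp b), that is, - tau^2 m n. *)
have -> : dilogA a b / tau = dilogB a b / tau - tau *~ (m * n); last first.
  by rewrite cexpB cexp_tauz divr1.
have := Li2_reflection sa s1a; rewrite /dilogA /dilogB eb => <-.
rewrite -mulrzr intrM.
move: am bn; rewrite -[tau *~ m]mulrzr -[tau *~ n]mulrzr.
move: (Li2 _) (Li2 _) (Log _) (Log _) (m%:~R) (n%:~R) => L1 L2 l1 l2 m' n' -> ->.
by have := @tau_neq0 R; move: tau => t t0; field.
Qed.

(** Consequently every point lies in the domain of smoothness of one of the two formulas for
    [ell]. *)
Lemma slit_or z : z != 0 -> slit (1 - z) || slit z.
Proof.
case: z => x y; rewrite eq_complex /slit /= sub0r oppr_eq0 => h.
have [y0|] := eqVneq y 0; last by rewrite !orbT.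
move: h; rewrite y0 eqxx /= andbT !orbF => x0; apply/orP.
by have [|?] := ltP 0 x; [right | left; lra].
Qed.

Lemma cexp_ell_shift a b : cexp a + cexp b = 1 ->
  cexp (ell a (b - tau)) = cexp (ell a b) * cexp (a / 2).
Proof.
move=> ab; have ab' : cexp a + cexp (b - tau) = 1 by rewrite cexpB cexp_tau divr1.
have [s1|s] := orP (slit_or (cexp_neq0 a)).
  rewrite !ell_dilogA// -cexpD /dilogA; congr cexp.
  by field; exact: tau_neq0.
rewrite !cexp_ell_dilogB// /dilogB cexpB cexp_tau divr1.
(* With this formula the increment is Log(cexp a) - a / 2, which agrees with a / 2 only modulo
   [tau]; the identity therefore needs the outer [cexp]. *)
have -> : (reflection_const - (Li2 (cexp b) - a * (b - tau) / 2 + (b - tau) * Log (cexp a))) / tau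
  = (reflection_const - (Li2 (cexp b) - a * b / 2 + b * Log (cexp a))) / tau + (Log (cexp a) - a / 2).
  by field; exact: tau_neq0.
rewrite cexpD; congr (_ * _); rewrite cexpB cexp_Log ?cexp_neq0//.
apply: (mulIf (cexp_neq0 (a / 2))); rewrite divfK ?cexp_neq0// -cexpD.
by congr cexp; field.
Qed.

(** Logarithmic derivatives are taken of exp ell, because ell itself may jump by multiples of [tau]
    where its formula changes; the alternating product of five exponentials then contributes a
    sum. *)
Definition dlog (f : C -> C) s (d : C) := cder f s (f s * d).

Lemma dlogM f g s d e : dlog f s d -> dlog g s e -> dlog (fun s => f s * g s) s (d + e).
Proof. by move=> df dg; apply: cder_eq (cderM df dg) _; ring. Qed.

Lemma dlogV f s d : dlog f s d -> f s != 0 -> dlog (fun s => (f s)^-1) s (- d).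
Proof. by move=> df f0; apply: cder_eq (cderV f0 df) _; field. Qed.

Lemma dlog_ell (a b : C -> C) s a' b' : cder a s a' -> cder b s b' ->
  (\forall s \near s, cexp (a s) + cexp (b s) = 1) ->
  dlog (fun s => cexp (ell (a s) (b s))) s ((a s * b' - a' * b s) / (2 * tau)).
Proof.
move=> da db nab; have ab := nbhs_singleton nab.
have t0 := @tau_neq0 R.
have dea := cder_comp da (cder_cexp (a s)); have deb := cder_comp db (cder_cexp (b s)).
(* Differentiating the relation expresses b' through a', after which the logarithmic terms of either
   formula cancel. *)
have rel : cexp (a s) * a' + cexp (b s) * b' = 0.
  apply: cder_unique (cderD dea deb) _; apply: cder_near (cder_cst 1 s).
  by apply: filterS nab => w ->.
have eb : 1 - cexp (a s) = cexp (b s) by rewrite -ab addrC addKr.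
have ea : 1 - cexp (b s) = cexp (a s) by rewrite -ab addrK.
have [ea0 eb0] := (cexp_neq0 (a s), cexp_neq0 (b s)).
have b'E : b' = - (cexp (a s) * a') / cexp (b s).
  by apply: (mulIf eb0); rewrite divfK// mulrC; apply/eqP; rewrite -addr_eq0 addrC rel.
have [s1|s0] := orP (slit_or ea0).
  have d1e := cderB (cder_cst 1 s) dea.
  have dA : cder (fun s => cexp (dilogA (a s) (b s) / tau)) s
      (cexp (dilogA (a s) (b s) / tau) * ((a s * b' - a' * b s) / (2 * tau))).
    have d2 := cderM (cderM da db) (cder_cst 2^-1 s).
    have d3 := cderM da (cder_comp d1e (cder_Log s1)).
    have d4 := cderD (cderB (cder_comp dea (cder_Li2 ea0 s1)) d2) d3.
    apply: cder_eq (cder_comp (cderM d4 (cder_cst tau^-1 s)) (cder_cexp _)) _.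
    rewrite b'E -/(dilogA (a s) (b s)) !eb; congr (_ * _).
    by field; rewrite t0 ea0 eb0.
  apply: cder_eq (cder_near _ dA) _; last by rewrite ell_dilogA.
  by apply: filterS (ccont_open (cder_cont d1e) (nbhs_slit s1)) => w sw; rewrite ell_dilogA.
have s1b : slit (1 - cexp (b s)) by rewrite ea.
have dB : cder (fun s => cexp (dilogB (a s) (b s) / tau)) s
    (cexp (dilogB (a s) (b s) / tau) * ((a s * b' - a' * b s) / (2 * tau))).
  have d2 := cderM (cderM da db) (cder_cst 2^-1 s).
  have d3 := cderM db (cder_comp dea (cder_Log s0)).
  have d4 := cderB (cder_cst reflection_const s) (cderD (cderB (cder_comp deb (cder_Li2 eb0 s1b)) d2) d3).
  apply: cder_eq (cder_comp (cderM d4 (cder_cst tau^-1 s)) (cder_cexp _)) _.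
  rewrite b'E -/(dilogB (a s) (b s)) ea; congr (_ * _).
  by field; rewrite t0 ea0 eb0.
apply: cder_eq (cder_near _ dB) _; last by rewrite cexp_ell_dilogB.
apply: filterS2 nab (ccont_open (cder_cont dea) (nbhs_slit s0)) => w nw sw.
by rewrite cexp_ell_dilogB.
Qed.

End LiftedDilogarithm.

(** * Logarithmic coordinates on the extended cover *)

Section CoverCoordinates.
Context {R : realType}.
Local Notation C := R[i].
Local Notation tau := (@tau R).
Implicit Types z w a b : C.

Lemma normc_tau : normc tau = pi *+ 2.
Proof. by rewrite /normc /= expr0n /= add0r sqrtr_sqr ger0_norm// mulrn_wge0// pi_ge0. Qed.

(** Distinct points of a fibre of [cexp] are at least 2 pi apart. This upgrades equality of
    exponentials to equality of logarithms in the continuity arguments below. *)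
Lemma cexp_eq_small a b : cexp a = cexp b -> normc (a - b) < 1 -> a = b.
Proof.
move=> /cexp_eq[n ->]; rewrite [b + _]addrC addrK -mulrzr normcM normc_tau.
have [->|n0] := eqVneq n 0; first by rewrite mulr0z mulr0 add0r.
have -> : (n%:~R : C) = (n%:~R : R)%:C by rewrite rmorph_int.
rewrite normcR => h; exfalso.
have : 1 <= `|n%:~R : R|.
  by rewrite -intr_norm -[1]/(1%:~R) ler_int; lia.
have := @pi_ge2 R; nra.
Qed.

Lemma LogV z : slit z -> Log z^-1 = - Log z.
Proof.
move=> sz; have z0 := slit_neq0 sz; apply: Log_unique.
  by rewrite cexpN cexp_Log.
rewrite ImN Im_Log; have /andP[h1 _] := Arg_bound z; have h2 := Arg_lt_pi sz.
by apply/andP; split; lra.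
Qed.

Lemma tau4_i : cexp (tau / 4) = 'i%C.
Proof.
have -> : tau / 4 = 0 +i* (pi / 2).
  apply: (@mulIf _ 4); first by rewrite pnatr_eq0.
  rewrite divfK ?pnatr_eq0// mulr_natr; apply: complex_eq => /=.
    by rewrite !addr0.
  by rewrite -mulr2n; lra.
by apply: complex_eq; rewrite ?Re_cexp ?Im_cexp /= expR0 ?cos_pihalf ?sin_pihalf mul1r.
Qed.

(* [halfplane true] is the closed upper and [halfplane false] the closed lower
   half plane; [Logh s] is the branch of the logarithm continuous there. *)
Definition halfplane (s : bool) z := if s then 0 <= Im z else Im z <= 0.

Definition Logh (s : bool) z : C :=
  if s then Log (- 'i%C * z) + tau / 4 else Log ('i%C * z) - tau / 4.

Lemma neqi0 : 'i%C != 0 :> C.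
Proof. by rewrite -tau4_i cexp_neq0. Qed.

Lemma cexp_Logh s z : z != 0 -> cexp (Logh s z) = z.
Proof.
move=> z0; have i2 : 'i%C * 'i%C = -1 :> C by rewrite -expr2 sqr_i.
case: s; rewrite /Logh.
  by rewrite cexpD tau4_i cexp_Log ?mulf_neq0 ?oppr_eq0 ?neqi0// mulrAC mulNr i2 opprK mul1r.
rewrite cexpB tau4_i cexp_Log ?mulf_neq0 ?neqi0//.
by rewrite mulrC mulKf ?neqi0.
Qed.

Lemma slit_rotate s z : z != 0 -> halfplane s z -> slit ((if s then - 'i%C else 'i%C) * z).
Proof.
case: z s => x y [] z0; rewrite /halfplane /slit /= => hy.
  rewrite oppr0 !mul0r mulN1r sub0r opprK add0r mulN1r oppr_eq0.
  move: z0; rewrite eq_complex /= negb_and => /orP[->|y0]; first by rewrite orbT.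
  by rewrite lt_neqAle eq_sym y0 hy.
rewrite !mul0r !mul1r sub0r add0r oppr_gt0.
move: z0; rewrite eq_complex /= negb_and => /orP[->|y0]; first by rewrite orbT.
by rewrite lt_neqAle y0 hy.
Qed.

Lemma ccont_Logh s z : z != 0 -> halfplane s z -> ccont (Logh s) z.
Proof.
move=> z0 hz; have := slit_rotate z0 hz; rewrite /Logh; case: s hz => hz sl.
  apply: ccontD (ccont_cst _ _); apply: ccont_comp (ccont_Log sl).
  by apply: ccontM; [exact: ccont_cst | exact: ccont_id].
apply: ccontB (ccont_cst _ _); apply: ccont_comp (ccont_Log sl).
by apply: ccontM; [exact: ccont_cst | exact: ccont_id].
Qed.

Lemma Arg_Re_ge0 z : 0 <= Re z -> - (pi / 2) <= Arg z <= pi / 2.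
Proof.
case: z => a b /=; rewrite /Arg; have p0 := @pi_gt0 R.
have := @atan_gtNpi2 R (b / a); have := @atan_ltpi2 R (b / a).
have [a0|//|a0] := ltgtP 0 a.
  by move=> *; apply/andP; split; lra.
by case: (ltP 0 b) => hb; [|case: (ltP b 0)] => *; apply/andP; split; lra.
Qed.

Lemma Im_tau4 : Im (tau / 4) = pi / 2.
Proof.
have -> : tau / 4 = 0 +i* (pi / 2) => //.
apply: (@mulIf _ 4); first by rewrite pnatr_eq0.
rewrite divfK ?pnatr_eq0// mulr_natr; apply: complex_eq => /=.
  by rewrite !addr0.
by rewrite -mulr2n; lra.
Qed.

Lemma Log_upper z : z != 0 -> halfplane true z -> Log z = Logh true z.
Proof.
move=> z0 hz; apply: Log_unique; first exact: cexp_Logh.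
rewrite /Logh ImD Im_tau4 Im_Log.
have : 0 <= Re (- 'i%C * z).
  by move: hz; case: (z) => x y /=; rewrite oppr0 mul0r mulN1r sub0r opprK.
by move=> /Arg_Re_ge0 /andP[? ?]; have := @pi_gt0 R; move=> ?; apply/andP; split; lra.
Qed.

Definition negative_real z := (Im z == 0) && (Re z < 0).

(** [Log] is continuous from above on the negative axis, so seen from below it is one period too
    large exactly there. *)
Lemma Log_lower z : z != 0 -> halfplane false z ->
  Log z = Logh false z + (if negative_real z then tau else 0).
Proof.
move=> z0 hz; have p0 := @pi_gt0 R; apply: Log_unique.
  rewrite cexpD cexp_Logh//; case: ifP => _; by rewrite ?cexp_tau ?cexp0 mulr1.
rewrite ImD /Logh ImD ImN Im_tau4 Im_Log.
have : 0 <= Re ('i%C * z).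
  by move: hz; case: (z) => x y /=; rewrite mul0r mul1r sub0r oppr_ge0.
move=> /Arg_Re_ge0; case: ifP => [/andP[/eqP y0 x0]|neg] /andP[h1 h2].
  have -> : Arg ('i%C * z) = - (pi / 2).
    move: y0 x0; case: (z) => x y /= -> x0.
    by rewrite !mul0r !mul1r subrr add0r ltxx ltNge ltW//= x0.
  by rewrite /=; apply/andP; split; lra.
have h3 : - (pi / 2) < Arg ('i%C * z).
  have [|//] := ltP (- (pi / 2)) (Arg ('i%C * z)); first by [].
  move=> h3; have hA : Arg ('i%C * z) = - (pi / 2) by apply/le_anti; rewrite h1 h3.
  have iz0 : 'i%C * z != 0 by rewrite mulf_neq0// neqi0.
  have n0 : 0 < normc ('i%C * z) by rewrite normc_gt0.
  have [] := cos_sin_Arg iz0; rewrite hA cosN sinN cos_pihalf sin_pihalf => hc hs.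
  exfalso; move/negP: neg; apply; move: hc hs n0; case: (z) => x y.
  move: (normc _) => N /=; rewrite !mul0r !mul1r sub0r add0r => hc hs n0.
  apply/andP; split.
    have := congr1 ( *%R^~ N) hc; rewrite /= mul0r divfK ?lt0r_neq0// => /esym/eqP.
    by rewrite oppr_eq0.
  by have := congr1 ( *%R^~ N) hs; rewrite /= divfK ?lt0r_neq0// => <-; rewrite mulN1r oppr_lt0.
by rewrite addr0 /=; apply/andP; split; lra.
Qed.

Lemma LoghV s z : z != 0 -> halfplane s z -> Logh (~~ s) z^-1 = - Logh s z.
Proof.
move=> z0 hz; have i2 : 'i%C * 'i%C = -1 :> C by rewrite -expr2 sqr_i.
have iV : 'i%C^-1 = - 'i%C :> C by apply: (mulIf neqi0); rewrite mulVf ?neqi0// mulNr i2 opprK.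
have := slit_rotate z0 hz; case: s hz => hz sl; rewrite /Logh /=.
  have -> : 'i%C * z^-1 = (- 'i%C * z)^-1 by rewrite invfM invrN iV opprK.
  by rewrite LogV// opprD.
have -> : - 'i%C * z^-1 = ('i%C * z)^-1 by rewrite invfM iV.
by rewrite LogV// opprB addrC.
Qed.

Lemma halfplaneV s z : halfplane s z -> halfplane (~~ s) z^-1.
Proof.
case: z s => x y []; rewrite /halfplane /= => h.
  by rewrite oppr_le0 divr_ge0// addr_ge0 ?sqr_ge0.
by rewrite oppr_ge0 mulr_le0_ge0// invr_ge0 addr_ge0 ?sqr_ge0.
Qed.

Lemma negative_realV z : negative_real z^-1 = negative_real z.
Proof.
case: z => x y; rewrite /negative_real /= oppr_eq0.
have [->|y0] := eqVneq y 0.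
  rewrite mul0r eqxx /= expr0n /= addr0 expr2.
  have [->|x0] := eqVneq x 0; first by rewrite mul0r.
  by rewrite invfM mulrA mulfV// mul1r invr_lt0.
rewrite mulf_eq0 (negbTE y0) invr_eq0 /=.
by rewrite paddr_eq0 ?sqr_ge0// !sqrf_eq0 (negbTE y0) andbF.
Qed.

Definition uu (x : @Chat R) : C := Log (val x).1.1 + tau *~ (val x).1.2.
(** The value z stands for z + 0i, so 1 - z is approached from below; - Log (1 - z)^-1 is the
    logarithm of 1 - z with that continuity. Crossing (1, oo) downwards raises both the principal
    Log(1 - z) by 2 pi i and q by 1, whence the minus sign before q. *)
Definition vv (x : @Chat R) : C := - Log (1 - (val x).1.1)^-1 - tau *~ (val x).2.

Lemma chz_neq0 (x : @Chat R) : chz x != 0.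
Proof. by have /andP[] := valP x. Qed.

Lemma chz_neq1 (x : @Chat R) : 1 - chz x != 0.
Proof. by rewrite subr_eq0 eq_sym; have /andP[] := valP x. Qed.

Lemma cexp_uu x : cexp (uu x) = chz x.
Proof. by rewrite cexpD cexp_tauz mulr1 cexp_Log// chz_neq0. Qed.

Lemma cexp_vv x : cexp (vv x) = 1 - chz x.
Proof. by rewrite cexpB cexp_tauz divr1 cexpN cexp_Log ?invrK// invr_eq0 chz_neq1. Qed.

Lemma cexp_uuvv x : cexp (uu x) + cexp (vv x) = 1.
Proof. by rewrite cexp_uu cexp_vv addrC subrK. Qed.

Lemma tauz_inj : injective (fun n : int => tau *~ n).
Proof.
move=> m n /eqP; rewrite -subr_eq0 -mulrzBr -mulrzr mulf_eq0 (negbTE (@tau_neq0 R)) /=.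
by rewrite intr_eq0 subr_eq0 => /eqP.
Qed.

Lemma uuvv_inj x y : uu x = uu y -> vv x = vv y -> x = y.
Proof.
move=> eu ev; have ez : chz x = chz y by rewrite -!cexp_uu eu.
apply/val_inj; move: eu ev ez; rewrite /uu /vv /chz.
case: (val x) (val y) => [[z p] q] [[z' p'] q'] /= eu ev ez; subst z'.
by move: eu ev => /addrI/tauz_inj-> /addrI/oppr_inj/tauz_inj->.
Qed.

Lemma uuvv_surj a b : cexp a + cexp b = 1 -> exists x : @Chat R, uu x = a /\ vv x = b.
Proof.
move=> ab; have [p ap] : exists p : int, a = Log (cexp a) + tau *~ p.
  by apply: cexp_eq; rewrite cexp_Log ?cexp_neq0.
have eb : cexp b = 1 - cexp a by rewrite -ab addrC addKr.
have [q bq] : exists q : int, b = - Log (1 - cexp a)^-1 + tau *~ q.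
  by apply: cexp_eq; rewrite cexpN cexp_Log ?invrK// invr_eq0 -eb cexp_neq0.
have v : (cexp a != 0) && (cexp a != 1).
  by rewrite cexp_neq0 /=; apply: contraNneq (cexp_neq0 b) => e; rewrite eb e subrr.
exists (exist (fun x : C * int * int => (x.1.1 != 0) && (x.1.1 != 1)) (cexp a, p, - q) v).
by rewrite /uu /vv /=; split; [rewrite -ap | rewrite mulrNz opprK -bq].
Qed.

Definition Chat_of a b : @Chat R := xget Chat_default [set x | uu x = a /\ vv x = b].

Lemma uu_Chat_of a b : cexp a + cexp b = 1 -> uu (Chat_of a b) = a.
Proof. by move=> /uuvv_surj[x hx]; rewrite /Chat_of; case: xgetP => [y _ []//|/(_ x)]. Qed.

Lemma vv_Chat_of a b : cexp a + cexp b = 1 -> vv (Chat_of a b) = b.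
Proof. by move=> /uuvv_surj[x hx]; rewrite /Chat_of; case: xgetP => [y _ []//|/(_ x)]. Qed.

Lemma Chat_of_uuvv x : Chat_of (uu x) (vv x) = x.
Proof. by apply: uuvv_inj; rewrite ?uu_Chat_of ?vv_Chat_of// cexp_uuvv. Qed.

End CoverCoordinates.
Arguments Logh {R} s z : simpl never.

(** * The quotient topology in logarithmic coordinates *)

Section CoverTopology.
Context {R : realType}.
Local Notation C := R[i].
Local Notation tau := (@tau R).
Implicit Types z a b : C.

Lemma Hside_neq s (w : R * R) : Hside s w ->
  [/\ halfplane s (w.1 +i* w.2), w.1 +i* w.2 != 0, 1 - (w.1 +i* w.2) != 0
    & halfplane (~~ s) (1 - (w.1 +i* w.2))].
Proof.
case: w => x y; rewrite /Hside /halfplane /= => -[hy [w0 w1]]; split=> //.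
- by apply: contra_notN w0 => /eqP [-> ->].
- by rewrite subr_eq0; apply: contra_notN w1 => /eqP [-> ->].
- by case: s hy => /=; rewrite sub0r ?oppr_le0 ?oppr_ge0.
Qed.

Lemma negative_real_1B (x y : R) : negative_real (1 - (x +i* y)) = (y == 0) && (1 < x).
Proof. by rewrite /negative_real /= sub0r oppr_eq0 subr_lt0. Qed.

(** The shifts of p and q in [glue] cancel the jumps of Log on the cuts, so that on each closed half
    plane both coordinates are single continuous branches. The sign [~~ s] appears because z |-> 1 -
    z exchanges the half planes. *)
Lemma uuvv_glue s p q (w : R * R) x : Hside s w -> val x = Defs.glue s p q w ->
  uu x = Logh s (w.1 +i* w.2) + tau *~ p /\
  vv x = Logh (~~ s) (1 - (w.1 +i* w.2)) - tau *~ q.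
Proof.
move=> /[dup] hw /Hside_neq []; set z := _ +i* _ => hz z0 z1 h1z.
have zV0 : (1 - z)^-1 != 0 by rewrite invr_eq0.
have := LoghV z1 h1z; rewrite negbK => hV.
have hzV := halfplaneV h1z; rewrite negbK in hzV.
rewrite /uu /vv /Defs.glue -/z; case: s hw hz h1z hV hzV => hw hz h1z hV hzV /= ->.
  by rewrite /= Log_upper// Log_upper// hV opprK.
have : ((val x).1.1 = z) = ((val x).1.1 = z) by [].
have eneg : negative_real (1 - z)^-1 = (w.2 == 0) && (1 < w.1).
  by rewrite negative_realV negative_real_1B.
have e0 : negative_real z = (w.2 == 0) && (w.1 < 0) by [].
move=> _; case: ifP => [c0|c0]; last case: ifP => [c1|c1].
- have c1 : (w.2 == 0) && (1 < w.1) = false.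
    by case/andP: c0 => _ h; rewrite ltNge (ltW (lt_trans h ltr01)) andbF.
  rewrite /= (Log_lower z0 hz) (Log_lower zV0 hzV) eneg e0 c0 c1 hV addr0 opprK.
  by rewrite mulrzBr mulr1z; split; [ring|].
- rewrite /= (Log_lower z0 hz) (Log_lower zV0 hzV) eneg e0 c0 c1 hV addr0.
  by split=> //; rewrite mulrzBr mulr1z; ring.
- by rewrite /= (Log_lower z0 hz) (Log_lower zV0 hzV) eneg e0 c0 c1 hV !addr0 opprK.
Qed.

Lemma glue_surj s (x : @Chat R) : halfplane s (chz x) ->
  exists p q, val x = Defs.glue s p q (Re (chz x), Im (chz x)).
Proof.
rewrite /Defs.glue /chz; case: (val x) => [[[a b] p] q] /=; case: s => hx.
  by exists p, q.
case c0: ((b == 0) && (a < 0)); first by exists (p + 1), q; rewrite addrK.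
case c1: ((b == 0) && (1 < a)); first by exists p, (q + 1); rewrite addrK.
by exists p, q.
Qed.

Lemma Hside_chz s (x : @Chat R) : halfplane s (chz x) -> Hside s (Re (chz x), Im (chz x)).
Proof.
move=> h; have := chz_neq0 x; have := chz_neq1 x; move: h; rewrite subr_eq0.
case: (chz x) => a b h; rewrite !eq_complex /= !negb_and => h1 h0.
split=> //; split=> [[a0 b0]|[a1 b0]].
  by move: h0; rewrite a0 b0 !eqxx.
by move: h1; rewrite a1 b0 !eqxx.
Qed.

Lemma ccont_pair (w : R * R) : ccont (fun w : R * R => w.1 +i* w.2) w.
Proof. by apply: ccont_ReIm; [exact: cvg_fst | exact: cvg_snd]. Qed.

Lemma ccont_Logh_pair s (w : R * R) : Hside s w -> ccont (fun w : R * R => Logh s (w.1 +i* w.2)) w.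
Proof.
move=> /Hside_neq[hz z0 _ _]; exact: (ccont_comp (ccont_pair w) (ccont_Logh z0 hz)).
Qed.

Lemma ccont_Logh_pair1 s (w : R * R) : Hside s w ->
  ccont (fun w : R * R => Logh (~~ s) (1 - (w.1 +i* w.2))) w.
Proof.
move=> /Hside_neq[_ _ z1 hz].
apply: (ccont_comp (f := Logh (~~ s)) (g := fun w : R * R => 1 - (w.1 +i* w.2))).
  by apply: ccontB; [exact: ccont_cst | exact: ccont_pair].
exact: ccont_Logh.
Qed.

(** The universal property of the quotient topology, with [g] the pullbacks of [f] to the pieces. *)
Lemma ccont_Chat (f : @Chat R -> C) (g : bool -> int -> int -> R * R -> C) :
  (forall s p q w x, Hside s w -> val x = Defs.glue s p q w -> f x = g s p q w) ->
  (forall s p q w, Hside s w -> ccont (g s p q) w) ->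
  forall x, ccont f x.
Proof.
move=> fg cg x; apply/ccontP => e e0.
have oU : Chat_open [set y | normc (f x - f y) < e].
  move=> s p q w hw [y /= hy vy].
  have /ccontP/(_ (e - normc (f x - f y))) := cg s p q w hw.
  rewrite subr_gt0 => /(_ hy); apply: filterS => w' hw' Hw' y' vy'.
  rewrite /= (fg _ _ _ _ _ Hw' vy') -[_ - _](subrKA (f y)).
  rewrite (le_lt_trans (le_normcD _ _))// addrC -ltrBrDr.
  by rewrite {1}(fg _ _ _ _ _ hw vy).
by apply: (open_nbhs_nbhs (A := [set y | normc (f x - f y) < e])); split=> //=; rewrite subrr normc0.
Qed.

Lemma ccont_uu (x : @Chat R) : ccont uu x.
Proof.
apply: (ccont_Chat (g := fun s p q w => Logh s (w.1 +i* w.2) + tau *~ p)).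
  by move=> s p q w y hw vy; have [] := uuvv_glue hw vy.
by move=> s p q w hw; apply: ccontD (ccont_cst _ _); exact: ccont_Logh_pair.
Qed.

Lemma ccont_vv (x : @Chat R) : ccont vv x.
Proof.
apply: (ccont_Chat (g := fun s p q w => Logh (~~ s) (1 - (w.1 +i* w.2)) - tau *~ q)).
  by move=> s p q w y hw vy; have [] := uuvv_glue hw vy.
by move=> s p q w hw; apply: ccontB (ccont_cst _ _); exact: ccont_Logh_pair1.
Qed.

Lemma halfplane_closed s z : ~~ halfplane s z -> \forall w \near z, ~~ halfplane s w.
Proof.
move=> h; have c := ccont_Im (ccont_id z).
have i0 : 0 < `|Im z|.
  by rewrite normr_gt0; apply: contra h => /eqP h; rewrite /halfplane h lexx; case: s.
apply/nearC; exists `|Im z| => // w hw; have := le_lt_trans (normc_Im _) hw.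
rewrite ImD ImN ltr_norml; move: h i0; rewrite /halfplane; case: s; rewrite -ltNge => h.
  by rewrite ltr0_norm// => i0 /andP[? ?]; rewrite -ltNge; lra.
by rewrite gtr0_norm// => i0 /andP[? ?]; rewrite -ltNge; lra.
Qed.

(** Continuity of the inverse of ([uu], [vv]), proved on each closed half plane separately. The
    point [y] with the value cexp (a t') on the sheet (p, q) of the limit point lies in [U], and its
    coordinates are so close to a t' and b t' that it must be the lifted point. *)
Lemma continuous_Chat_of (T : topologicalType) (a b : T -> C) (t : T) :
  ccont a t -> ccont b t -> (\forall s \near t, cexp (a s) + cexp (b s) = 1) ->
  {for t, continuous (fun s => Chat_of (a s) (b s))}.
Proof.
move=> ca cb nab; have ab := nbhs_singleton nab.
set x0 := Chat_of (a t) (b t).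
have ux0 : uu x0 = a t by exact: uu_Chat_of.
have vx0 : vv x0 = b t by exact: vv_Chat_of.
have z0E : chz x0 = cexp (a t) by rewrite -cexp_uu ux0.
move=> A; rewrite nbhsE => -[U [oU Ux0] UA].
suff side s : \forall t' \near t, halfplane s (cexp (a t')) -> U (Chat_of (a t') (b t')).
  apply: filterS2 (side true) (side false) => t' h1 h2; apply: UA.
  by case: (leP 0 (Im (cexp (a t')))) => h; [exact: h1 | apply: h2; exact: ltW].
have cea : ccont (fun t' => cexp (a t')) t := ccont_comp ca (cder_cont (cder_cexp _)).
have [hs|hs] := boolP (halfplane s (cexp (a t))); last first.
  apply: filterS (ccont_open cea (halfplane_closed hs)) => t'.
  by move=> /negbTE ->.
rewrite -z0E in hs; have [p [q vx]] := glue_surj hs.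
have Hs := Hside_chz hs; set w0 := (_, _) in vx Hs.
have N := oU s p q w0 Hs (ex_intro2 _ _ _ Ux0 vx).
pose wt t' := (Re (cexp (a t')), Im (cexp (a t'))).
have cw : wt @ t --> w0.
  by rewrite /w0 z0E; exact: (cvg_pair (ccont_Re cea) (ccont_Im cea)).
have [eu ev] := uuvv_glue Hs vx.
have cL : ccont (fun t' => a t') t by [].
(* Two errors below 1/2 add up to less than the threshold 1 of [cexp_eq_small]. *)
have h5 : 0 < 1 / 2 :> R by lra.
have /ccontP/(_ _ h5) nL1 := ccont_Logh_pair Hs.
have /ccontP/(_ _ h5) nL2 := ccont_Logh_pair1 Hs.
move/ccontP : ca => /(_ _ h5) na; move/ccontP : cb => /(_ _ h5) nb.
have {}nL1 : \forall t' \near t, normc (Logh s (w0.1 +i* w0.2)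
  - Logh s ((wt t').1 +i* (wt t').2)) < 1 / 2 by exact: cw _ nL1.
have {}nL2 : \forall t' \near t, normc (Logh (~~ s) (1 - (w0.1 +i* w0.2))
  - Logh (~~ s) (1 - ((wt t').1 +i* (wt t').2))) < 1 / 2 by exact: cw _ nL2.
have {}N : \forall t' \near t, Hside s (wt t') ->
  forall x', val x' = Defs.glue s p q (wt t') -> U x' by exact: cw _ N.
apply: filterS2 (filterI nab (filterI na nb)) (filterI N (filterI nL1 nL2)).
move=> t' [abt [nat nbt]] [NU [n1 n2]] ht'.
have wtE : (wt t').1 +i* (wt t').2 = cexp (a t') by rewrite /wt; case: (cexp _).
have xt : chz (Chat_of (a t') (b t')) = cexp (a t') by rewrite -cexp_uu uu_Chat_of.
have Ht' : Hside s (wt t') by rewrite /wt -xt; apply: Hside_chz; rewrite xt.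
have vt : (cexp (a t') != 0) && (cexp (a t') != 1).
  rewrite cexp_neq0 /=; have := chz_neq1 (Chat_of (a t') (b t')); rewrite xt subr_eq0 eq_sym.
  by [].
have [y vy] : exists y : @Chat R, val y = Defs.glue s p q (wt t').
  have v : ((Defs.glue s p q (wt t')).1.1 != 0) && ((Defs.glue s p q (wt t')).1.1 != 1).
    by rewrite /Defs.glue wtE; do 3![case: ifP => // _].
  by exists (exist (fun x : C * int * int => (x.1.1 != 0) && (x.1.1 != 1)) _ v).
have [eu' ev'] := uuvv_glue Ht' vy.
suff -> : Chat_of (a t') (b t') = y by exact: NU.
have chy : chz y = cexp (a t') by rewrite -cexp_uu eu' cexpD cexp_tauz mulr1 cexp_Logh ?wtE// cexp_neq0.
apply: uuvv_inj; rewrite ?uu_Chat_of ?vv_Chat_of//.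
  apply: cexp_eq_small; first by rewrite cexp_uu chy.
  have -> : a t' - uu y = - (a t - a t') + (uu x0 - uu y) by rewrite ux0; ring.
  rewrite (le_lt_trans (le_normcD _ _))// normcN eu eu' opprD addrACA subrr addr0.
  by move: nat n1; move: (normc _) (normc _) => ? ?; lra.
apply: cexp_eq_small; first by rewrite cexp_vv chy -abt addrC addKr.
have -> : b t' - vv y = - (b t - b t') + (vv x0 - vv y) by rewrite vx0; ring.
rewrite (le_lt_trans (le_normcD _ _))// normcN ev ev' opprD addrACA subrr addr0.
by move: nbt n2; move: (normc _) (normc _) => ? ?; lra.
Qed.

End CoverTopology.

(** * Logarithmic lifts of the five-term relation and paths between them *)

Section FiveTermSpace.
Context {R : realType}.
Local Notation C := R[i].
Local Notation tau := (@tau R).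

(* Points of the universal abelian cover of {(x, y) | (x, y, ...) in FT}:
   logarithms a0, b0, a1, b1, w of x, 1 - x, y, 1 - y and x - y. *)
Definition ftlog (P : tuple5 C) : Prop := let: (a0, b0, a1, b1, w) := P in
  [/\ cexp a0 + cexp b0 = 1, cexp a1 + cexp b1 = 1 & cexp w = cexp a0 - cexp a1].

(** Writing z2, z3, z4 for the last three entries, 1 - z2 = (x - y) / x, 1 - z3 = (x - y) / (x (1 -
    y)) and 1 - z4 = (x - y) / (1 - y); this is why one further logarithm, that of x - y, makes all
    ten logarithms linear. *)
Definition ftlift (P : tuple5 C) : @Chat5 R := let: (a0, b0, a1, b1, w) := P in
  (Chat_of a0 b0, Chat_of a1 b1, Chat_of (a1 - a0) (w - a0),
   Chat_of (b0 - a0 - b1 + a1) (w - a0 - b1), Chat_of (b0 - b1) (w - b1)).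

Definition ftell (P : tuple5 C) : C := let: (a0, b0, a1, b1, w) := P in
  ell a0 b0 - ell a1 b1 + ell (a1 - a0) (w - a0)
  - ell (b0 - a0 - b1 + a1) (w - a0 - b1) + ell (b0 - b1) (w - b1).

Lemma ftlog_cexp a0 b0 a1 b1 w : ftlog (a0, b0, a1, b1, w) ->
  [/\ cexp (a1 - a0) + cexp (w - a0) = 1,
      cexp (b0 - a0 - b1 + a1) + cexp (w - a0 - b1) = 1
    & cexp (b0 - b1) + cexp (w - b1) = 1].
Proof.
case=> h0 h1 hw; rewrite !cexpD !cexpN.
have e0 : cexp b0 = 1 - cexp a0 by rewrite -h0 addrC addKr.
have e1 : cexp a1 = 1 - cexp b1 by rewrite -h1 addrK.
have := cexp_neq0 a0; have := cexp_neq0 b1; rewrite hw e0 e1.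
by move: (cexp a0) (cexp b1) => x y y0 x0; split; field; rewrite ?x0 ?y0.
Qed.

Lemma cexp_sum_neq a b : cexp a + cexp b = 1 -> ((cexp a : C) != 0) && (cexp a != 1).
Proof.
move=> h; rewrite cexp_neq0 /=; apply: contraNneq (cexp_neq0 b) => e.
by move/eqP: h; rewrite e -subr_eq0 addrC addKr.
Qed.

Lemma ftlift_FT P : ftlog P -> FT (pihat5 (ftlift P)).
Proof.
case: P => [[[[a0 b0] a1] b1] w] hP; have [h2 h3 h4] := ftlog_cexp hP.
case: hP => h0 h1 hw; exists (cexp a0), (cexp a1); split.
- by rewrite -subr_eq0 -hw cexp_neq0.
- exact: cexp_sum_neq h0.
- exact: cexp_sum_neq h1.
- rewrite /pihat5 /map5 /ftlift -!cexp_uu !uu_Chat_of//.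
have e0 : cexp b0 = 1 - cexp a0 by rewrite -h0 addrC addKr.
have e1 : cexp b1 = 1 - cexp a1 by rewrite -h1 addrC addKr.
have := cexp_neq0 a0; have := cexp_neq0 a1; have := cexp_neq0 b1; have := cexp_neq0 b0.
rewrite !cexpD !cexpN e0 e1.
move: (cexp a0) (cexp a1) => x y x1 y1 y0 x0; congr (_, _, _, _, _).
by field; rewrite x0 y0 y1 -oppr_eq0 opprB y1.
Qed.

Definition cdiff (f : C -> C) s := exists d, cder f s d.

(** Paths are given by functions of a complex parameter, complex differentiable at the points of
    [0, 1], so that complex derivatives can be taken along them. *)
Definition ftpath (p : C -> tuple5 C) : Prop := exists a0 b0 a1 b1 w : C -> C,
  (forall s, p s = (a0 s, b0 s, a1 s, b1 s, w s)) /\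
  forall t : R, 0 <= t <= 1 ->
  [/\ cdiff a0 t%:C, cdiff b0 t%:C, cdiff a1 t%:C, cdiff b1 t%:C & cdiff w t%:C] /\
  \forall s \near t%:C, ftlog (a0 s, b0 s, a1 s, b1 s, w s).

(** Closure under symmetry and transitivity replaces reversal and concatenation of paths. What is
    carried along paths, the component of the lift and the value of exp [ftell], respects these
    rules. *)
Inductive linked : tuple5 C -> tuple5 C -> Prop :=
| linked_path p : ftpath p -> linked (p 0) (p 1)
| linked_sym P Q : linked P Q -> linked Q P
| linked_trans Q P S : linked P Q -> linked Q S -> linked P S.

Lemma continuous_Chat5_of (f g h k l : R -> @Chat R) (t : R) :
  {for t, continuous f} -> {for t, continuous g} -> {for t, continuous h} ->
  {for t, continuous k} -> {for t, continuous l} ->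
  {for t, continuous (fun s => (f s, g s, h s, k s, l s) : Chat5)}.
Proof. by move=> cf cg ch ck cl; exact: (cvg_pair (cvg_pair (cvg_pair (cvg_pair cf cg) ch) ck) cl). Qed.

Lemma ftpath_connected p : ftpath p ->
  connected_component (pihat5 @^-1` FT : set (@Chat5 R)) (ftlift (p 0)) (ftlift (p 1)).
Proof.
case=> a0 [b0] [a1] [b1] [w] [pE hp].
pose f (t : R) := ftlift (p t%:C).
have i0 : (`[0, 1] : set R) 0 by rewrite /= in_itv /= lexx ler01.
have i1 : (`[0, 1] : set R) 1 by rewrite /= in_itv /= lexx ler01.
have cf : {within `[0, 1], continuous f}.
  apply: continuous_in_subspaceT => t; rewrite inE /= in_itv /= => t01.
  have [[d0 e0 d1 e1 dw] hn] := hp t t01.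
  have cc (g : C -> C) : cdiff g t%:C -> ccont (fun s : R => g s%:C) t.
    by case=> d /cder_cont; exact: ccont_comp (real_complex_ccont t).
  have {}hn : \forall s \near t, ftlog (a0 s%:C, b0 s%:C, a1 s%:C, b1 s%:C, w s%:C).
    exact: ccont_open (real_complex_ccont t) hn.
  move: d0 e0 d1 e1 dw => /cc d0 /cc e0 /cc d1 /cc e1 /cc dw.
  have -> : f = (fun s : R => (Chat_of (a0 s%:C) (b0 s%:C), Chat_of (a1 s%:C) (b1 s%:C),
     Chat_of (a1 s%:C - a0 s%:C) (w s%:C - a0 s%:C),
     Chat_of (b0 s%:C - a0 s%:C - b1 s%:C + a1 s%:C) (w s%:C - a0 s%:C - b1 s%:C),
     Chat_of (b0 s%:C - b1 s%:C) (w s%:C - b1 s%:C)) : Chat5).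
    by apply/funext => s; rewrite /f pE.
  apply: continuous_Chat5_of.
  - by apply: continuous_Chat_of d0 e0 _; apply: filterS hn => s [].
  - by apply: continuous_Chat_of d1 e1 _; apply: filterS hn => s [].
  - apply: continuous_Chat_of (ccontB d1 d0) (ccontB dw d0) _.
    by apply: filterS hn => s /ftlog_cexp[].
  - apply: continuous_Chat_of (ccontD (ccontB (ccontB e0 d0) e1) d1) (ccontB (ccontB dw d0) e1) _.
    by apply: filterS hn => s /ftlog_cexp[].
  - apply: continuous_Chat_of (ccontB e0 e1) (ccontB dw e1) _.
    by apply: filterS hn => s /ftlog_cexp[].
exists (f @` `[0, 1]); last by exists 1.
split; first by exists 0.
  move=> _ [t /= + <-]; rewrite in_itv /= => t01; have [_ hn] := hp t t01.
  by apply: ftlift_FT; rewrite pE; exact: nbhs_singleton hn.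
apply: connected_continuous_connected cf.
by apply/connected_intervalP; exact: interval_is_interval.
Qed.

(** Each entry contributes a b' - a' b. These cancel because the alternating sum of the wedges of a
    and b over the five linear lifts vanishes identically. *)
Lemma dlog_ftell a0 b0 a1 b1 w s :
  [/\ cdiff a0 s, cdiff b0 s, cdiff a1 s, cdiff b1 s & cdiff w s] ->
  (\forall s \near s, ftlog (a0 s, b0 s, a1 s, b1 s, w s)) ->
  cder (fun s => cexp (ftell (a0 s, b0 s, a1 s, b1 s, w s))) s 0.
Proof.
move=> [[a0' d0] [b0' e0] [a1' d1] [b1' e1] [w' dw]] hn.
have n0 : \forall s \near s, cexp (a0 s) + cexp (b0 s) = 1 by apply: filterS hn => z [].
have n1 : \forall s \near s, cexp (a1 s) + cexp (b1 s) = 1 by apply: filterS hn => z [].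
have n2 : \forall s \near s, cexp (a1 s - a0 s) + cexp (w s - a0 s) = 1.
  by apply: filterS hn => z /ftlog_cexp[].
have n3 : \forall s \near s, cexp (b0 s - a0 s - b1 s + a1 s) + cexp (w s - a0 s - b1 s) = 1.
  by apply: filterS hn => z /ftlog_cexp[].
have n4 : \forall s \near s, cexp (b0 s - b1 s) + cexp (w s - b1 s) = 1.
  by apply: filterS hn => z /ftlog_cexp[].
have l0 := dlog_ell d0 e0 n0.
have l1 := dlog_ell d1 e1 n1.
have l2 := dlog_ell (cderB d1 d0) (cderB dw d0) n2.
have l3 := dlog_ell (cderD (cderB (cderB e0 d0) e1) d1) (cderB (cderB dw d0) e1) n3.
have l4 := dlog_ell (cderB e0 e1) (cderB dw e1) n4.
have l := dlogM (dlogM (dlogM (dlogM l0 (dlogV l1 (cexp_neq0 _))) l2) (dlogV l3 (cexp_neq0 _))) l4.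
apply: cder_ext (cder_eq l _).
  by move=> z; rewrite /ftell !cexpD !cexpN.
rewrite -[RHS](mulr0 (cexp (ell (a0 s) (b0 s)) / cexp (ell (a1 s) (b1 s))
  * cexp (ell (a1 s - a0 s) (w s - a0 s)) / cexp (ell (b0 s - a0 s - b1 s + a1 s) (w s - a0 s - b1 s))
  * cexp (ell (b0 s - b1 s) (w s - b1 s)))); congr (_ * _).
by field; exact: tau_neq0.
Qed.

Lemma ftpath_ftell p : ftpath p -> cexp (ftell (p 0)) = cexp (ftell (p 1)).
Proof.
case=> a0 [b0] [a1] [b1] [w] [pE hp]; apply/esym.
apply: (@cder0_cst _ (fun s => cexp (ftell (p s)))) => t t01.
have [hd hn] := hp t t01.
by apply: cder_ext (dlog_ftell hd hn) => s; rewrite pE.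
Qed.

Lemma linked_connected P Q : linked P Q ->
  connected_component (pihat5 @^-1` FT : set (@Chat5 R)) (ftlift P) (ftlift Q).
Proof.
elim=> [p|{}P {}Q _ /connected_component_sym//|{}Q {}P S _ h1 _ h2].
  exact: ftpath_connected.
exact: connected_component_trans h1 h2.
Qed.

Lemma linked_ftell P Q : linked P Q -> cexp (ftell P) = cexp (ftell Q).
Proof. by elim=> [p /ftpath_ftell//|{}P {}Q _ ->//|{}Q {}P S _ -> _ ->]. Qed.

Definition ftshift (n0 n1 n2 n3 n4 : int) (P : tuple5 C) : tuple5 C :=
  let: (a0, b0, a1, b1, w) := P in
  (a0 + tau *~ n0, b0 + tau *~ n1, a1 + tau *~ n2, b1 + tau *~ n3, w + tau *~ n4).

(** Exchanging x and y requires a logarithm of y - x, here w + pi i. By this symmetry, moves and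
    loops of y follow from those of x. *)
Definition ftswap (P : tuple5 C) : tuple5 C :=
  let: (a0, b0, a1, b1, w) := P in (a1, b1, a0, b0, w + tau / 2).

Lemma ftlog_shift n0 n1 n2 n3 n4 P : ftlog P -> ftlog (ftshift n0 n1 n2 n3 n4 P).
Proof.
case: P => [[[[a0 b0] a1] b1] w] /=.
by rewrite !cexpD !cexp_tauz !mulr1.
Qed.

Lemma ftlog_swap P : ftlog P -> ftlog (ftswap P).
Proof.
case: P => [[[[a0 b0] a1] b1] w] /= [h0 h1 hw]; split=> //.
by rewrite cexpD cexp_tau2 mulrN1 hw opprB.
Qed.

Lemma cdiffD_cst f a s : cdiff f s -> cdiff (fun s => f s + a) s.
Proof. by case=> d hd; exists (d + 0); apply: cderD => //; exact: cder_cst. Qed.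

Lemma linked_shift n0 n1 n2 n3 n4 P Q : linked P Q ->
  linked (ftshift n0 n1 n2 n3 n4 P) (ftshift n0 n1 n2 n3 n4 Q).
Proof.
elim=> [p [a0 [b0 [a1 [b1 [w [pE hp]]]]]]|{}P {}Q _|{}Q {}P S _ h1 _ h2].
- apply: (@linked_path (fun s => ftshift n0 n1 n2 n3 n4 (p s))).
  exists (fun s => a0 s + tau *~ n0), (fun s => b0 s + tau *~ n1), (fun s => a1 s + tau *~ n2),
    (fun s => b1 s + tau *~ n3), (fun s => w s + tau *~ n4); split.
    by move=> s; rewrite pE.
  move=> t /hp[[d0 e0 d1 e1 dw] hn]; split; first by split; exact: cdiffD_cst.
  by apply: filterS hn => s; exact: (@ftlog_shift n0 n1 n2 n3 n4 (_, _, _, _, _)).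
- exact: linked_sym.
- exact: linked_trans h1 h2.
Qed.

Lemma linked_swap P Q : linked P Q -> linked (ftswap P) (ftswap Q).
Proof.
elim=> [p [a0 [b0 [a1 [b1 [w [pE hp]]]]]]|{}P {}Q _|{}Q {}P S _ h1 _ h2].
- apply: (@linked_path (fun s => ftswap (p s))).
  exists a1, b1, a0, b0, (fun s => w s + tau / 2); split.
    by move=> s; rewrite pE.
  move=> t /hp[[d0 e0 d1 e1 dw] hn]; split; first by split=> //; exact: cdiffD_cst.
  by apply: filterS hn => s; exact: (@ftlog_swap (_, _, _, _, _)).
- exact: linked_sym.
- exact: linked_trans h1 h2.
Qed.

(* Moving x along X with y fixed; l0, l1, ly are the increments of the
   logarithms of x, 1 - x, x - y. *)
Lemma linked_move a0 b0 a1 b1 w (l0 l1 ly X : C -> C) :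
  ftlog (a0, b0, a1, b1, w) -> l0 0 = 0 -> l1 0 = 0 -> ly 0 = 0 ->
  (forall t : R, 0 <= t <= 1 -> [/\ cdiff l0 t%:C, cdiff l1 t%:C & cdiff ly t%:C] /\
   \forall s \near t%:C, [/\ cexp (l0 s) * cexp a0 = X s,
     cexp (l1 s) * (1 - cexp a0) = 1 - X s & cexp (ly s) * (cexp a0 - cexp a1) = X s - cexp a1]) ->
  linked (a0, b0, a1, b1, w) (a0 + l0 1, b0 + l1 1, a1, b1, w + ly 1).
Proof.
move=> [h0 h1 hw] l00 l10 ly0 hl.
pose p s : tuple5 C := (l0 s + a0, l1 s + b0, a1, b1, ly s + w).
have -> : (a0, b0, a1, b1, w) = p 0 by rewrite /p l00 l10 ly0 !add0r.
have -> : (a0 + l0 1, b0 + l1 1, a1, b1, w + ly 1) = p 1.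
  by rewrite /p [_ + a0]addrC [_ + b0]addrC [_ + w]addrC.
apply: linked_path; exists (fun s => l0 s + a0), (fun s => l1 s + b0), (fun=> a1), (fun=> b1),
  (fun s => ly s + w); split=> // t /hl[[d0 d1 dy] hn]; split.
  by split; do ?exact: cdiffD_cst; exists 0; exact: cder_cst.
apply: filterS hn => s [e0 e1 ey]; split=> //.
  have eb0 : cexp b0 = 1 - cexp a0 by rewrite -h0 addrC addKr.
  have -> : cexp (l1 s + b0) = 1 - X s by rewrite cexpD eb0.
  by rewrite cexpD e0 addrC subrK.
by rewrite cexpD hw ey cexpD e0.
Qed.

End FiveTermSpace.

(** * Connectedness of the space of logarithms *)

Section FiveTermConnected.
Context {R : realType}.
Local Notation C := R[i].
Local Notation tau := (@tau R).
Implicit Types P Q : tuple5 C.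

Lemma segment_log (r : C) : slit r -> exists l : C -> C,
  l 0 = 0 /\ forall t : R, 0 <= t <= 1 -> cdiff l t%:C /\
    \forall s \near t%:C, cexp (l s) = 1 + s * (r - 1).
Proof.
move=> sr; exists (fun s => Log (1 + s * (r - 1))); rewrite mul0r addr0 Log1; split=> // t t01.
have st : slit (1 + t%:C * (r - 1)).
  by have := slit_segment sr t01; congr slit; ring.
have da := cder_affine 1 (r - 1) t%:C.
split; first by eexists; exact: cder_comp da (cder_Log st).
by apply: filterS (ccont_open (cder_cont da) (nbhs_slit st)) => s /slit_neq0; exact: cexp_Log.
Qed.

(** The three ratio conditions say that the segment from cexp a0 to x misses 0, 1 and y; each
    increment of a logarithm is then a principal logarithm. *)
Lemma linked_segment a0 b0 a1 b1 w (x : C) : ftlog (a0, b0, a1, b1, w) ->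
  slit (x / cexp a0) -> slit ((x - 1) / (cexp a0 - 1)) ->
  slit ((x - cexp a1) / (cexp a0 - cexp a1)) ->
  exists Q, [/\ linked (a0, b0, a1, b1, w) Q, ftlog Q,
    cexp Q.1.1.1.1 = x & cexp Q.1.1.2 = cexp a1].
Proof.
move=> hP /segment_log[l0 [l00 h0]] /segment_log[l1 [l10 h1]] /segment_log[ly [ly0 hy]].
have [hx hy1 hw] := hP.
have x0 := cexp_neq0 a0.
have x1 : cexp a0 - 1 != 0.
  by rewrite -hx opprD addrA subrr add0r oppr_eq0 cexp_neq0.
have xy : cexp a0 - cexp a1 != 0 by rewrite -hw cexp_neq0.
have i1 : 0 <= (1 : R) <= 1 by rewrite ler01 lexx.
exists (a0 + l0 1, b0 + l1 1, a1, b1, w + ly 1).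
have e0 : cexp (l0 1) = x / cexp a0.
  by rewrite (nbhs_singleton (h0 1 i1).2) mul1r addrC subrK.
have e1 : cexp (l1 1) = (x - 1) / (cexp a0 - 1).
  by rewrite (nbhs_singleton (h1 1 i1).2) mul1r addrC subrK.
have ey : cexp (ly 1) = (x - cexp a1) / (cexp a0 - cexp a1).
  by rewrite (nbhs_singleton (hy 1 i1).2) mul1r addrC subrK.
have eb : cexp b0 = - (cexp a0 - 1) by rewrite opprB -hx addrC addKr.
split=> //=.
- apply: (linked_move (X := fun s => cexp a0 + s * (x - cexp a0))) => // t t01.
  have [[d0 n0] [d1 n1]] := (h0 t t01, h1 t t01).
  have [dy ny] := hy t t01; split=> //.
  apply: filterS2 n0 (filterI n1 ny) => s -> [-> ->]; split; by field; rewrite ?x0 ?x1 ?xy.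
- split=> //; rewrite !cexpD ?e0 ?e1 ?ey ?hw ?eb; by field; rewrite ?x0 ?x1 ?xy.
- by rewrite cexpD e0 mulrC divfK.
Qed.

(** The circle 1 + k exp(tau s) stays in the right half plane, so its logarithm returns to its
    initial value: a loop has winding number 0 about the points outside it. *)
Lemma loop_log (k : C) : normc k < 1 -> exists l : C -> C,
  [/\ l 0 = 0, l 1 = 0 & forall t : R, 0 <= t <= 1 -> cdiff l t%:C /\
    \forall s \near t%:C, cexp (l s) * (1 + k) = 1 + k * cexp (tau * s)].
Proof.
move=> k1; have slk (t : R) : slit (1 + k * cexp (tau * t%:C)).
  rewrite /slit; apply/orP; left; rewrite ReD /=.
  have := normc_Re (k * cexp (tau * t%:C)); rewrite normcM normc_cexp.
  have -> : Re (tau * t%:C) = 0 by rewrite ReM /= mul0r mulr0 subr0.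
  rewrite expR0 mulr1 ler_norml => /andP[]; lra.
have k0 : 1 + k != 0 by have := slit_neq0 (slk 0); rewrite mulr0 cexp0 mulr1.
exists (fun s => Log (1 + k * cexp (tau * s)) - Log (1 + k)); split.
- by rewrite mulr0 cexp0 mulr1 subrr.
- by rewrite mulr1 cexp_tau mulr1 subrr.
move=> t t01.
have da : cder (fun s => 1 + k * cexp (tau * s)) t%:C (0 + k * (cexp (tau * t%:C) * (tau * 1))).
  apply: cderD; first exact: cder_cst.
  by apply: cderZ; apply: cder_comp (cder_cexp _); apply: cderZ; exact: cder_id.
split; first by eexists; apply: cderB (cder_cst _ _); exact: cder_comp da (cder_Log (slk t)).
apply: filterS (ccont_open (cder_cont da) (nbhs_slit (slk t))) => s /slit_neq0 s0.
by rewrite cexpB !cexp_Log// divfK.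
Qed.

Lemma full_loop (t : R) : cdiff (fun s => tau * s) t%:C.
Proof. by eexists; apply: cderZ; exact: cder_id. Qed.

Lemma normc_div_lt1 (a b : C) : b != 0 -> normc a < normc b -> normc (a / b) < 1.
Proof. by move=> b0 ab; rewrite normcM normcV ltr_pdivrMr ?mul1r// normc_gt0. Qed.

(** x runs once round 0, and the hypotheses keep 1 and y outside the circle, so only the logarithm
    of x changes. The next two lemmas use circles round 1 and round y in the same way. *)
Lemma linked_loop0 a0 b0 a1 b1 w : ftlog (a0, b0, a1, b1, w) ->
  normc (cexp a0) < 1 -> normc (cexp a0) < normc (cexp a1) ->
  linked (a0, b0, a1, b1, w) (a0 + tau, b0, a1, b1, w).
Proof.
move=> hP h1 hy; rewrite -normcN in h1.
have y0 := cexp_neq0 a1.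
have [l1 [l10 l11 H1]] := loop_log h1.
have : normc (- (cexp a0 / cexp a1)) < 1 by rewrite normcN normc_div_lt1.
move=> /loop_log[ly [ly0 ly1 Hy]].
have := linked_move (l0 := fun s => tau * s) (X := fun s => cexp (tau * s) * cexp a0) hP _ l10 ly0.
rewrite mulr0 mulr1 l11 ly1 !addr0; apply=> // t t01.
have [[d1 n1] [dy ny]] := (H1 t t01, Hy t t01); split; first by split=> //; exact: full_loop.
apply: filterS2 n1 ny => s e1 ey; split=> //; first by rewrite e1; ring.
have -> : cexp a0 - cexp a1 = - cexp a1 * (1 + - (cexp a0 / cexp a1)) by field.
by rewrite mulrCA ey; field.
Qed.

Lemma linked_loop1 a0 b0 a1 b1 w : ftlog (a0, b0, a1, b1, w) ->
  normc (cexp a0 - 1) < 1 -> normc (cexp a0 - 1) < normc (1 - cexp a1) ->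
  linked (a0, b0, a1, b1, w) (a0, b0 + tau, a1, b1, w).
Proof.
move=> hP h0 hy; have [_ hy1 _] := hP.
have y1 : 1 - cexp a1 != 0 by rewrite -hy1 addrC addKr cexp_neq0.
have [l0 [l00 l01 H0]] := loop_log h0.
have [ly [ly0 ly1 Hy]] := loop_log (normc_div_lt1 y1 hy).
have := linked_move (l1 := fun s => tau * s) (X := fun s => 1 + (cexp a0 - 1) * cexp (tau * s)) hP l00 _ ly0.
rewrite mulr0 mulr1 l01 ly1 !addr0; apply=> // t t01.
have [[d0 n0] [dy ny]] := (H0 t t01, Hy t t01); split; first by split=> //; exact: full_loop.
apply: filterS2 n0 ny => s e0 ey; split; last 1 first.
- have -> : cexp a0 - cexp a1 = (1 - cexp a1) * (1 + (cexp a0 - 1) / (1 - cexp a1)) by field.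
  by rewrite mulrCA ey; field.
- by rewrite -e0; ring.
- by ring.
Qed.

Lemma linked_loopy a0 b0 a1 b1 w : ftlog (a0, b0, a1, b1, w) ->
  normc (cexp a0 - cexp a1) < normc (cexp a1) ->
  normc (cexp a0 - cexp a1) < normc (1 - cexp a1) ->
  linked (a0, b0, a1, b1, w) (a0, b0, a1, b1, w + tau).
Proof.
move=> hP h0 h1; have [_ hy1 _] := hP; have y0 := cexp_neq0 a1.
have y1 : 1 - cexp a1 != 0 by rewrite -hy1 addrC addKr cexp_neq0.
have [l0 [l00 l01 H0]] := loop_log (normc_div_lt1 y0 h0).
have : normc (- ((cexp a0 - cexp a1) / (1 - cexp a1))) < 1 by rewrite normcN normc_div_lt1.
move=> /loop_log[l1 [l10 l11 H1]].
have := linked_move (ly := fun s => tau * s)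
  (X := fun s => cexp a1 + (cexp a0 - cexp a1) * cexp (tau * s)) hP l00 l10.
rewrite mulr0 mulr1 l01 l11 !addr0; apply=> // t t01.
have [[d0 n0] [d1 n1]] := (H0 t t01, H1 t t01); split; first by split=> //; exact: full_loop.
apply: filterS2 n0 n1 => s e0 e1; split.
- have -> : cexp a0 = cexp a1 * (1 + (cexp a0 - cexp a1) / cexp a1) by field.
  by rewrite mulrCA e0; field.
- have -> : 1 - cexp a0 = (1 - cexp a1) * (1 + - ((cexp a0 - cexp a1) / (1 - cexp a1))) by field.
  by rewrite mulrCA e1; field.
- by ring.
Qed.

Lemma poly_nonroot (p : {poly R}) : p != 0 -> exists s, p.[s] != 0.
Proof.
move=> p0; pose rs := [seq i%:R : R | i <- iota 0 (size p)].
have u : uniq rs by rewrite map_inj_uniq ?iota_uniq// => i j /eqP; rewrite eqr_nat => /eqP.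
have [al|] := boolP (all (root p) rs).
  by have := max_poly_roots p0 al u; rewrite size_map size_iota ltnn.
by move=> /allPn[s _ hs]; exists s.
Qed.

(* The point s + i s^2 lies on the line through b and b + d exactly at the roots
   of this polynomial, so a generic point of the parabola avoids finitely many lines. *)
Definition line_poly (b d : C) : {poly R} :=
  Re d *: ('X^2 - (Im b)%:P) - Im d *: ('X - (Re b)%:P).

Lemma line_poly_neq0 b d : d != 0 -> line_poly b d != 0.
Proof.
move=> d0; apply/eqP => h.
have c2 : (line_poly b d)`_2 = Re d.
  by rewrite /line_poly !coefB !coefZ !coefB coefXn coefC coefX coefC /= !subr0 mulr1 mulr0 subr0.
have c1 : (line_poly b d)`_1 = - Im d.
  by rewrite /line_poly !coefB !coefZ !coefB coefXn coefC coefX coefC /= !subr0 mulr1 mulr0 sub0r.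
move: c1 c2; rewrite h !coef0 => /esym/eqP; rewrite oppr_eq0 => /eqP i0 r0.
by move/negP: d0; apply; rewrite eq_complex -r0 i0 !eqxx.
Qed.

Lemma Im_div_line_poly (b d : C) (s : R) : d != 0 ->
  (line_poly b d).[s] != 0 -> Im ((s +i* (s ^+ 2) - b) / d) != 0.
Proof.
case: b d => b1 b2 [d1 d2] d0.
have n0 : d1 ^+ 2 + d2 ^+ 2 != 0.
  rewrite paddr_eq0 ?sqr_ge0// !sqrf_eq0.
  by move: d0; rewrite eq_complex.
rewrite /line_poly !hornerE /=; apply: contra_neq => /eqP.
have -> : (s - b1) * - (d2 / (d1 ^+ 2 + d2 ^+ 2)) + (s ^+ 2 - b2) * (d1 / (d1 ^+ 2 + d2 ^+ 2))
  = (d1 * (s ^+ 2 - b2) - d2 * (s - b1)) / (d1 ^+ 2 + d2 ^+ 2) by field.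
by rewrite mulf_eq0 invr_eq0 (negbTE n0) orbF => /eqP.
Qed.

Lemma slit_Im (z : C) : Im z != 0 -> slit z.
Proof. by rewrite /slit => ->; rewrite orbT. Qed.

Lemma slitV_Im (z : C) : Im z != 0 -> slit z^-1.
Proof.
case: z => a b b0; apply: slit_Im => /=; rewrite oppr_eq0 mulf_neq0//.
by rewrite invr_eq0 paddr_eq0 ?sqr_ge0// !sqrf_eq0 (negbTE b0) andbF.
Qed.

(** The segment from x to x' may meet a forbidden point b; the detour through m avoids all of
    them. *)
Lemma generic_midpoint (x x' : C) (bs : seq C) :
  (forall b, b \in bs -> x != b /\ x' != b) ->
  exists m : C, forall b, b \in bs -> slit ((m - b) / (x - b)) /\ slit ((x' - b) / (m - b)).
Proof.
move=> hb; pose p := \prod_(b <- bs) (line_poly b (x - b) * line_poly b (x' - b)).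
have p0 : p != 0.
  rewrite /p prodf_seq_neq0; apply/allP => b /hb[hx hx'] /=.
  by rewrite mulf_neq0// line_poly_neq0// subr_eq0.
have [s] := poly_nonroot p0; rewrite /p horner_prod prodf_seq_neq0 => /allP hs.
exists (s +i* (s ^+ 2)) => b /[dup] /hb[hx hx'] /hs /=.
rewrite hornerM mulf_eq0 negb_or => /andP[h1 h2]; split.
  by apply/slit_Im/Im_div_line_poly; rewrite ?subr_eq0.
by rewrite -invf_div; apply/slitV_Im/Im_div_line_poly; rewrite ?subr_eq0.
Qed.

Lemma linked_movex P (x' : C) : ftlog P -> (x' != 0) && (x' != 1) -> x' != cexp P.1.1.2 ->
  exists Q, [/\ linked P Q, ftlog Q, cexp Q.1.1.1.1 = x' & cexp Q.1.1.2 = cexp P.1.1.2].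
Proof.
case: P => [[[[a0 b0] a1] b1] w] /= hP /andP[x'0 x'1] x'y.
have [hx _ hw] := hP.
have x1 : cexp a0 != 1 by have /andP[] := cexp_sum_neq hx.
have xy : cexp a0 != cexp a1 by rewrite -subr_eq0 -hw cexp_neq0.
have [|m hm] := @generic_midpoint (cexp a0) x' [:: 0; 1; cexp a1].
  by move=> b; rewrite !inE => /or3P[] /eqP ->; rewrite ?cexp_neq0.
have [m0 m0'] := hm 0 (mem_head _ _).
have [m1 m1'] : slit ((m - 1) / (cexp a0 - 1)) /\ slit ((x' - 1) / (m - 1)).
  by apply: hm; rewrite !inE eqxx orbT.
have [my my'] : slit ((m - cexp a1) / (cexp a0 - cexp a1)) /\ slit ((x' - cexp a1) / (m - cexp a1)).
  by apply: hm; rewrite !inE eqxx !orbT.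
rewrite !subr0 in m0 m0'.
have [[[[[c0 d0] c1] d1] v] [l1 hQ /= ec ec1]] := linked_segment hP m0 m1 my.
rewrite -ec -ec1 in m0' m1' my'.
have [S [l2 hS eS eS1]] := linked_segment hQ m0' m1' my'.
by exists S; split=> //; [exact: linked_trans l1 l2 | rewrite eS1].
Qed.

Lemma ftswap2 P : ftswap (ftswap P) = ftshift 0 0 0 0 1 P.
Proof.
case: P => [[[[a0 b0] a1] b1] w] /=; rewrite !mulr0z !addr0; congr (_, _).
by rewrite mulr1z -addrA -splitr.
Qed.

Lemma linked_movey P (y' : C) : ftlog P -> (y' != 0) && (y' != 1) -> y' != cexp P.1.1.1.1 ->
  exists Q, [/\ linked P Q, ftlog Q, cexp Q.1.1.2 = y' & cexp Q.1.1.1.1 = cexp P.1.1.1.1].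
Proof.
move=> hP hy hxy; have [|Q [l hQ e0 e1]] := linked_movex (ftlog_swap hP) hy.
  by case: (P) hxy => [[[[a0 b0] a1] b1] w].
(* Swapping twice adds [tau] to w, and the shift by -1 undoes this. *)
exists (ftshift 0 0 0 0 (-1) (ftswap Q)); split.
- have := linked_shift 0 0 0 0 (-1) (linked_swap l); rewrite ftswap2.
  case: (P) => [[[[a0 b0] a1] b1] w] /=; rewrite !mulr0z !addr0 -addrA -mulrzDr addrN.
  by rewrite mulr0z addr0.
- exact/ftlog_shift/ftlog_swap.
- by case: (Q) e0 => [[[[a0 b0] a1] b1] w] /=; rewrite mulr0z addr0.
- case: (Q) e1 => [[[[a0 b0] a1] b1] w] /=; rewrite mulr0z addr0 => ->.
  by case: (P) => [[[[? ?] ?] ?] ?].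
Qed.

Lemma exists_other (bs : seq C) : exists m : C, m \notin bs.
Proof.
pose rs := [seq (i%:R : C) | i <- iota 0 (size bs).+1].
have u : uniq rs by rewrite map_inj_uniq ?iota_uniq// => i j /eqP; rewrite eqr_nat => /eqP.
have [|/allPn[m _ hm]] := boolP (all (mem bs) rs); last by exists m.
move=> /allP h; have := uniq_leq_size u h.
by rewrite size_map size_iota ltnn.
Qed.

Lemma linked_reach P (x y : C) : ftlog P -> (x != 0) && (x != 1) -> (y != 0) && (y != 1) ->
  x != y -> exists Q, [/\ linked P Q, ftlog Q, cexp Q.1.1.1.1 = x & cexp Q.1.1.2 = y].
Proof.
move=> hP hx hy xy.
(* x is parked at a point m different from the old and the new y, which lets y move before x goes to
   its destination. *)
have [m] := exists_other [:: 0; 1; cexp P.1.1.2; y].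
rewrite !inE !negb_or => /and4P[m0 m1 mP my].
have [|Q1 [l1 hQ1 e1 f1]] := linked_movex hP _ mP; first by rewrite m0.
have [|Q2 [l2 hQ2 e2 f2]] := linked_movey hQ1 hy; first by rewrite e1 eq_sym.
have [|Q3 [l3 hQ3 e3 f3]] := linked_movex hQ2 hx; first by rewrite e2.
exists Q3; split=> //; last by rewrite f3.
exact: linked_trans l1 (linked_trans l2 l3).
Qed.

Lemma ftshift0 P : ftshift 0 0 0 0 0 P = P.
Proof. by case: P => [[[[a0 b0] a1] b1] w] /=; rewrite !mulr0z !addr0. Qed.

Lemma ftshiftD m0 m1 m2 m3 m4 n0 n1 n2 n3 n4 P :
  ftshift m0 m1 m2 m3 m4 (ftshift n0 n1 n2 n3 n4 P) =
  ftshift (n0 + m0) (n1 + m1) (n2 + m2) (n3 + m3) (n4 + m4) P.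
Proof. by case: P => [[[[a0 b0] a1] b1] w] /=; rewrite !mulrzDr !addrA. Qed.

(** Paths commute with shifts, so conjugation by a path to one convenient pair (x, y) realises the
    shift everywhere. *)
Lemma linked_period n0 n1 n2 n3 n4 (x y : C) :
  (x != 0) && (x != 1) -> (y != 0) && (y != 1) -> x != y ->
  (forall Q, ftlog Q -> cexp Q.1.1.1.1 = x -> cexp Q.1.1.2 = y -> linked Q (ftshift n0 n1 n2 n3 n4 Q)) ->
  forall P, ftlog P -> linked P (ftshift n0 n1 n2 n3 n4 P).
Proof.
move=> hx hy xy hQ P hP; have [Q [l hQ' ex ey]] := linked_reach hP hx hy xy.
apply: (linked_trans l (linked_trans (hQ Q hQ' ex ey) _)).
exact: linked_sym (linked_shift n0 n1 n2 n3 n4 l).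
Qed.

Lemma neqC_nat (m n : nat) : (m%:R : C) != n%:R = (m != n).
Proof. by rewrite eqr_nat. Qed.

Lemma normc_nat (n : nat) : normc (n%:R : C) = n%:R.
Proof. by rewrite -[n%:R](rmorph_nat (real_complex R)) normcR normr_nat. Qed.

Lemma linked_shift_a0 P : ftlog P -> linked P (ftshift 1 0 0 0 0 P).
Proof.
have h0 : (2^-1 : C) != 0 by rewrite invr_eq0 pnatr_eq0.
have e2 : normc (2^-1 : C) = 2^-1 by rewrite normcV normc_nat.
(* The circle of radius 1/2 about 0 leaves 1 and y = 2 outside. Similarly, x = 1/2 and y = 3 serve
   for the loop about 1, and x = 4 and y = 5 for the loop about y. *)
apply: (@linked_period _ _ _ _ _ 2^-1 2).
- exact: half_valid.
- by rewrite pnatr_eq0 /= (neqC_nat 2 1).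
- apply/eqP => h; have := congr1 (@normc R) h; rewrite e2 normc_nat; lra.
case=> [[[[a0 b0] a1] b1] w] hQ /= ex ey; rewrite mulr1z !mulr0z !addr0.
by apply: linked_loop0; rewrite ?ex ?ey// e2 ?normc_nat; lra.
Qed.

Lemma linked_shift_b0 P : ftlog P -> linked P (ftshift 0 1 0 0 0 P).
Proof.
have e2 : normc (2^-1 : C) = 2^-1 by rewrite normcV normc_nat.
apply: (@linked_period _ _ _ _ _ 2^-1 3).
- exact: half_valid.
- by rewrite pnatr_eq0 /= (neqC_nat 3 1).
- apply/eqP => h; have := congr1 (@normc R) h; rewrite e2 normc_nat; lra.
case=> [[[[a0 b0] a1] b1] w] hQ /= ex ey; rewrite mulr1z !mulr0z !addr0.
have eh : (2^-1 - 1 : C) = - 2^-1 by field.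
have e3 : (1 - 3 : C) = - 2 by ring.
by apply: linked_loop1; rewrite ?ex ?ey// eh normcN e2 ?e3 ?normcN ?normc_nat; lra.
Qed.

Lemma linked_shift_w P : ftlog P -> linked P (ftshift 0 0 0 0 1 P).
Proof.
apply: (@linked_period _ _ _ _ _ 4 5).
- by rewrite pnatr_eq0 /= (neqC_nat 4 1).
- by rewrite pnatr_eq0 /= (neqC_nat 5 1).
- by rewrite (neqC_nat 4 5).
case=> [[[[a0 b0] a1] b1] w] hQ /= ex ey; rewrite mulr1z !mulr0z !addr0.
have e1 : (4 - 5 : C) = - 1 by ring.
have e4 : (1 - 5 : C) = - 4 by ring.
by apply: linked_loopy; rewrite ?ex ?ey// e1 normcN normc1 ?e4 ?normcN ?normc_nat; lra.
Qed.

Lemma linked_shift_swap n0 n1 n2 n3 n4 :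
  (forall P, ftlog P -> linked P (ftshift n0 n1 n2 n3 n4 P)) ->
  forall P, ftlog P -> linked P (ftshift n2 n3 n0 n1 n4 P).
Proof.
move=> h P hP; have := linked_shift 0 0 0 0 (-1) (linked_swap (h _ (ftlog_swap hP))).
rewrite ftswap2 ftshiftD addr0 subrr ftshift0.
suff -> : ftshift 0 0 0 0 (-1) (ftswap (ftshift n0 n1 n2 n3 n4 (ftswap P))) = ftshift n2 n3 n0 n1 n4 P by [].
case: P {hP} => [[[[a0 b0] a1] b1] w] /=; rewrite !mulr0z !addr0; congr (_, _).
by rewrite mulrNz mulr1z; field.
Qed.

Lemma linked_refl P : ftlog P -> linked P P.
Proof. by move=> /linked_shift_a0 l; exact: linked_trans l (linked_sym l). Qed.

Lemma linked_shift_int n0 n1 n2 n3 n4 :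
  (forall P, ftlog P -> linked P (ftshift n0 n1 n2 n3 n4 P)) ->
  forall (n : int) P, ftlog P -> linked P (ftshift (n0 * n) (n1 * n) (n2 * n) (n3 * n) (n4 * n) P).
Proof.
move=> h.
have hn (m : nat) P : ftlog P ->
    linked P (ftshift (n0 * m%:Z) (n1 * m%:Z) (n2 * m%:Z) (n3 * m%:Z) (n4 * m%:Z) P).
  elim: m P => [|m ih] P hP; first by rewrite !mulr0 ftshift0; exact: linked_refl.
  apply: linked_trans (ih P hP) _.
  rewrite -addn1 PoszD !mulrDr !mulr1 -ftshiftD; apply: h; exact: ftlog_shift.
case=> m P hP; first exact: hn.
rewrite NegzE !mulrN; apply: linked_sym.
set Q := ftshift _ _ _ _ _ P; have hQ : ftlog Q by exact: ftlog_shift.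
by have := hn m.+1 Q hQ; rewrite /Q ftshiftD !addNr ftshift0.
Qed.

Lemma linked_shift_all n0 n1 n2 n3 n4 P : ftlog P -> linked P (ftshift n0 n1 n2 n3 n4 P).
Proof.
have L0 := linked_shift_int linked_shift_a0.
have L1 := linked_shift_int linked_shift_b0.
have L2 := linked_shift_int (linked_shift_swap linked_shift_a0).
have L3 := linked_shift_int (linked_shift_swap linked_shift_b0).
have L4 := linked_shift_int linked_shift_w.
move=> hP; have e : ftshift n0 n1 n2 n3 n4 P = ftshift (0 * n4) (0 * n4) (0 * n4) (0 * n4) (1 * n4)
   (ftshift (0 * n3) (0 * n3) (0 * n3) (1 * n3) (0 * n3)
   (ftshift (0 * n2) (0 * n2) (1 * n2) (0 * n2) (0 * n2)
   (ftshift (0 * n1) (1 * n1) (0 * n1) (0 * n1) (0 * n1)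
   (ftshift (1 * n0) (0 * n0) (0 * n0) (0 * n0) (0 * n0) P)))).
  by rewrite !ftshiftD !mul0r !mul1r !addr0 !add0r.
rewrite e; apply: linked_trans (L0 n0 P hP) _.
apply: linked_trans (L1 n1 _ _) _; first exact: ftlog_shift.
apply: linked_trans (L2 n2 _ _) _; first by do 2?apply: ftlog_shift.
apply: linked_trans (L3 n3 _ _) _; first by do 3?apply: ftlog_shift.
by apply: L4; do 4?apply: ftlog_shift.
Qed.

Lemma linked_all P Q : ftlog P -> ftlog Q -> linked P Q.
Proof.
move=> hP; case: Q => [[[[a0 b0] a1] b1] w] /[dup] hQ [hx hy hw].
have xy : cexp a0 != cexp a1 by rewrite -subr_eq0 -hw cexp_neq0.
have [] := linked_reach hP (cexp_sum_neq hx) (cexp_sum_neq hy) xy.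
case=> [[[[c0 d0] c1] d1] v] [l /[dup] hS [hx' hy' hw'] /= e0 e1].
apply: linked_trans l _.
have [n0 ->] := cexp_eq e0; have [n2 ->] := cexp_eq e1.
have f0 : cexp d0 = cexp b0 by apply: (addrI (cexp a0)); rewrite hx -e0.
have f1 : cexp d1 = cexp b1 by apply: (addrI (cexp a1)); rewrite hy -e1.
have fw : cexp v = cexp w by rewrite hw hw' e0 e1.
have [n1 ->] := cexp_eq f0; have [n3 ->] := cexp_eq f1; have [n4 ->] := cexp_eq fw.
exact/linked_sym/(linked_shift_all n0 n1 n2 n3 n4 hQ).
Qed.

Lemma ftell_const P Q : ftlog P -> ftlog Q -> cexp (ftell P) = cexp (ftell Q).
Proof. by move=> hP hQ; exact/linked_ftell/linked_all. Qed.

End FiveTermConnected.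

(** * The component as the solution set of linear equations *)

Section FThatLog.
Context {R : realType}.
Local Notation C := R[i].
Local Notation tau := (@tau R).
Implicit Types (P : tuple5 C) (u : @Chat5 R).

Definition FTlog u : Prop := let: (a, b, c, d, e) := u in
  [/\ uu c = uu b - uu a, vv d = vv c - vv b, uu e = vv a - vv b,
      uu d = vv a - uu a - vv b + uu b & vv e = vv c + uu a - vv b].

Definition logs_of u : tuple5 C := let: (a, b, c, d, e) := u in
  (uu a, vv a, uu b, vv b, vv c + uu a).

Lemma FTlog_lift u : FTlog u -> ftlog (logs_of u) /\ u = ftlift (logs_of u).
Proof.
case: u => [[[[a b] c] d] e] [hc hd he hd' he']; split.
  split; [exact: cexp_uuvv|exact: cexp_uuvv|].
  have := cexp_uuvv c; rewrite hc; move: (uu a) (uu b) (vv c) => x y v.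
  rewrite !cexpD !cexpN; have := cexp_neq0 x; move: (cexp x) (cexp y) (cexp v) => X Y V X0 h.
  have -> : V = 1 - Y / X by rewrite -h addrC addKr.
  by field.
rewrite /ftlift /logs_of addrK -hc Chat_of_uuvv Chat_of_uuvv Chat_of_uuvv.
by rewrite -hd' -hd -he -he' !Chat_of_uuvv.
Qed.

Lemma ftlift_FTlog P : ftlog P -> FTlog (ftlift P).
Proof.
case: P => [[[[a0 b0] a1] b1] w] /[dup] /ftlog_cexp[h2 h3 h4] [h0 h1 hw].
by rewrite /FTlog /ftlift !uu_Chat_of// !vv_Chat_of//; split=> //; ring.
Qed.

Lemma FT_cexp (a b c d e : @Chat R) : FT (pihat5 (a, b, c, d, e)) ->
  [/\ cexp (uu c) = cexp (uu b - uu a), cexp (vv d) = cexp (vv c - vv b),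
      cexp (uu e) = cexp (vv a - vv b),
      cexp (uu d) = cexp (vv a - uu a - vv b + uu b) &
      cexp (vv e) = cexp (vv c + uu a - vv b)].
Proof.
case=> x [y] [xy /andP[x0 x1] /andP[y0 y1]] [ea eb ec ed ee].
have := (cexp_uu a, cexp_uu b, cexp_uu c, cexp_uu d, cexp_uu e).
have := (cexp_vv a, cexp_vv b, cexp_vv c, cexp_vv d, cexp_vv e).
rewrite ea eb ec ed ee.
move: (uu a) (uu b) (uu c) (uu d) (uu e) (vv a) (vv b) (vv c) (vv d) (vv e).
move=> ua ub uc ud ue va vb vc vd ve hv hu; rewrite !cexpD !cexpN !hu !hv.
have x1' : 1 - x != 0 by rewrite subr_eq0 eq_sym.
have y1' : 1 - y != 0 by rewrite subr_eq0 eq_sym.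
have y1'' : y - 1 != 0 by rewrite subr_eq0.
have xy' : x - y != 0 by rewrite subr_eq0.
by split; field; rewrite ?x0 ?y0 ?x1' ?y1' ?y1'' ?xy'.
Qed.

Lemma cexp_eq_Im (a b : C) : cexp a = cexp b -> `|Im a - Im b| < pi *+ 2 -> a = b.
Proof.
move=> /cexp_eq[n ->]; rewrite ImD.
have -> : Im (tau *~ n) = n%:~R * (pi *+ 2).
  by rewrite [LHS](raddfMz (@complex.Im R : Rcomplex R -> R)) /= mulrzl.
have p2 : 0 < pi *+ 2 :> R by rewrite pmulrn_lgt0// pi_gt0.
rewrite addrAC subrr add0r normrM (gtr0_norm p2) -[ltRHS]mul1r (ltr_pM2r p2).
rewrite -intr_norm -[1]/(1%:~R) ltr_int => n1.
have -> : n = 0 by lia.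
by rewrite mulr0z addr0.
Qed.

Lemma Arg_upper (z : C) : 0 < Im z -> 0 < Arg z < pi.
Proof.
move=> i0; have sz : slit z by rewrite /slit gt_eqF// orbT.
have z0 := slit_neq0 sz; have n0 : 0 < normc z by rewrite normc_gt0.
rewrite (Arg_lt_pi sz) andbT ltNge; apply/negP => A0.
have [_ hs] := cos_sin_Arg z0.
have : 0 < sin (Arg z) by rewrite hs divr_gt0.
rewrite ltNge -oppr_ge0 -sinN sin_ge0_pi//; have /andP[? _] := Arg_bound z.
by apply/andP; split; lra.
Qed.

Lemma uu_vv_upper (x : @Chat R) : 0 < Im (chz x) -> (val x).1.2 = 0 -> (val x).2 = 0 ->
  0 < Im (uu x) < pi /\ - pi < Im (vv x) < 0.
Proof.
move=> i0 p0 q0; rewrite /uu /vv p0 q0 !mulr0z addr0 subr0 ImN !Im_Log; split.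
  exact: Arg_upper.
have : 0 < Im (1 - chz x)^-1.
  case: (chz x) (chz_neq1 x) i0 => a b h /= b0.
  rewrite sub0r mulNr opprK divr_gt0// ltr_pwDr ?sqr_ge0// exprn_even_gt0//=.
  by rewrite oppr_eq0 gt_eqF.
by move=> /Arg_upper /andP[? ?]; apply/andP; split; lra.
Qed.

(** Here every u has imaginary part in (0, pi) and every v in (-pi, 0), so the two sides of each
    equation are less than 2 pi apart and have equal exponentials. *)
Lemma FTplus_FTlog u : FTplus_lift u -> FTlog u.
Proof.
have diffU (s t : R) : 0 < s < pi -> 0 < t < pi -> `|s - t| < pi.
  by move=> /andP[? ?] /andP[? ?]; rewrite ltr_norml; apply/andP; split; lra.
have diffL (s t : R) : - pi < s < 0 -> - pi < t < 0 -> `|s - t| < pi.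
  by move=> /andP[? ?] /andP[? ?]; rewrite ltr_norml; apply/andP; split; lra.
have sumUL (s t : R) : - pi < s < 0 -> 0 < t < pi -> `|s + t| < pi.
  by move=> /andP[? ?] /andP[? ?]; rewrite ltr_norml; apply/andP; split; lra.
have normU (s : R) : 0 < s < pi -> `|s| < pi by move=> /andP[? ?]; rewrite gtr0_norm.
have normL (s : R) : - pi < s < 0 -> `|s| < pi.
  by move=> /andP[? ?]; rewrite ltr0_norm//; lra.
have window (s t : R) : `|s| < pi -> `|t| < pi -> `|s - t| < pi *+ 2.
  by move=> hs ht; rewrite (le_lt_trans (ler_normB _ _))// mulr2n ltrD.
have window3 (s t r : R) : 0 < s < pi -> 0 < t < pi -> 0 < r < pi -> `|s - (t + r)| < pi *+ 2.
  move=> /andP[? ?] /andP[? ?] /andP[? ?].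
  by rewrite mulr2n ltr_norml; apply/andP; split; lra.
case: u => [[[[a b] c] d] e] [[/FT_cexp[h1 h2 h3 h4 h5]]].
rewrite /pihat5 /map5 -!complexIm -![0 < _%:C]/(0%:C < _) !ltcR => -[ia ib ic id ie].
move=> [[pa qa] [pb qb] [pc qc] [pd qd] [pe qe]].
have [ua va] := uu_vv_upper ia pa qa.
have [ub vb] := uu_vv_upper ib pb qb.
have [uc vc] := uu_vv_upper ic pc qc.
have [ud vd] := uu_vv_upper id pd qd.
have [ue ve] := uu_vv_upper ie pe qe.
have e1 : uu c = uu b - uu a.
  apply: cexp_eq_Im h1 _; rewrite (ImD (uu b)) (ImN (uu a)).
  by apply: window; [exact: normU | exact: diffU].
have e2 : vv d = vv c - vv b.
  apply: cexp_eq_Im h2 _; rewrite (ImD (vv c)) (ImN (vv b)).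
  by apply: window; [exact: normL | exact: diffL].
have e3 : uu e = vv a - vv b.
  apply: cexp_eq_Im h3 _; rewrite (ImD (vv a)) (ImN (vv b)).
  by apply: window; [exact: normU | exact: diffL].
(* The crude bound on the four terms on the left would exceed 2 pi; the equations already proved
   shorten the sum to two terms. *)
have e4 : vv a - uu a - vv b + uu b = uu e + uu c by rewrite e1 e3; ring.
have e5 : vv c + uu a - vv b = vv d + uu a by rewrite e2; ring.
split=> //.
  by apply: cexp_eq_Im h4 _; rewrite e4 (ImD (uu e)); exact: window3.
apply: cexp_eq_Im h5 _; rewrite e5 (ImD (vv d)).
by apply: window; [exact: normL | exact: sumUL].
Qed.

(** On A the distance [h] of f and g is either 0 or at least 1, so the locus where they agree is
    both open and closed in A. *)
Lemma ccont_eq_connected (T : topologicalType) (A : set T) (f g : T -> C) (v : T) :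
  connected A -> (forall x, ccont f x) -> (forall x, ccont g x) ->
  (forall x, A x -> cexp (f x) = cexp (g x)) -> A v -> f v = g v ->
  forall x, A x -> f x = g x.
Proof.
move=> cA cf cg fg Av fgv x Ax.
pose h y : R := normc (f y - g y).
have ch : continuous h by move=> y; exact: (ccont_normc (ccontB (cf y) (cg y))).
have hv : h v = 0 by rewrite /h fgv subrr normc0.
have near_eq y : A y -> h y < 1 -> f y = g y by move=> /fg; exact: cexp_eq_small.
have h0 y : f y = g y -> h y = 0 by move=> e; rewrite /h e subrr normc0.
pose B := A `&` [set y | f y = g y].
have BA : B = A.
  apply: cA; first by exists v.
    exists (h @^-1` [set r | r < 1]); first by apply: open_comp (@open_lt R 1) => y _; exact: ch.
    apply/seteqP; split=> y [Ay /= ey]; split=> //=.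
      by rewrite h0// ltr01.
    exact: near_eq.
  exists (h @^-1` [set r | r <= 0]); first by apply: closed_comp (@closed_le R 0) => y _; exact: ch.
  apply/seteqP; split=> y [Ay /= ey]; split=> //=.
    by rewrite h0.
  by apply: near_eq => //; exact: le_lt_trans ey ltr01.
have : B x by rewrite BA.
by case.
Qed.

Lemma FThat_FTlog u : FThat u -> FTlog u.
Proof.
case=> v /FTplus_FTlog hv [A [Av AF cA] Au].
have cu (i : @Chat5 R -> @Chat R) : continuous i -> forall x, ccont (fun x => uu (i x)) x.
  by move=> ci x; split; apply: continuous_comp; [exact: ci | case: (ccont_uu (i x))].
have cv (i : @Chat5 R -> @Chat R) : continuous i -> forall x, ccont (fun x => vv (i x)) x.
  by move=> ci x; split; apply: continuous_comp; [exact: ci | case: (ccont_vv (i x))].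
have pe : continuous (fun x : @Chat5 R => x.2) by move=> x; exact: cvg_snd.
have p4 : continuous (fun x : @Chat5 R => x.1) by move=> x; exact: cvg_fst.
have pd : continuous (fun x : @Chat5 R => x.1.2).
  by move=> x; apply: (continuous_comp (p4 x)); exact: cvg_snd.
have p3 : continuous (fun x : @Chat5 R => x.1.1).
  by move=> x; apply: (continuous_comp (p4 x)); exact: cvg_fst.
have pc : continuous (fun x : @Chat5 R => x.1.1.2).
  by move=> x; apply: (continuous_comp (p3 x)); exact: cvg_snd.
have p2 : continuous (fun x : @Chat5 R => x.1.1.1).
  by move=> x; apply: (continuous_comp (p3 x)); exact: cvg_fst.
have pb : continuous (fun x : @Chat5 R => x.1.1.1.2).
  by move=> x; apply: (continuous_comp (p2 x)); exact: cvg_snd.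
have pa : continuous (fun x : @Chat5 R => x.1.1.1.1).
  by move=> x; apply: (continuous_comp (p2 x)); exact: cvg_fst.
have hF (x : @Chat5 R) : A x ->
  [/\ cexp (uu x.1.1.2) = cexp (uu x.1.1.1.2 - uu x.1.1.1.1),
      cexp (vv x.1.2) = cexp (vv x.1.1.2 - vv x.1.1.1.2),
      cexp (uu x.2) = cexp (vv x.1.1.1.1 - vv x.1.1.1.2),
      cexp (uu x.1.2) = cexp (vv x.1.1.1.1 - uu x.1.1.1.1 - vv x.1.1.1.2 + uu x.1.1.1.2) &
      cexp (vv x.2) = cexp (vv x.1.1.2 + uu x.1.1.1.1 - vv x.1.1.1.2)].
  by case: x => [[[[a b] c] d] e] /AF; exact: FT_cexp.
have E (f g : @Chat5 R -> C) := @ccont_eq_connected _ A f g v cA.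
have FTlogE (x : @Chat5 R) : FTlog x <->
  [/\ uu x.1.1.2 = uu x.1.1.1.2 - uu x.1.1.1.1,
      vv x.1.2 = vv x.1.1.2 - vv x.1.1.1.2,
      uu x.2 = vv x.1.1.1.1 - vv x.1.1.1.2,
      uu x.1.2 = vv x.1.1.1.1 - uu x.1.1.1.1 - vv x.1.1.1.2 + uu x.1.1.1.2 &
      vv x.2 = vv x.1.1.2 + uu x.1.1.1.1 - vv x.1.1.1.2].
  by case: x => [[[[a b] c] d] e].
move/FTlogE: hv => [h1 h2 h3 h4 h5]; apply/FTlogE; split.
- apply: (E (fun x => uu x.1.1.2) (fun x => uu x.1.1.1.2 - uu x.1.1.1.1)) => //.
  + exact: cu.
  + by move=> x; exact: (ccontB (cu _ pb x) (cu _ pa x)).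
  + by move=> x /hF[].
- apply: (E (fun x => vv x.1.2) (fun x => vv x.1.1.2 - vv x.1.1.1.2)) => //.
  + exact: cv.
  + by move=> x; exact: (ccontB (cv _ pc x) (cv _ pb x)).
  + by move=> x /hF[].
- apply: (E (fun x => uu x.2) (fun x => vv x.1.1.1.1 - vv x.1.1.1.2)) => //.
  + exact: cu.
  + by move=> x; exact: (ccontB (cv _ pa x) (cv _ pb x)).
  + by move=> x /hF[].
- apply: (E (fun x => uu x.1.2)
    (fun x => vv x.1.1.1.1 - uu x.1.1.1.1 - vv x.1.1.1.2 + uu x.1.1.1.2)) => //.
  + exact: cu.
  + move=> x.
    exact: (ccontD (ccontB (ccontB (cv _ pa x) (cu _ pa x)) (cv _ pb x)) (cu _ pb x)).
  + by move=> x /hF[].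
- apply: (E (fun x => vv x.2) (fun x => vv x.1.1.2 + uu x.1.1.1.1 - vv x.1.1.1.2)) => //.
  + exact: cv.
  + by move=> x; exact: (ccontB (ccontD (cv _ pc x) (cu _ pa x)) (cv _ pb x)).
  + by move=> x /hF[].
Qed.

(** [FThat] is a union over the lifts of FT^+, so a point is needed to know that it contains
    anything. The choice x = 1/2 + i, y = 1/2 + 2i puts all five entries in the upper half plane. *)
Lemma FTplus_lift_nonempty : exists v : @Chat5 R, FTplus_lift v.
Proof.
pose h : R := 1 / 2.
pose x : C := h +i* 1; pose y : C := h +i* 2.
have neq0 (a b : R) : b != 0 -> (a +i* b : C) != 0.
  by move=> b0; rewrite eq_complex /= (negbTE b0) andbF.
have [x0 y0] : x != 0 /\ y != 0 by split; rewrite neq0// ?oner_eq0 ?pnatr_eq0.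
have x1 : x - 1 != 0 by rewrite neq0// subr0 oner_eq0.
have y1 : y - 1 != 0 by rewrite neq0// subr0 pnatr_eq0.
have y1' : 1 - y != 0 by rewrite -oppr_eq0 opprB.
have ec : y / x = (9 / 5) +i* (2 / 5).
  by apply: (mulIf x0); rewrite divfK//; apply: complex_eq => /=; rewrite /h; field.
have ed : (1 - x^-1) / (1 - y^-1) = (77 / 85) +i* (36 / 85).
  have -> : (1 - x^-1) / (1 - y^-1) = ((x - 1) * y) / (x * (y - 1)) by field; rewrite x0 y0 y1.
  have xy0 : x * (y - 1) != 0 by rewrite mulf_neq0.
  by apply: (mulIf xy0); rewrite divfK//; apply: complex_eq => /=; rewrite /h; field.
have ee : (1 - x) / (1 - y) = (9 / 17) +i* (2 / 17).
  by apply: (mulIf y1'); rewrite divfK//; apply: complex_eq => /=; rewrite /h; field.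
pose mk (z : C) : @Chat R := mkChat z 0 0.
have mkE (a b : R) : 0 < b -> val (mk (a +i* b)) = (a +i* b, 0, 0).
  move=> b0; rewrite /mk /mkChat insubdK// unfold_in /= neq0 ?lt0r_neq0//=.
  by rewrite -subr_eq0 neq0// subr0 lt0r_neq0.
have [p1 p2 p3 p4 p5] : [/\ 0 < 1 :> R, 0 < 2 :> R, 0 < 2 / 5 :> R, 0 < 36 / 85 :> R & 0 < 2 / 17 :> R].
  by split; lra.
exists (mk x, mk y, mk ((9 / 5) +i* (2 / 5)), mk ((77 / 85) +i* (36 / 85)), mk ((9 / 17) +i* (2 / 17))).
split; last by rewrite !mkE.
rewrite /pihat5 /map5 /chz !mkE//; split.
  exists x, y; split.
  - rewrite -subr_eq0 -oppr_eq0 opprB.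
    have -> : y - x = 0 +i* 1 by apply: complex_eq; rewrite !(ReD, ImD, ReN, ImN) /=; lra.
    by rewrite neq0// oner_eq0.
  - by rewrite x0 -subr_eq0 x1.
  - by rewrite y0 -subr_eq0 y1.
  - by rewrite ec ed ee.
by rewrite /= -!complexIm -![0 < _%:C]/(0%:C < _) !ltcR.
Qed.

Lemma FThatP u : FThat u <-> FTlog u.
Proof.
split; first exact: FThat_FTlog.
move=> /FTlog_lift[hP ->]; have [v hv] := FTplus_lift_nonempty.
exists v => //; have [hQ ->] := FTlog_lift (FTplus_FTlog hv).
exact/linked_connected/linked_all.
Qed.

End FThatLog.

(** * Formal consequences of the lifted five-term relation *)

Section Periods.
Context {R : realType} {V : zmodType}.
Local Notation C := R[i].
Local Notation tau := (@tau R).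
Implicit Types a b u v s t z : C.

Variant five_term_map (f : C -> C -> V) : Prop := FiveTermMap of
  forall a0 b0 a1 b1 w, ftlog (a0, b0, a1, b1, w) ->
  f a0 b0 - f a1 b1 + f (a1 - a0) (w - a0) - f (b0 - a0 - b1 + a1) (w - a0 - b1)
  + f (b0 - b1) (w - b1) = 0.

Context {f : C -> C -> V} (five : five_term_map f).

Definition log1B a : C := Log (1 - cexp a).

Lemma cexp_log1B a : cexp a != 1 -> cexp a + cexp (log1B a) = 1.
Proof. by move=> h; rewrite cexp_Log ?subr_eq0 1?eq_sym// addrC subrK. Qed.

Lemma exists_log (bs : seq C) : exists s, cexp s \notin bs.
Proof.
have [m] := exists_other (0 :: bs); rewrite inE negb_or => /andP[m0 mbs].
by exists (Log m); rewrite cexp_Log.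
Qed.

Lemma cexp_add_neq1 a s : (cexp s != cexp (- a)) = (cexp (a + s) != 1).
Proof.
rewrite cexpD cexpN; apply/idP/idP; apply: contra_neq => h.
  by apply: (mulfI (cexp_neq0 a)); rewrite h mulfV// cexp_neq0.
by rewrite h mulfV// cexp_neq0.
Qed.

Definition dv a b : V := f a (b - tau) - f a b.
Definition du a b : V := f (a + tau) b - f a b.

Lemma five_sub (A B D E G A' B' D' E' G' : V) :
  A - B + D - E + G = 0 -> A' - B' + D' - E' + G' = 0 ->
  (A' - A) - (B' - B) + (D' - D) - (E' - E) + (G' - G) = 0.
Proof.
move=> h.
have e (x y : V) : y = x + (y - x) by rewrite addrC subrK.
rewrite {1}(e A A') {1}(e B B') {1}(e D D') {1}(e E E') {1}(e G G') !(opprD _ (_ - _)).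
by rewrite (addrACA A) (addrACA (A - B)) (addrACA (A - B + D)) (addrACA (A - B + D - E)) h add0r.
Qed.

(** Replacing w by w - tau changes only the v-coordinates of the last three entries. The relation is
    chosen so that these entries are (u, v), (u + u', v'') and (u', v'). *)
Lemma dv_add_gen u v u' v' v'' : cexp u + cexp v = 1 -> cexp u' + cexp v' = 1 ->
  cexp (u + u') + cexp v'' = 1 -> dv u v + dv u' v' = dv (u + u') v''.
Proof.
case: five => F h h' h''.
pose b1 := v - v''; pose a0 := v' - v''; pose a1 := u + a0; pose b0 := u' + b1; pose w := v + a0.
have e2 : a1 - a0 = u by rewrite addrK.
have e2' : w - a0 = v by rewrite addrK.
have e4 : b0 - b1 = u' by rewrite addrK.
have e3 : b0 - a0 - b1 + a1 = u + u' by rewrite /b0 /a1; ring.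
have e3' : v - b1 = v'' by rewrite /b1; ring.
have e4' : w - b1 = v' by rewrite /w /a0 /b1; ring.
have hP : ftlog (a0, b0, a1, b1, w).
  rewrite /= /a1 /b0 /w /a0 /b1 !(cexpD, cexpN).
  have -> : cexp v = 1 - cexp u by rewrite -h addrC addKr.
  have -> : cexp v' = 1 - cexp u' by rewrite -h' addrC addKr.
  have -> : cexp v'' = 1 - cexp u * cexp u' by rewrite -h'' cexpD addrC addKr.
  have : 1 - cexp u * cexp u' != 0.
    by rewrite -cexpD -h'' addrC addKr cexp_neq0.
  by move: (cexp u) (cexp u') => x y xy; split; field.
have hP' : ftlog (a0, b0, a1, b1, w - tau).
  by case: hP => ? ? hw; split=> //; rewrite cexpB cexp_tau divr1.
have sub (x : C) : w - tau - x = w - x - tau by rewrite addrAC.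
have := five_sub (F _ _ _ _ _ hP) (F _ _ _ _ _ hP').
rewrite !subrr !add0r !sub (addrAC _ (- tau) (- b1)) e2 e2' e3 e3' e4 e4' -/(dv u v) -/(dv (u + u') v'') -/(dv u' v').
by move=> e; apply/eqP; rewrite -subr_eq0 addrAC e.
Qed.

(** Adding the increment at a generic s turns both sides into the increment at u + s with the same
    second coordinate. *)
Lemma dv_indep u v v' : cexp u + cexp v = 1 -> cexp u + cexp v' = 1 -> dv u v = dv u v'.
Proof.
move=> h h'; have [s] := exists_log [:: 1; cexp (- u)].
rewrite !inE negb_or cexp_add_neq1 => /andP[s1 us1].
have hs := cexp_log1B s1; have hus := cexp_log1B us1.
apply: (addIr (dv s (log1B s))).
by rewrite (dv_add_gen h hs hus) (dv_add_gen h' hs hus).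
Qed.

Definition gen u : V := locked (dv u (log1B u)).

Lemma dvE u v : cexp u + cexp v = 1 -> dv u v = gen u.
Proof.
move=> h; rewrite /gen -lock; apply: dv_indep => //; apply: cexp_log1B.
by have /andP[] := cexp_sum_neq h.
Qed.

Lemma gen_add u u' : cexp u != 1 -> cexp u' != 1 -> cexp (u + u') != 1 ->
  gen (u + u') = gen u + gen u'.
Proof. by move=> h h' h''; rewrite /gen -!lock -(dv_add_gen (cexp_log1B h) (cexp_log1B h') (cexp_log1B h'')). Qed.

(** Raising a1 by tau affects the second, third and fourth entries, here (u, v), (u', v + v'') and
    (u'', v''), and raises only their u-coordinates. *)
Lemma du_add_gen u v u' u'' v'' : cexp u + cexp v = 1 -> cexp u' + cexp (v + v'') = 1 ->
  cexp u'' + cexp v'' = 1 -> du u' (v + v'') = du u v + du u'' v''.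
Proof.
case: five => F h h' h''.
pose a0 := u - u'; pose w := v + v'' + a0; pose b0 := u'' - u' + v.
have e2 : u - a0 = u' by rewrite /a0; ring.
have e2' : w - a0 = v + v'' by rewrite addrK.
have e3 : b0 - a0 - v + u = u'' by rewrite /b0 /a0; ring.
have e3' : v + v'' - v = v'' by rewrite addrC addKr.
have hP : ftlog (a0, b0, u, v, w).
  rewrite /= /w /b0 /a0 !(cexpD, cexpN).
  have -> : cexp u = 1 - cexp v by rewrite -h addrK.
  have -> : cexp u'' = 1 - cexp v'' by rewrite -h'' addrK.
  have -> : cexp u' = 1 - cexp v * cexp v'' by rewrite -h' cexpD addrK.
  have : 1 - cexp v * cexp v'' != 0.
    by rewrite -cexpD -h' addrK cexp_neq0.
  by move: (cexp v) (cexp v'') => x y xy; split; field.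
have hP' : ftlog (a0, b0, u + tau, v, w).
  by case: hP => ? ? hw; split=> //; rewrite [cexp (u + tau)]cexpD cexp_tau mulr1.
have := five_sub (F _ _ _ _ _ hP) (F _ _ _ _ _ hP').
rewrite !subrr addr0 sub0r [_ + (u + tau)]addrA [u + tau - a0]addrAC e2 e2' e3 e3'.
rewrite -/(du u v) -/(du u' (v + v'')) -/(du u'' v'').
by move=> /eqP; rewrite subr_eq0 => /eqP <-; rewrite addrA subrr add0r.
Qed.

(** Raising b0 by tau raises the v-coordinate of the first entry (a, b) and the u-coordinates of the
    last two, here (u, v) and (u', v + a). This mixed relation is the link between [du] and
    [gen]. *)
Lemma du_shift u v u' a b : cexp u + cexp v = 1 -> cexp u' + cexp (v + a) = 1 ->
  cexp a + cexp b = 1 -> du u' (v + a) = du u v + gen a.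
Proof.
case: five => F h h' hab.
pose b1 := b - u'; pose a1 := u - u' + a; pose w := v + a + b1.
have e3 : b - a - b1 + a1 = u by rewrite /b1 /a1; ring.
have e3' : w - a - b1 = v by rewrite /w; ring.
have e4 : b - b1 = u' by rewrite /b1; ring.
have e4' : w - b1 = v + a by rewrite addrK.
have hP : ftlog (a, b, a1, b1, w).
  rewrite /= /w /a1 /b1 !(cexpD, cexpN).
  have -> : cexp u = 1 - cexp v by rewrite -h addrK.
  have -> : cexp b = 1 - cexp a by rewrite -hab addrC addKr.
  have -> : cexp u' = 1 - cexp v * cexp a by rewrite -h' cexpD addrK.
  have : 1 - cexp v * cexp a != 0 by rewrite -cexpD -h' addrK cexp_neq0.
  by move: (cexp v) (cexp a) => x y xy; split; [ring|field|field].
have hP' : ftlog (a, b + tau, a1, b1, w).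
  by case: hP => ? ? hw; split=> //; rewrite [cexp (b + tau)]cexpD cexp_tau mulr1.
have := five_sub (F _ _ _ _ _ hP) (F _ _ _ _ _ hP').
have add (x : C) : b + tau - x = b - x + tau by rewrite addrAC.
rewrite !subrr subr0 addr0 !add (addrAC _ tau) (addrAC _ tau) e3 e3' e4 e4'.
rewrite -/(du u v) -/(du u' (v + a)).
have -> : f a (b + tau) - f a b = - gen a.
  rewrite -(@dvE a (b + tau)); last by rewrite cexpD cexp_tau mulr1.
  by rewrite /dv addrK opprB.
by move=> /eqP; rewrite -opprD addrC subr_eq0 => /eqP ->; rewrite addrC.
Qed.

(** The increment at s + v, for generic s, is expanded by [du_add_gen] and by [du_shift]; the common
    term at s cancels. *)
Lemma duE u v : cexp u + cexp v = 1 -> du u v = gen v.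
Proof.
move=> h; have v1 : cexp v != 1 by rewrite addrC in h; have /andP[] := cexp_sum_neq h.
have [s] := exists_log [:: 1; cexp (- v)].
rewrite !inE negb_or cexp_add_neq1 => /andP[s1]; rewrite addrC => sv1.
have hs : cexp (log1B s) + cexp s = 1 by rewrite addrC cexp_log1B.
have hsv : cexp (log1B (s + v)) + cexp (s + v) = 1 by rewrite addrC cexp_log1B.
apply: (addrI (du (log1B s) s)).
by rewrite -(du_add_gen hs hsv h) (du_shift hs hsv (cexp_log1B v1)).
Qed.

Lemma shift_u u v : cexp u + cexp v = 1 -> f (u + tau) v = f u v + gen v.
Proof. by move=> /duE <-; rewrite /du [RHS]addrC subrK. Qed.

Lemma shift_v u v : cexp u + cexp v = 1 -> f u (v - tau) = f u v + gen u.
Proof. by move=> /dvE <-; rewrite /dv [RHS]addrC subrK. Qed.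

Lemma cexpDtau a : cexp (a + tau) = cexp a. Proof. by rewrite cexpD cexp_tau mulr1. Qed.
Lemma cexpBtau a : cexp (a - tau) = cexp a. Proof. by rewrite cexpB cexp_tau divr1. Qed.

Definition period a := gen (a + tau) - gen a.

Lemma period_sym u v : cexp u + cexp v = 1 -> period (v - tau) = - period u.
Proof.
move=> h; have h1 : cexp u + cexp (v - tau) = 1 by rewrite cexpBtau.
have h2 : cexp (u + tau) + cexp v = 1 by rewrite cexpDtau.
have := shift_u h1; rewrite (shift_v h2) (shift_u h) (shift_v h) -!addrA => /addrI.
move=> e; rewrite /period subrK opprB.
have -> : gen v = gen u + gen (v - tau) - gen (u + tau) by rewrite -e addrK.
by rewrite addrAC addrK.
Qed.

Lemma period_const a b : cexp a != 1 -> cexp b != 1 -> period a = period b.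
Proof.
have key x y : cexp x != 1 -> cexp y != 1 -> cexp (x + y) != 1 -> period x = period y.
  move=> x1 y1 xy1.
  have e1 : gen (x + y + tau) = gen (x + tau) + gen y.
    have c : cexp (x + tau + y) != 1 by rewrite addrAC cexpDtau.
    by rewrite addrAC (@gen_add (x + tau) y) ?cexpDtau.
  have e2 : gen (x + y + tau) = gen x + gen (y + tau).
    by rewrite -[x + y + tau]addrA (@gen_add x (y + tau)) ?cexpDtau// addrA cexpDtau.
  have e : gen (x + tau) = gen x + gen (y + tau) - gen y by rewrite -e2 e1 addrK.
  by rewrite /period e addrAC [gen x + _]addrC addrK.
move=> a1 b1; have [s] := exists_log [:: 1; cexp (- a); cexp (- b)].
rewrite !inE !negb_or !cexp_add_neq1 => /and3P[s1 as1 bs1].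
by rewrite (key a s)// (key b s).
Qed.

(** The period is constant by additivity and changes sign by [period_sym]. It need not vanish: for
    the universal f it is the class of \hat kappa = \hat chi(-1). *)
Lemma period2 a : cexp a != 1 -> period a + period a = 0.
Proof.
move=> a1; have h := cexp_log1B a1.
have h1 : cexp (log1B a - tau) != 1.
  by rewrite cexpBtau; rewrite addrC in h; have /andP[] := cexp_sum_neq h.
by rewrite {1}(period_const a1 h1) (period_sym h) addNr.
Qed.

(** [gen] is controlled only where cexp u != 1, since 1 is not a value of z. Additivity extends it
    to all of C as a difference gen (u + s) - gen s with s generic, and [genlog] picks such an s. *)
Definition genlog u : C := xget 0 [set s | (cexp s != 1) && (cexp (u + s) != 1)].

Definition Gen u : V := gen (u + genlog u) - gen (genlog u).

Lemma GenE u s : cexp s != 1 -> cexp (u + s) != 1 -> Gen u = gen (u + s) - gen s.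
Proof.
have key s' : cexp s' != 1 -> cexp (u + s') != 1 -> forall r, cexp r != 1 -> cexp (u + r) != 1 ->
    cexp (u + s' + r) != 1 -> gen (u + s') - gen s' = gen (u + r) - gen r.
  move=> h1 h2 r r1 ur1 usr1; apply/eqP; rewrite subr_eq addrAC eq_sym subr_eq eq_sym.
  by rewrite -!gen_add// addrAC// [u + r + s']addrAC.
move=> s1 us1; have [t1 ut1] : cexp (genlog u) != 1 /\ cexp (u + genlog u) != 1.
  by rewrite /genlog; case: xgetP => [t _ /andP[]//|/(_ s)]; rewrite /= s1 us1.
have [r] := exists_log [:: 1; cexp (- u); cexp (- (u + s)); cexp (- (u + genlog u))].
rewrite !inE !negb_or !cexp_add_neq1 => /and4P[r1 ur usr utr].
by rewrite /Gen (key _ t1 ut1 r)// (key _ s1 us1 r).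
Qed.

Lemma Gen_gen u : cexp u != 1 -> Gen u = gen u.
Proof.
move=> u1; have [s] := exists_log [:: 1; cexp (- u)].
rewrite !inE !negb_or !cexp_add_neq1 => /andP[s1 us1].
by rewrite (GenE s1 us1) gen_add// addrK.
Qed.

Lemma GenD u u' : Gen (u + u') = Gen u + Gen u'.
Proof.
have [s] := exists_log [:: 1; cexp (- u'); cexp (- (u + u'))].
rewrite !inE !negb_or !cexp_add_neq1 => /and3P[s1 us1 uus1].
rewrite (GenE s1 uus1) (GenE s1 us1) (@GenE u (u' + s))// ?addrA//.
by rewrite subrK.
Qed.

Lemma Gen_tau a : cexp a != 1 -> Gen tau = period a.
Proof.
move=> a1; rewrite /period [a + tau]addrC; apply: GenE => //.
by rewrite addrC cexpDtau.
Qed.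

Lemma Gen0 : Gen 0 = 0.
Proof. by apply: (addrI (Gen 0)); rewrite -GenD !addr0. Qed.

Lemma GenN u : Gen (- u) = - Gen u.
Proof. by apply: (addrI (Gen u)); rewrite -GenD !subrr Gen0. Qed.

Lemma Gen_2tau (n : int) : Gen (2 * (tau *~ n)) = 0.
Proof.
have h2 : (cexp (Log 2) : C) != 1 by rewrite cexp_Log ?pnatr_eq0// (neqC_nat 2 1).
have e : Gen (2 * tau) = 0 by rewrite mulr_natl mulr2n GenD (Gen_tau h2) period2.
have hn (m : nat) : Gen (2 * (tau *~ m)) = 0.
  by elim: m => [|m ih]; rewrite ?mulr0z ?mulr0 ?Gen0// intS mulrzDr mulr1z mulrDr GenD e ih addr0.
by case: n => m; rewrite ?NegzE ?mulrNz ?mulrN ?GenN hn ?oppr0.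
Qed.

Lemma Gen_double a b : cexp a = cexp b -> Gen (2 * a) = Gen (2 * b).
Proof. by move=> /cexp_eq[n ->]; rewrite mulrDr GenD Gen_2tau addr0. Qed.

Lemma GenMz u (n : int) : Gen (u *~ n) = Gen u *~ n.
Proof.
have hn (m : nat) : Gen (u *+ m) = Gen u *+ m.
  by elim: m => [|m ih]; rewrite ?mulr0n ?Gen0// !mulrS GenD ih.
by case: n => m; rewrite ?NegzE -?mulNrz ?mulrNz ?GenN -!pmulrn hn.
Qed.

Lemma shift_uz u v (n : int) : cexp u + cexp v = 1 -> f (u + tau *~ n) v = f u v + Gen v *~ n.
Proof.
move=> h; have v1 : cexp v != 1 by rewrite addrC in h; have /andP[] := cexp_sum_neq h.
have hm (m : nat) w : cexp w = cexp u -> f (w + tau *~ m) v = f w v + Gen v *~ m.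
  move=> wu; elim: m => [|m ih]; first by rewrite !mulr0z !addr0.
  rewrite -addn1 PoszD !mulrzDr !mulr1z addrA shift_u; first by rewrite ih Gen_gen ?addrA.
  by rewrite cexpD cexp_tauz mulr1 wu.
case: n => m; first exact: hm.
rewrite NegzE !mulrNz -[in RHS](subrK (tau *~ m.+1) u) hm ?addrK//.
by rewrite cexpB cexp_tauz divr1.
Qed.

Lemma shift_vz u v (n : int) : cexp u + cexp v = 1 -> f u (v - tau *~ n) = f u v + Gen u *~ n.
Proof.
move=> h; have u1 : cexp u != 1 by have /andP[] := cexp_sum_neq h.
have hm (m : nat) w : cexp w = cexp v -> f u (w - tau *~ m) = f u w + Gen u *~ m.
  move=> wv; elim: m => [|m ih]; first by rewrite !mulr0z subr0 addr0.
  rewrite -addn1 PoszD !mulrzDr !mulr1z opprD addrA shift_v; first by rewrite ih Gen_gen ?addrA.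
  by rewrite cexpB cexp_tauz divr1 wv.
case: n => m; first exact: hm.
rewrite NegzE !mulrNz opprK -[in RHS](addrK (tau *~ m.+1) v) hm ?addrK//.
by rewrite cexpD cexp_tauz mulr1.
Qed.

End Periods.

(** * Quotients and free abelian groups *)

(** Applied to [Rhat], this turns congruences into identities in an abelian group V, the universal
    target for a [five_term_map]. *)
Lemma zmod_quotient (M : zmodType) (S : set M) : S 0 -> (forall x y, S x -> S y -> S (x - y)) ->
  exists (V : zmodType) (p : {additive M -> V}), forall x, p x = 0 <-> S x.
Proof.
move=> S0 SB; pose P : {pred M} := fun x => `[< S x >].
have cP : GRing.zmod_closed P.
  by split; [exact/asboolP | move=> x y /asboolP Sx /asboolP Sy; exact/asboolP/SB].
pose cl := GRing.isZmodClosed.Build M P cP.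
pose I : zmodClosed M := HB.pack P cl.
exists (Quotient.quot I), (\pi_(Quotient.quot I))%qT => x.
split=> [e|Sx].
  have : x - 0 \in I.
    by rewrite Quotient.idealrBE; apply/eqP; rewrite e raddf0.
  by rewrite subr0 => /asboolP.
rewrite -(raddf0 (\pi_(Quotient.quot I))%qT); apply/eqP; rewrite -Quotient.idealrBE subr0; exact/asboolP.
Qed.

Section Subgroup.
Context {M : zmodType} {S : set M}.
Hypotheses (S0 : S 0) (SB : forall x y, S x -> S y -> S (x - y)).

Lemma subgroupN x : S x -> S (- x).
Proof. by move=> Sx; rewrite -sub0r; exact: SB. Qed.

Lemma subgroupD x y : S x -> S y -> S (x + y).
Proof. by move=> Sx /subgroupN Sy; rewrite -[y]opprK; exact: SB. Qed.

Lemma subgroupMz x (n : int) : S x -> S (x *~ n).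
Proof.
move=> Sx; have Sn (m : nat) : S (x *~ m).
  by elim: m => [|m ih]; rewrite ?mulr0z// intS mulrzDr mulr1z; exact: subgroupD.
by case: n => m; rewrite ?NegzE ?mulrNz//; exact: subgroupN.
Qed.

End Subgroup.

Section FreeGroup.
Context {K : choiceType}.

Lemma int_scale (M : lmodType int) (n : int) (x : M) : n *: x = x *~ n.
Proof. by rewrite -scaler_int intz. Qed.

Lemma freeg_generated (S : set {freeg K / int}) : S 0 -> (forall x y, S x -> S y -> S (x - y)) ->
  (forall k, S << k >>) -> forall x, S x.
Proof.
move=> S0 SB SU; elim/freeg_ind_dom0 => // n k x _ _ Sx.
apply: subgroupD => //; have -> : << n *g k >> = << k >> *~ n :> {freeg K / int}.
  by rewrite freegU_mulz intz.
exact: subgroupMz.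
Qed.

Lemma freeg_extend (M : zmodType) (f : K -> M) :
  exists g : {additive {freeg K / int} -> M}, forall k, g << k >> = f k.
Proof.
pose g : {freeg K / int} -> M := fglift (f : K -> zmodule M).
have ga : additive g by exact: (@lift_is_additive _ _ (zmodule M)).
pose m := GRing.isAdditive.Build _ _ g ga.
exists (HB.pack g m : {additive _ -> _}) => k /=.
by rewrite /g liftU scale1r.
Qed.

(* [Rhat] and [Rpre] are both of this form. *)
Definition relations (P : set (tuple5 K)) : set {freeg K / int} :=
  [set x | exists s : seq (int * tuple5 K),
     all (fun a => `[< P a.2 >]) s /\ x = \sum_(a <- s) a.1 *: five_term a.2].

Variable P : set (tuple5 K).

Lemma relations0 : relations P 0.
Proof. by exists [::]; rewrite big_nil. Qed.

Lemma relationsB x y : relations P x -> relations P y -> relations P (x - y).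
Proof.
move=> [s [Ps ->]] [t [Pt ->]]; exists (s ++ [seq (- a.1, a.2) | a <- t]); split.
  by rewrite all_cat Ps all_map; apply: sub_all Pt.
rewrite big_cat big_map -sumrN; congr (_ + _).
by apply: eq_bigr => a _; rewrite scaleNr.
Qed.

Lemma relations_five_term u : P u -> relations P (five_term u).
Proof.
by move=> Pu; exists [:: (1, u)]; rewrite /= big_seq1 scale1r andbT; split=> //; exact/asboolP.
Qed.

Lemma relations_min (S : set {freeg K / int}) : S 0 -> (forall x y, S x -> S y -> S (x - y)) ->
  (forall u, P u -> S (five_term u)) -> relations P `<=` S.
Proof.
move=> S0 SB SP _ [s [Ps ->]]; elim: s Ps => [|a s ih /= /andP[/asboolP Pa /ih Ss]].
  by rewrite big_nil.
rewrite big_cons int_scale; apply: subgroupD => //; apply: subgroupMz => //; exact: SP.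
Qed.

End FreeGroup.

(** * The extended pre-Bloch group, the regulator and the exact sequence *)

Section ExtendedPreBlochGroup.
Context {R : realType}.
Local Notation C := R[i].
Local Notation tau := (@tau R).
Local Notation ZC := {freeg (@Chat R) / int}.
Local Notation ZC01 := {freeg (@Cx01 R) / int}.

Lemma Rhat0 : Rhat (0 : ZC). Proof. exact: relations0. Qed.

Lemma RhatB (x y : ZC) : Rhat x -> Rhat y -> Rhat (x - y). Proof. exact: relationsB. Qed.

Lemma Rpre0 : Rpre (0 : ZC01).
Proof. exact: (relations0 (fun t : tuple5 Cx01 => FT (map5 val t))). Qed.

Lemma RpreB (x y : ZC01) : Rpre x -> Rpre y -> Rpre (x - y).
Proof. exact: (@relationsB _ (fun t : tuple5 Cx01 => FT (map5 val t))). Qed.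

Lemma Rhat_five_term (u : Chat5) : FThat u -> Rhat (five_term u : ZC).
Proof. exact: relations_five_term. Qed.

Lemma Rpre_five_term (t : tuple5 Cx01) : FT (map5 val t) -> Rpre (five_term t : ZC01).
Proof. exact: (@relations_five_term _ (fun t : tuple5 Cx01 => FT (map5 val t))). Qed.

Lemma Rhat_min (S : set ZC) : S 0 -> (forall x y, S x -> S y -> S (x - y)) ->
  (forall u, FThat u -> S (five_term u)) -> forall x, Rhat x -> S x.
Proof. by move=> S0 SB SF x; exact: relations_min. Qed.

Lemma Rpre_min (S : set ZC01) : S 0 -> (forall x y, S x -> S y -> S (x - y)) ->
  (forall t, FT (map5 val t) -> S (five_term t)) -> forall y, Rpre y -> S y.
Proof.
move=> S0 SB SF y.
exact: (@relations_min _ (fun t : tuple5 Cx01 => FT (map5 val t))).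
Qed.

Lemma pistar_additive : additive (@pistar R).
Proof. exact: lift_is_additive. Qed.

HB.instance Definition _ :=
  GRing.isAdditive.Build ZC ZC01 (@pistar R) pistar_additive.

Lemma pistarU (k : @Chat R) : pistar << k >> = << pihat k >>.
Proof. by rewrite /pistar liftU scale1r. Qed.

Lemma five_term_additive (K : choiceType) (M : zmodType) (h : {additive {freeg K / int} -> M}) a b c d e :
  h (five_term (a, b, c, d, e)) = h << a >> - h << b >> + h << c >> - h << d >> + h << e >>.
Proof. by rewrite /five_term raddfD raddfB raddfD raddfB. Qed.

Lemma pistar_five_term (u : @Chat5 R) : pistar (five_term u) = five_term (map5 pihat u).
Proof. by case: u => [[[[a b] c] d] e]; rewrite five_term_additive /= !pistarU. Qed.

Lemma FThat_FT (u : @Chat5 R) : FThat u -> FT (map5 val (map5 pihat u)).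
Proof.
move=> /FThatP/FTlog_lift[/ftlift_FT] + -> => //; by case: (ftlift _) => [[[[a b] c] d] e].
Qed.

Lemma Rhat_Rpre (x : ZC) : Rhat x -> Rpre (pistar x).
Proof.
move: x; apply: (@Rhat_min (fun x => Rpre (pistar x))) => [|x y hx hy|u /FThat_FT].
- by rewrite raddf0; exact: Rpre0.
- by rewrite raddfB; exact: RpreB.
- by rewrite pistar_five_term; exact: Rpre_five_term.
Qed.

Definition basepoint (z : @Cx01 R) : @Chat R := mkChat (val z) 0 0.

Lemma val_mkChat (w : C) p q : w != 0 -> w != 1 -> val (mkChat w p q) = (w, p, q).
Proof. by move=> w0 w1; rewrite /mkChat insubdK// unfold_in /= w0. Qed.

Lemma pihat_mkChat (z : @Cx01 R) p q : pihat (mkChat (val z) p q) = z.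
Proof. by have /andP[z0 z1] := valP z; apply: val_inj; rewrite /= val_mkChat. Qed.

Lemma uu_mkChat (w : C) p q : w != 0 -> w != 1 -> uu (mkChat w p q) = Log w + tau *~ p.
Proof. by move=> w0 w1; rewrite /uu val_mkChat. Qed.

Lemma vv_mkChat (w : C) p q : w != 0 -> w != 1 ->
  vv (mkChat w p q) = - Log (1 - w)^-1 - tau *~ q.
Proof. by move=> w0 w1; rewrite /vv val_mkChat. Qed.

Lemma FT_ftlift (t : tuple5 (@Cx01 R)) : FT (map5 val t) ->
  exists2 P, ftlog P & map5 pihat (ftlift P) = t.
Proof.
case: t => [[[[a b] c] d] e] [x [y [xy /andP[x0 x1] /andP[y0 y1] et]]].
have x1' : 1 - x != 0 by rewrite subr_eq0 eq_sym.
have y1' : 1 - y != 0 by rewrite subr_eq0 eq_sym.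
have xy' : x - y != 0 by rewrite subr_eq0.
have hP : ftlog (Log x, Log (1 - x), Log y, Log (1 - y), Log (x - y)).
  by rewrite /= !cexp_Log//; split=> //; rewrite addrC subrK.
exists (Log x, Log (1 - x), Log y, Log (1 - y), Log (x - y)) => //.
have [h2 h3 h4] := ftlog_cexp hP; have [h0 h1 _] := hP.
have chE (k : @Chat R) (w : @Cx01 R) : cexp (uu k) = sval w -> pihat k = w.
  by rewrite cexp_uu => e'; exact/val_inj.
case: et => ea eb ec ed ee; rewrite /map5 /ftlift.
congr (_, _, _, _, _); apply: chE; rewrite uu_Chat_of//.
- by rewrite ea cexp_Log.
- by rewrite eb cexp_Log.
- by rewrite ec !(cexpB, cexpD) !cexp_Log.
- rewrite ed !(cexpB, cexpD) !cexp_Log//; field.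
  by rewrite x0 y0 y1' -oppr_eq0 opprB y1'.
- by rewrite ee !(cexpB, cexpD) !cexp_Log.
Qed.

Lemma FThat_ftlift P : ftlog P -> FThat (@ftlift R P).
Proof. by move=> /ftlift_FTlog/FThatP. Qed.

(** The cases in [chi_hat] choose m so that Log(z^2) + 2 pi i m equals 2 Log z modulo 4 pi i, the
    period of [Gen]. The correction n is 1 exactly when Arg z <= - pi / 2. *)
Lemma chi_hat_brace (z : C) : z != 0 -> z != 1 -> z != -1 ->
  exists m n : int, chi_hat z = brace (z ^+ 2) m /\ Log (z ^+ 2) + tau *~ m = 2 * (Log z + tau *~ n).
Proof.
move=> z0 z1 zN1; rewrite /chi_hat (negbTE z1) (negbTE zN1).
have e2 : cexp (2 * Log z) = z ^+ 2 by rewrite mulr_natl mulr2n cexpD cexp_Log.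
have Im2 : Im (2 * Log z) = Arg z + Arg z by rewrite mulr_natl mulr2n ImD Im_Log.
have Imtau : Im tau = pi + pi by [].
have /andP[A1 A2] := Arg_bound z; have p0 := @pi_gt0 R.
case: ifP => [/andP[h1 h2]|/negbT].
  exists 0, 0; split=> //; rewrite !mulr0z !addr0; apply: Log_unique => //.
  by rewrite Im2; apply/andP; split; lra.
rewrite negb_and -leNgt -ltNge => /orP[h|h].
  exists 1, 1; split=> //; rewrite !mulr1z mulrDr.
  rewrite (@Log_unique _ (2 * Log z + tau)).
  - by rewrite -addrA [2 * tau]mulr_natl mulr2n.
  - by rewrite cexpDtau.
  - by rewrite (ImD (2 * Log z)) Im2 Imtau; apply/andP; split; lra.
exists 1, 0; split=> //; rewrite !mulr1z mulr0z addr0.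
rewrite (@Log_unique _ (2 * Log z - tau)).
- by rewrite subrK.
- by rewrite cexpBtau.
- by rewrite (ImD (2 * Log z)) (ImN tau) Im2 Imtau; apply/andP; split; lra.
Qed.

Lemma sqr_neq01 (z : C) : z != 0 -> z != 1 -> z != -1 -> (z ^+ 2 != 0) && (z ^+ 2 != 1).
Proof. by move=> z0 z1 zN1; rewrite expf_neq0//= sqrf_eq1 negb_or z1. Qed.

Lemma half_neq01 : (2^-1 != 0 :> C) /\ (2^-1 != 1 :> C).
Proof. by case/andP: (@half_valid R). Qed.

Lemma pistar_brace (w : C) n : w != 0 -> w != 1 -> pistar (brace w n) = 0.
Proof.
move=> w0 w1; have h : (w != 0) && (w != 1) by rewrite w0.
rewrite /brace raddfB /= !pistarU.
by rewrite !(@pihat_mkChat (exist (fun z : C => (z != 0) && (z != 1)) w h)) subrr.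
Qed.

Lemma pistar_chi_hat (z : C) : z != 0 -> pistar (chi_hat z) = 0.
Proof.
move=> z0; have [->|z1] := eqVneq z 1; first by rewrite /chi_hat eqxx raddf0.
have [->|zN1] := eqVneq z (-1).
  have [h0 h1] := half_neq01.
  rewrite /chi_hat eqxx; case: ifP => _; rewrite ?raddf0// /kappa_hat raddfB /=.
  by rewrite !pistar_brace// subrr.
have [m [n [-> _]]] := chi_hat_brace z0 z1 zN1.
by have /andP[] := sqr_neq01 z0 z1 zN1; exact: pistar_brace.
Qed.

Lemma N1_neq1 : (-1 : C) != 1.
Proof. by rewrite eq_sym -subr_eq0 opprK -mulr2n pnatr_eq0. Qed.

Lemma chi_hatN1 : chi_hat (-1 : C) = kappa_hat.
Proof. by rewrite /chi_hat (negbTE N1_neq1) eqxx. Qed.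

Section Regulator.
Context {L : {additive ZC -> C}} (c0 : C).
Hypothesis LE : forall k, L << k >> = ell (uu k) (vv k) - c0.

Lemma cexp_L_brace w n : w != 0 -> w != 1 -> cexp (L (brace w n)) = cexp ((Log w + tau *~ n) / 2).
Proof.
move=> w0 w1; rewrite /brace raddfB !LE /= opprB addrA subrK.
rewrite !uu_mkChat// !vv_mkChat// mulr1z mulr0z subr0 cexpB cexp_ell_shift.
  by rewrite mulrAC mulfV ?cexp_neq0// mul1r.
rewrite cexpD cexp_tauz mulr1 cexp_Log// cexpN cexp_Log ?invr_eq0 ?subr_eq0 1?eq_sym//.
by rewrite invrK addrC subrK.
Qed.

Lemma cexp_L_chi_hat z : z != 0 -> cexp (L (chi_hat z)) = z.
Proof.
move=> z0; have [->|z1] := eqVneq z 1; first by rewrite /chi_hat eqxx raddf0 cexp0.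
have [->|zN1] := eqVneq z (-1).
  have [h0 h1] := half_neq01.
  rewrite chi_hatN1 /kappa_hat raddfB cexpB !cexp_L_brace// -cexpB mulr0z addr0.
  by rewrite mulrN1z -mulrBl opprB addrC subrK cexp_tau2.
have [m [n [-> e]]] := chi_hat_brace z0 z1 zN1.
have /andP[h0 h1] := sqr_neq01 z0 z1 zN1; rewrite cexp_L_brace// e mulrC mulKf ?pnatr_eq0//.
by rewrite cexpD cexp_tauz mulr1 cexp_Log.
Qed.

Hypothesis c0E : forall P, ftlog P -> cexp (ftell P) = cexp c0.

(** The five-term sum of [ell] is the constant c0 modulo [tau]. Its signs add up to 1, so
    subtracting c0 from every value of [ell] removes c0 from the sum exactly once. *)
Lemma cexp_L_Rhat x : Rhat x -> cexp (L x) = 1.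
Proof.
move: x; apply: (@Rhat_min (fun x => cexp (L x) = 1)) => [|x y hx hy|u].
- by rewrite raddf0 cexp0.
- by rewrite raddfB cexpB hx hy divr1.
move=> /FThatP /FTlog_lift[hP ->]; have := c0E hP; move: hP.
case: (logs_of u) => [[[[a0 b0] a1] b1] w] hP; have [h2 h3 h4] := ftlog_cexp hP.
have [h0 h1 _] := hP; rewrite five_term_additive !LE !uu_Chat_of// !vv_Chat_of// /ftell.
move: (ell _ _) (ell _ _) (ell _ _) (ell _ _) (ell _ _) => e4 e3 e2 e1 e0 hc.
have -> : e0 - c0 - (e1 - c0) + (e2 - c0) - (e3 - c0) + (e4 - c0) = e0 - e1 + e2 - e3 + e4 - c0.
  by ring.
by rewrite cexpB hc mulfV ?cexp_neq0.
Qed.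

End Regulator.

Lemma regulator : exists L : {additive ZC -> C},
  (forall x, Rhat x -> cexp (L x) = 1) /\ forall z, z != 0 -> cexp (L (chi_hat z)) = z.
Proof.
have [v /FTplus_FTlog /FTlog_lift[hP _]] := @FTplus_lift_nonempty R.
have [L LE] := freeg_extend (fun k : @Chat R => ell (uu k) (vv k) - ftell (logs_of v)).
exists L; split; last exact: cexp_L_chi_hat LE.
by apply: (cexp_L_Rhat LE) => Q hQ; exact: ftell_const.
Qed.

(** * Kernel, image and splitting in the quotient group *)

Section Quotient.
Context {V : zmodType} {p : {additive ZC -> V}}.
Hypothesis pP : forall x, p x = 0 <-> Rhat x.

Definition quotient_map (a b : C) : V := p << Chat_of a b >>.
Local Notation Gen := (@Gen R V quotient_map).

Lemma quotient_map_five : five_term_map quotient_map.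
Proof.
split=> a0 b0 a1 b1 w hP; rewrite /quotient_map -five_term_additive.
by apply/pP/Rhat_five_term; exact: FThat_ftlift hP.
Qed.

Let five := quotient_map_five.

Lemma quotient_mapE k : p << k >> = quotient_map (uu k) (vv k).
Proof. by rewrite /quotient_map Chat_of_uuvv. Qed.

Lemma p_brace w n : w != 0 -> w != 1 -> p (brace w n) = Gen (Log w + tau *~ n).
Proof.
move=> w0 w1; have h : cexp (Log w + tau *~ n) + cexp (- Log (1 - w)^-1) = 1.
  rewrite cexpD cexp_tauz mulr1 cexp_Log// cexpN cexp_Log ?invr_eq0 ?subr_eq0 1?eq_sym//.
  by rewrite invrK addrC subrK.
rewrite /brace raddfB /= !quotient_mapE !uu_mkChat// !vv_mkChat// mulr1z mulr0z subr0.
rewrite (shift_v five h) addrC addKr -(Gen_gen five)//.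
by have /andP[] := cexp_sum_neq h.
Qed.

Lemma Gen_half c z : cexp z = cexp (c / 2) -> Gen (2 * z) = Gen c.
Proof. by move=> /(Gen_double five) ->; congr Gen; rewrite mulrC divfK ?pnatr_eq0. Qed.

Lemma p_chi_hat z : z != 0 -> p (chi_hat z) = Gen (2 * Log z).
Proof.
move=> z0; have [->|z1] := eqVneq z 1.
  by rewrite /chi_hat eqxx raddf0 Log1 mulr0 (Gen0 five).
have [->|zN1] := eqVneq z (-1).
  have [h0 h1] := half_neq01.
  rewrite chi_hatN1 /kappa_hat raddfB /= !p_brace// mulr0z addr0 mulrN1z.
  rewrite (GenD five (Log 2^-1)) opprD addrA subrr add0r -(GenN five) opprK.
  by apply/esym/Gen_half; rewrite cexp_tau2 cexp_Log// oppr_eq0 oner_eq0.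
have [m [n [-> e]]] := chi_hat_brace z0 z1 zN1.
have /andP[h0 h1] := sqr_neq01 z0 z1 zN1; rewrite p_brace// e.
by apply: Gen_double five _ _ _; rewrite cexpD cexp_tauz mulr1.
Qed.

Lemma chi_hat_morph (z w : C) : z != 0 -> w != 0 -> Rhat (chi_hat (z * w) - chi_hat z - chi_hat w).
Proof.
move=> z0 w0; apply/pP; rewrite !raddfB /= !p_chi_hat ?mulf_neq0//.
rewrite (@Gen_double _ _ _ five (Log (z * w)) (Log z + Log w)).
  by rewrite mulrDr (GenD five) addrAC addrK subrr.
by rewrite cexpD !cexp_Log// mulf_neq0.
Qed.

(** The image of \hat chi, parametrised by Gen c = \hat chi(exp(c / 2)), so that the subgroup laws
    follow from additivity of [Gen]. *)
Definition chi_image : set V := [set x | exists c, x = Gen c].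

Lemma chi_image0 : chi_image 0.
Proof. by exists 0; rewrite (Gen0 five). Qed.

Lemma chi_imageB x y : chi_image x -> chi_image y -> chi_image (x - y).
Proof. by move=> [a ->] [b ->]; exists (a - b); rewrite (GenD five) (GenN five). Qed.

Lemma p_chi_hat_half c : p (chi_hat (cexp (c / 2))) = Gen c.
Proof.
by rewrite p_chi_hat ?cexp_neq0//; apply: Gen_half; rewrite cexp_Log ?cexp_neq0.
Qed.

Lemma chi_imageP x : chi_image (p x) <-> exists2 z, z != 0 & Rhat (x - chi_hat z).
Proof.
split=> [[c e]|[z z0 /pP]].
  exists (cexp (c / 2)); first exact: cexp_neq0.
  by apply/pP; rewrite raddfB /= p_chi_hat_half e subrr.
by rewrite raddfB /= => /eqP; rewrite subr_eq0 => /eqP ->; exists (2 * Log z); exact: p_chi_hat.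
Qed.

Context {S : {additive ZC01 -> ZC}}.
Hypothesis SE : forall z, S << z >> = << basepoint z >>.

(** Moving a generator to the sheet p = q = 0 over the same z changes its class only by values of
    [Gen], by [shift_uz] and [shift_vz]. *)
Lemma p_section x : chi_image (p (x - S (pistar x))).
Proof.
move: x; apply: freeg_generated => [|x y hx hy|k].
- by rewrite (raddf0 (@pistar R)) (raddf0 S) subr0 raddf0; exact: chi_image0.
- have -> : x - y - S (pistar (x - y)) = (x - S (pistar x)) - (y - S (pistar y)).
    by rewrite (raddfB (@pistar R)) (raddfB S) /= !opprD addrACA.
  by rewrite raddfB; exact: chi_imageB.
rewrite pistarU SE raddfB /= !quotient_mapE /basepoint.
have /andP[z0 z1] := valP (pihat k); rewrite uu_mkChat// vv_mkChat// mulr0z subr0 addr0.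
have h : cexp (Log (chz k)) + cexp (- Log (1 - chz k)^-1) = 1.
  rewrite cexp_Log// cexpN cexp_Log ?invr_eq0 ?chz_neq1//.
  by rewrite invrK addrC subrK.
rewrite /uu /vv -/(chz k) (shift_vz five); last by rewrite cexpD cexp_tauz mulr1.
rewrite (shift_uz five)// addrAC [_ + Gen _ *~ _ - _]addrAC subrr add0r -!(GenMz five) -(GenD five).
by eexists.
Qed.

(** Every tuple of FT has a lift in \hat FT, whose five-term sum is 0 in the quotient; replacing
    that lift by base points costs an element of the image of \hat chi. *)
Lemma p_Rpre y : Rpre y -> chi_image (p (S y)).
Proof.
move: y; apply: (@Rpre_min (fun y => chi_image (p (S y)))) => [|x y hx hy|t].
- by rewrite !raddf0; exact: chi_image0.
- by rewrite !raddfB; exact: chi_imageB.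
move=> /FT_ftlift[P hP <-]; rewrite -pistar_five_term.
have h : p (five_term (ftlift P)) = 0 by apply/pP/Rhat_five_term; exact: FThat_ftlift.
have := chi_imageB chi_image0 (p_section (five_term (ftlift P))).
by rewrite raddfB /= h !sub0r opprK.
Qed.

Lemma Rpre_pistarP x : Rpre (pistar x) <-> chi_image (p x).
Proof.
split=> [/p_Rpre h|/chi_imageP[z z0 /Rhat_Rpre]]; last first.
  by rewrite raddfB /= pistar_chi_hat// subr0.
rewrite -(subrK (S (pistar x)) x) raddfD; apply: (subgroupD chi_image0 chi_imageB) => //.
exact: p_section.
Qed.

Lemma pistar_section y : pistar (S y) = y.
Proof.
move: y; apply: freeg_generated => [|x y hx hy|z].
- by rewrite !raddf0.
- by rewrite !raddfB /= hx hy.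
by rewrite SE pistarU pihat_mkChat.
Qed.

Context {L : {additive ZC -> C}}.
Hypothesis LR : forall x, Rhat x -> cexp (L x) = 1.
Hypothesis Lchi : forall z, z != 0 -> cexp (L (chi_hat z)) = z.

(** exp L is a left inverse of \hat chi, so an element x of the image is the class of \hat chi(exp(L
    x)). *)
Lemma chi_image_L x : chi_image (p x) -> p x = Gen (2 * L x).
Proof.
move=> [c e]; rewrite e -p_chi_hat_half.
have : Rhat (x - chi_hat (cexp (c / 2))) by apply/pP; rewrite raddfB /= p_chi_hat_half e subrr.
move=> /LR; rewrite raddfB cexpB Lchi ?cexp_neq0// => h.
rewrite p_chi_hat ?cexp_neq0//; apply: Gen_double five _ _ _; rewrite cexp_Log ?cexp_neq0//.
by apply/esym/divr1_eq.
Qed.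

(** Base points alone need not respect the five-term relations. Subtracting the retraction of the
    base point puts it into the kernel of exp L, a complement of the image of \hat chi. *)
Definition splitting (z : @Cx01 R) : ZC :=
  << basepoint z >> - chi_hat (cexp (L << basepoint z >>)).

(** The five-term sum of base points lies in the image of \hat chi, where the retraction is the
    identity, so the corrections cancel it exactly. *)
Lemma splitting_five_term (t : tuple5 (@Cx01 R)) : FT (map5 val t) ->
  Rhat (let: (a, b, c, d, e) := t in
        splitting a - splitting b + splitting c - splitting d + splitting e).
Proof.
move=> ht; have := chi_image_L (p_Rpre (Rpre_five_term ht)).
case: t {ht} => [[[[a b] c] d] e] /eqP; rewrite -subr_eq0 => /eqP h; apply/pP; rewrite -{}h.
have q z : p (splitting z) = p (S << z >>) - Gen (2 * L (S << z >>)).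
  rewrite SE /splitting raddfB /= p_chi_hat ?cexp_neq0//; congr (_ - _).
  by apply: Gen_double five _ _ _; rewrite cexp_Log ?cexp_neq0.
rewrite (raddfD p) (raddfB p) (raddfD p) (raddfB p) !q.
have GD x y : Gen (2 * L (x + y)) = Gen (2 * L x) + Gen (2 * L y).
  by rewrite raddfD /= mulrDr (GenD five).
have GB x y : Gen (2 * L (x - y)) = Gen (2 * L x) - Gen (2 * L y).
  by rewrite raddfB /= mulrBr (GenD five) (GenN five).
rewrite five_term_additive /= GD GB GD GB !(raddfB p, raddfD p).
move: (p _) (p _) (p _) (p _) (p _) (Gen _) (Gen _) (Gen _) (Gen _) (Gen _).
move=> x5 x4 x3 x2 x1 y5 y4 y3 y2 y1.
rewrite !opprD !opprK.
by rewrite (addrACA x1) (addrACA (x1 - x2)) (addrACA (x1 - x2 + x3)) (addrACA (x1 - x2 + x3 - x4)).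
Qed.

Lemma pistar_splitting z : pistar (splitting z) = << z >>.
Proof. by rewrite /splitting raddfB /= pistarU pihat_mkChat pistar_chi_hat ?cexp_neq0// subr0. Qed.

End Quotient.
End ExtendedPreBlochGroup.

Theorem theorem3p4 (R : realType) :
  (* the map induced by pihat is well defined *)
  (forall x : {freeg (@Chat R) / int}, Rhat x -> Rpre (pistar x)) /\
  (* \hat chi : C^x -> \hat P(C) is a group homomorphism *)
  (forall z w : R[i], z != 0 -> w != 0 ->
     Rhat (chi_hat (z * w) - chi_hat z - chi_hat w)) /\
  (* exactness at C^x : \hat chi is injective *)
  (forall z : R[i], z != 0 -> Rhat (chi_hat z) -> z = 1) /\
  (* exactness at \hat P(C) : ker = im \hat chi *)
  (forall x : {freeg (@Chat R) / int},
     Rpre (pistar x) <-> exists2 z : R[i], z != 0 & Rhat (x - chi_hat z)) /\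
  (* exactness at P(C) : surjectivity *)
  (forall y : {freeg (@Cx01 R) / int}, exists x, Rpre (pistar x - y)) /\
  (* splitting : a homomorphism s : P(C) -> \hat P(C) with pi o s = id *)
  (exists sigma : @Cx01 R -> {freeg (@Chat R) / int},
     (forall t : tuple5 (@Cx01 R), FT (map5 val t) ->
        Rhat (let: (a, b, c, d, e) := t in
              sigma a - sigma b + sigma c - sigma d + sigma e)) /\
     (forall z : @Cx01 R, Rpre (pistar (sigma z) - << z >>))).
Proof.
have [V [p pP]] := zmod_quotient (@Rhat0 R) (@RhatB R).
have [S SE] := freeg_extend (fun z : @Cx01 R => << basepoint z >> : {freeg (@Chat R) / int}).
have [L [LR Lchi]] := @regulator R.
split; first exact: Rhat_Rpre.
split; first exact: chi_hat_morph pP.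
split; first by move=> z z0 /LR; rewrite Lchi.
split; first by move=> x; rewrite (Rpre_pistarP pP SE); exact: chi_imageP.
split; first by move=> y; exists (S y); rewrite (pistar_section SE) subrr; exact: Rpre0.
exists (splitting (L := L)); split; first exact: (splitting_five_term pP SE LR Lchi).
by move=> z; rewrite pistar_splitting subrr; exact: Rpre0.
Qed.
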